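(* Let $\{Q_{j,k}\}_{j,k\ge 0}$ be a doubly indexed sequence of holomorphic functions on $\mathbb{D}_e=\{z\in\mathbb{C}:|z|>1\}$. Then the following are equivalent. (1) The functions $Q_{j,k}$ are the coordinates of a point $\psi+\mathbb{C}\in\Sigma/\mathbb{C}$, i.e. there is $\psi\in\Sigma$ such that, with $Q_e(z,w)=\log\frac{\psi(z)-\psi(w)}{z-w}$, one has $Q_{j,k}(z)=(\partial_z^j\partial_w^kQ_e)(z,z)$ for all $z\in\mathbb{D}_e$ and all $j,k=0,1,2,\dots$. (2) Conditions (a), (b), (c), (d) below all hold. (3) Conditions (a), (b), (c'), (d) below all hold. Here: (a) For all $j,k\ge0$, $|Q_{j,k}(z)|=O(|z|^{-j-k-2})$ as $|z|\to+\infty$. (b) The sequence is symmetric, $Q_{j,k}=Q_{k,j}$ for all $j,k\ge 0$, and forms a consistent system: $Q_{j,k}'(z)=Q_{j+1,k}(z)+Q_{j,k+1}(z)$ for all $z\in\mathbb{D}_e$, $j,k\ge0$. (c) (jet nonlinear wave equation) For each $k=0,1,2,\dots$, on $\mathbb{D}_e$, $$Q_{k+2,0}-(k+2)Q_{k+1,1}-(k+1)\sum_{l=0}^{k}\binom{k}{l}Q_{l,1}\,Q_{k+1-l,0}=0 .$$ (c') (jet Riccati equation) On $\mathbb{D}_e$, $Q_{1,0}'-3Q_{1,1}-(Q_{1,0})^2=0$, and for each $k=1,2,3,\dots$, $$Q_{k,1}'-\frac{k+3}{k+1}Q_{k+1,1}+\sum_{l=1}^{k-1}\binom{k}{l}Q_{k-l,1}\,Q_{l,1}=0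 .$$ (d) For all integers $m,n\ge1$ the limit $$\gamma_{m,n}=\lim_{|z|\to+\infty}\mathrm{d}_{\langle j\rangle}^{m-1}\mathrm{d}_{\langle k\rangle}^{n-1}\Big(\frac{(-1)^{j+k}}{j!\,k!}z^{j+k+m+n}Q_{j,k}(z)\Big)$$ exists (finitely) and is independent of the point $(j,k)\in(\mathbb{Z}_{\ge0})^2$ at which the right-hand side is evaluated, and for each $\epsilon>0$ one has $|\gamma_{m,n}|=O((1+\epsilon)^{m+n})$ uniformly in $m,n$.
   Context: $\Sigma$ is the class of univalent (injective holomorphic) functions $\psi:\mathbb{D}_e\to\mathbb{C}$ with Laurent expansion $\psi(z)=z+b_0+b_1z^{-1}+b_2z^{-2}+\cdots$. $\Sigma/\mathbb{C}$ is the set of equivalence classes of $\Sigma$ modulo additive constants. For $\psi\in\Sigma$, $Q_e(z,w)=\log\frac{\psi(z)-\psi(w)}{z-w}$ is the holomorphic function on $\mathbb{D}_e^2$ (the quotient being read as $\psi'(z)$ when $z=w$) obtained from the branch of the logarithm which vanishes when $z=\infty$ or $w=\infty$; it is the Dirichlet symbol of the Grunsky operator of $\psi$ and depends only on $\psi+\mathbb{C}$. The finite difference operators act on functions $f(j,k)$ of integers $j,k\ge 0$ by $\mathrm{d}_{\langle j\rangle}f(j,k)=f(j+1,k)-f(j,k)$ and $\mathrm{d}_{\langle k\rangle}f(j,k)=f(j,k+1)-f(j,k)$; in (d), $m,n,z$ are held fixed while the differences are taken in $j$ and $k$. Empty sums are $0$. *)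

(* Defs.v *)
From Stdlib Require Export Reals Factorial.
From Coquelicot Require Export Coquelicot.

Open Scope C_scope.

Definition De (z : C) : Prop := (1 < Cmod z)%R.

(* The filter of neighbourhoods of infinity: [filterlim f C_infty F] says that
   [f z] tends to [F] as |z| tends to +oo. *)
Definition C_infty (P : C -> Prop) : Prop :=
  exists M : R, forall z : C, (M < Cmod z)%R -> P z.

Global Instance C_infty_filter : ProperFilter C_infty.
Proof.
constructor.
- intros P [M HM]. exists (RtoC (Rabs M + 1)). apply HM.
  rewrite Cmod_R, Rabs_pos_eq.
  + apply Rle_lt_trans with (1 := Rle_abs M), Rlt_plus_1.
  + apply Rplus_le_le_0_compat; [apply Rabs_pos | apply Rle_0_1].
- constructor.
  + exists 0%R; auto.
  + intros P Q [M HM] [N HN]. exists (Rmax M N). intros z Hz.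
    split; [apply HM | apply HN];
      apply Rle_lt_trans with (2 := Hz); [apply Rmax_l | apply Rmax_r].
  + intros P Q HPQ [M HM]. exists M; auto.
Qed.

Definition holomorphic_De (f : C -> C) : Prop :=
  forall z : C, De z -> ex_derive (K := C_AbsRing) (V := C_NormedModule) f z.

(* Complex Frechet differentiability at every point of De x De. *)
Definition holomorphic_De2 (F : C -> C -> C) : Prop :=
  forall z w : C, De z -> De w ->
    ex_filterdiff (K := C_AbsRing)
      (U := prod_NormedModule C_AbsRing C_NormedModule C_NormedModule)
      (V := C_NormedModule)
      (fun p => F (fst p) (snd p))
      (locally (T := prod_NormedModule C_AbsRing C_NormedModule C_NormedModule) (z, w)).

Definition Cexp (z : C) : C := (exp (Re z) * cos (Im z), exp (Re z) * sin (Im z))%R.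

Definition Sigma (psi : C -> C) : Prop :=
  holomorphic_De psi /\
  (forall z w : C, De z -> De w -> psi z = psi w -> z = w) /\
  exists b : nat -> C, forall z : C, De z ->
    is_pseries (K := C_AbsRing) (V := C_NormedModule) b (/ z) (psi z - z).

(* [Qe] is the holomorphic function log ((psi z - psi w) / (z - w)) on De x De,
   for the branch of the logarithm that vanishes at z = oo and at w = oo.  Being
   a branch of the logarithm of a function h means Cexp Qe = h; on the connected
   set De x De these conditions determine Qe uniquely. *)
Definition Grunsky_symbol (psi : C -> C) (Qe : C -> C -> C) : Prop :=
  holomorphic_De2 Qe /\
  (forall z w : C, De z -> De w -> z <> w ->
     Cexp (Qe z w) = (psi z - psi w) / (z - w)) /\
  (forall z : C, De z -> Cexp (Qe z z) = C_derive psi z) /\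
  (forall w : C, De w -> filterlim (fun z => Qe z w) C_infty (locally (RtoC 0))) /\
  (forall z : C, De z -> filterlim (fun w => Qe z w) C_infty (locally (RtoC 0))).

Definition C_derive_n (n : nat) (f : C -> C) : C -> C := Nat.iter n C_derive f.

Definition dpartial (j k : nat) (F : C -> C -> C) (z w : C) : C :=
  C_derive_n j (fun z' => C_derive_n k (fun w' => F z' w') w) z.

Definition jet_coordinates (Q : nat -> nat -> C -> C) : Prop :=
  exists psi : C -> C, Sigma psi /\
  exists Qe : C -> C -> C, Grunsky_symbol psi Qe /\
    forall (j k : nat) (z : C), De z -> Q j k z = dpartial j k Qe z z.

Definition cond_a (Q : nat -> nat -> C -> C) : Prop :=
  forall j k : nat, exists A : R,
    C_infty (fun z => Cmod (Q j k z) <= A * / Cmod z ^ (j + k + 2))%R.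

Definition cond_b (Q : nat -> nat -> C -> C) : Prop :=
  (forall (j k : nat) (z : C), De z -> Q j k z = Q k j z) /\
  (forall (j k : nat) (z : C), De z ->
     C_derive (Q j k) z = Q (S j) k z + Q j (S k) z).

Definition binom (n p : nat) : C := RtoC (Binomial.C n p).

Definition cond_c (Q : nat -> nat -> C -> C) : Prop :=
  forall (k : nat) (z : C), De z ->
    Q (k + 2)%nat 0%nat z - RtoC (INR (k + 2)) * Q (k + 1)%nat 1%nat z
    - RtoC (INR (k + 1)) *
      sum_n (G := C_AbelianGroup)
        (fun l => binom k l * Q l 1%nat z * Q (k + 1 - l)%nat 0%nat z) k
    = 0.

(* For k = 1 the sum, over 1 <= l <= 0, is 0. *)
Definition cond_c' (Q : nat -> nat -> C -> C) : Prop :=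
  (forall z : C, De z ->
     C_derive (Q 1%nat 0%nat) z - 3 * Q 1%nat 1%nat z - (Q 1%nat 0%nat z) ^ 2 = 0) /\
  (forall (k : nat) (z : C), (1 <= k)%nat -> De z ->
     C_derive (Q k 1%nat) z
     - RtoC (INR (k + 3)) / RtoC (INR (k + 1)) * Q (k + 1)%nat 1%nat z
     + sum_n_m (G := C_AbelianGroup)
         (fun l => binom k l * Q (k - l)%nat 1%nat z * Q l 1%nat z) 1 (k - 1)
     = 0).

Definition diff_j (f : nat -> nat -> C) (j k : nat) : C := f (S j) k - f j k.
Definition diff_k (f : nat -> nat -> C) (j k : nat) : C := f j (S k) - f j k.

Definition diff_expr (Q : nat -> nat -> C -> C) (m n j k : nat) (z : C) : C :=
  Nat.iter (m - 1) diff_j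
    (Nat.iter (n - 1) diff_k
       (fun j' k' => (-1) ^ (j' + k') / (RtoC (INR (fact j')) * RtoC (INR (fact k')))
                     * z ^ (j' + k' + m + n) * Q j' k' z)) j k.

Definition cond_d (Q : nat -> nat -> C -> C) : Prop :=
  exists gamma : nat -> nat -> C,
    (forall m n j k : nat, (1 <= m)%nat -> (1 <= n)%nat ->
       filterlim (diff_expr Q m n j k) C_infty (locally (gamma m n))) /\
    (forall eps : R, (0 < eps)%R -> exists A : R,
       forall m n : nat, (1 <= m)%nat -> (1 <= n)%nat ->
         (Cmod (gamma m n) <= A * (1 + eps) ^ (m + n))%R).

(* Main.v *)
(* The Grunsky symbol of [psi] is a double Laurent series
   [Q z w = sum a_mn z^-m w^-n] with [m, n >= 1], symmetric and with subexponential
   coefficients, and (a), (b), (d) characterize its diagonal jets: finite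
   differences in (j, k) of the Laurent coefficients of the Q_jk isolate the a_mn.
   It remains to characterize the symbols among such series.  Put
   [h z w = (z - w) exp (Q z w)].  Then [Q] is a Grunsky symbol iff
   [h z w = psi z - psi w] for some [psi], iff [dh/dw] depends on [w] only; at
   [z = w] its value is then [- exp (Q w w)].  This condition is equivalent to
   [d^2 h / dz dw = 0], whose Taylor coefficients in [z] at [z = w] are the jet wave
   equations (c), and to [d^2 h / dw^2 = (d/dw Q(w, w)) dh/dw], whose Taylor
   coefficients in [z] at [z = w] are the jet Riccati equations (c').
   Taylor expansions on a disc come from Cauchy's formula for functions with a
   continuous complex derivative, which suffices here: the derivative of the symbol
   is an explicit quotient, and (b) makes the Q_jk infinitely differentiable. *)

Require Import Defs.
From Stdlib Require Import Lra Lia Psatz ClassicalEpsilon Wf_nat.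

(** * Complex derivatives, continuity and the exponential *)

(** Conditions (a) and (b) do not say that the [Q_jk] are the jets of one function of two variables,
    and nothing converges off the diagonal a priori. The numbers [gamma] of (d) supply the candidate
    series, and their growth bound its convergence on all of De x De. That the [Q_jk] are its jets
    is a rigidity statement: by (b) the normalized Laurent coefficients obey a recursion in (j, k),
    and by (d) enough of their differences agree with those of the candidate.

    The equations (c) and (c') live on the diagonal, and a Taylor expansion at z = w reaches only a
    disc inside De. In the coordinates x = 1/z, y = 1/w the functions concerned extend to the whole
    bidisc after multiplication by x y, and the identity theorem applies there. Infinity becomes x =
    0 or y = 0, and the behaviour there fixes every constant of integration, including the branch of
    the logarithm, which is obtained by integrating a logarithmic derivative. Univalence comes last
    and for free: (z - w) exp Q vanishes only at z = w. *)

Definition is_C_derive (f : C -> C) (x l : C) : Prop :=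
  is_derive (K := C_AbsRing) (V := C_NormedModule) f x l.

Lemma is_C_derive_eps (f : C -> C) (x l : C) :
  is_C_derive f x l <->
  forall eps : R, (0 < eps)%R -> exists d : R, (0 < d)%R /\
    forall y, (Cmod (y - x) < d)%R ->
      (Cmod (f y - f x - (y - x) * l) <= eps * Cmod (y - x))%R.
Proof.
split.
- intros [_ H] eps He.
  assert (Hx : is_filter_lim (locally (T := AbsRing_UniformSpace C_AbsRing) x) x)
    by now intros P HP.
  destruct (H x Hx (mkposreal eps He)) as [d Hd].
  exists d; split; [apply cond_pos|].
  intros y Hy. exact (Hd y Hy).
- intros H; split; [apply is_linear_scal_l|].
  intros x' Hx'. apply (is_filter_lim_locally_unique (V := AbsRing_NormedModule C_AbsRing)) in Hx'.
  rewrite <- Hx'.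
  intros eps. destruct (H eps (cond_pos eps)) as [d [Hd0 Hd]].
  exists (mkposreal d Hd0). intros y Hy. exact (Hd y Hy).
Qed.

(** The product and chain rules are stated for [C] as a module over itself, with the discs of [Cmod]
    as balls, while [C_NormedModule] carries the product uniformity of R x R. Both notions of
    derivative reduce to the same epsilon statement. *)
Lemma is_C_derive_ring (f : C -> C) (x l : C) :
  is_C_derive f x l <-> @is_derive C_AbsRing (AbsRing_NormedModule C_AbsRing) f x l.
Proof.
rewrite is_C_derive_eps; split.
- intros H; split; [apply is_linear_scal_l|].
  intros x' Hx'. apply (is_filter_lim_locally_unique (V := AbsRing_NormedModule C_AbsRing)) in Hx'.
  rewrite <- Hx'.
  intros eps. destruct (H eps (cond_pos eps)) as [d [Hd0 Hd]].
  exists (mkposreal d Hd0). intros y Hy. exact (Hd y Hy).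
- intros [_ H] eps He.
  assert (Hx : is_filter_lim (locally (T := AbsRing_UniformSpace C_AbsRing) x) x)
    by now intros P HP.
  destruct (H x Hx (mkposreal eps He)) as [d Hd].
  exists d; split; [apply cond_pos|].
  intros y Hy. exact (Hd y Hy).
Qed.

Lemma is_C_derive_ext_loc (f g : C -> C) (x l : C) (d : R) :
  (0 < d)%R -> (forall y, (Cmod (y - x) < d)%R -> f y = g y) ->
  is_C_derive f x l -> is_C_derive g x l.
Proof.
intros Hd E H. apply (is_derive_ext_loc f g); [|exact H].
exists (mkposreal d Hd). intros y Hy. apply E, Hy.
Qed.

Lemma is_C_derive_eq (f : C -> C) (x l l' : C) :
  is_C_derive f x l -> l = l' -> is_C_derive f x l'.
Proof. now intros H <-. Qed.

Lemma is_C_derive_const (c x : C) : is_C_derive (fun _ => c) x 0.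
Proof. apply (is_derive_const (K := C_AbsRing) (V := C_NormedModule)). Qed.

Lemma is_C_derive_id (x : C) : is_C_derive (fun y => y) x 1.
Proof. apply is_C_derive_ring, (is_derive_id (K := C_AbsRing)). Qed.

Lemma is_C_derive_plus (f g : C -> C) (x a b : C) :
  is_C_derive f x a -> is_C_derive g x b -> is_C_derive (fun y => f y + g y) x (a + b).
Proof. apply (is_derive_plus (K := C_AbsRing) (V := C_NormedModule)). Qed.

Lemma is_C_derive_opp (f : C -> C) (x a : C) :
  is_C_derive f x a -> is_C_derive (fun y => - f y) x (- a).
Proof. apply (is_derive_opp (K := C_AbsRing) (V := C_NormedModule)). Qed.

Lemma is_C_derive_minus (f g : C -> C) (x a b : C) :
  is_C_derive f x a -> is_C_derive g x b -> is_C_derive (fun y => f y - g y) x (a - b).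
Proof. apply (is_derive_minus (K := C_AbsRing) (V := C_NormedModule)). Qed.

Lemma is_C_derive_mult (f g : C -> C) (x a b : C) :
  is_C_derive f x a -> is_C_derive g x b ->
  is_C_derive (fun y => f y * g y) x (a * g x + f x * b).
Proof.
intros Hf%is_C_derive_ring Hg%is_C_derive_ring. apply is_C_derive_ring.
apply (is_derive_mult (K := C_AbsRing)); [exact Hf|exact Hg|exact Cmult_comm].
Qed.

Lemma is_C_derive_scal (f : C -> C) (x a c : C) :
  is_C_derive f x a -> is_C_derive (fun y => c * f y) x (c * a).
Proof.
intros H. eapply is_C_derive_eq.
- apply is_C_derive_mult; [apply is_C_derive_const|exact H].
- cbv beta; ring.
Qed.

Lemma is_C_derive_comp (f g : C -> C) (x a b : C) :
  is_C_derive f (g x) a -> is_C_derive g x b ->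
  is_C_derive (fun y => f (g y)) x (b * a).
Proof.
intros Hf Hg%is_C_derive_ring.
exact (is_derive_comp (K := C_AbsRing) (V := C_NormedModule) f g x a b Hf Hg).
Qed.

Lemma is_C_derive_uniq (f : C -> C) (x a b : C) :
  is_C_derive f x a -> is_C_derive f x b -> a = b.
Proof.
intros H1 H2. apply is_C_derive_unique in H1. apply is_C_derive_unique in H2. congruence.
Qed.

Lemma Cmod_minus_sym (x y : C) : Cmod (x - y) = Cmod (y - x).
Proof. rewrite <- Cmod_opp. f_equal. ring. Qed.

Lemma Cmod_triangle_rev (x y : C) : (Cmod x - Cmod y <= Cmod (x - y))%R.
Proof.
assert (H := Cmod_triangle (x - y) y). replace (x - y + y) with x in H by ring. lra.
Qed.

Lemma Cmod_minus_le (x y : C) : (Cmod (x - y) <= Cmod x + Cmod y)%R.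
Proof. rewrite <- (Cmod_opp y). apply Cmod_triangle. Qed.

Lemma fst_le_Cmod (x : C) : (Rabs (fst x) <= Cmod x)%R.
Proof. eapply Rle_trans; [apply Rmax_l|apply Rmax_Cmod]. Qed.

Lemma snd_le_Cmod (x : C) : (Rabs (snd x) <= Cmod x)%R.
Proof. eapply Rle_trans; [apply Rmax_r|apply Rmax_Cmod]. Qed.

Lemma Cmod_le_fst_snd (x : C) : (Cmod x <= Rabs (fst x) + Rabs (snd x))%R.
Proof.
replace x with (RtoC (fst x) + Ci * RtoC (snd x)) at 1.
- eapply Rle_trans; [apply Cmod_triangle|].
  rewrite Cmod_mult, Cmod_Ci, !Cmod_R. lra.
- destruct x as [a b]; unfold Ci, RtoC, Cplus, Cmult; simpl; f_equal; ring.
Qed.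

Lemma Cmod_eq0_eps (x : C) : (forall eps : R, (0 < eps)%R -> (Cmod x <= eps)%R) -> x = 0.
Proof.
intros H. apply Cmod_eq_0. apply Rle_antisym; [|apply Cmod_ge_0].
apply le_epsilon. intros eps He. rewrite Rplus_0_l. now apply H.
Qed.

Lemma continuous_Cmod {T : UniformSpace} (f : T -> C) (p : T) :
  continuous f p <->
  forall eps : R, (0 < eps)%R -> locally p (fun q => (Cmod (f q - f p) < eps)%R).
Proof.
split.
- intros H eps He.
  assert (He2 : (0 < eps / 2)%R) by lra.
  assert (HL := proj1 (filterlim_locally f (f p)) H (mkposreal _ He2)).
  eapply filter_imp; [|exact HL]. intros q [H1 H2].
  eapply Rle_lt_trans; [apply Cmod_le_fst_snd|].
  change (Rabs (fst (f q) - fst (f p)) < eps / 2)%R in H1.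
  change (Rabs (snd (f q) - snd (f p)) < eps / 2)%R in H2.
  change (Rabs (fst (f q) - fst (f p)) + Rabs (snd (f q) - snd (f p)) < eps)%R. lra.
- intros H. apply filterlim_locally. intros eps.
  eapply filter_imp; [|exact (H eps (cond_pos eps))]. intros q Hq; split.
  + change (Rabs (fst (f q) - fst (f p)) < eps)%R.
    eapply Rle_lt_trans; [|exact Hq]. apply (fst_le_Cmod (f q - f p)).
  + change (Rabs (snd (f q) - snd (f p)) < eps)%R.
    eapply Rle_lt_trans; [|exact Hq]. apply (snd_le_Cmod (f q - f p)).
Qed.

Notation C2 := (prod_UniformSpace C_UniformSpace C_UniformSpace).

(** Balls of the product uniformity are squares; the factor [sqrt 2] compares a square with the disc
    around it. *)
Lemma locally_C (x : C) (P : C -> Prop) :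
  locally (T := C_UniformSpace) x P <->
  exists d : R, (0 < d)%R /\ forall y, (Cmod (y - x) < d)%R -> P y.
Proof.
split.
- intros [d Hd]. exists d; split; [apply cond_pos|].
  intros y Hy. apply Hd, C_NormedModule_mixin_compat1, Hy.
- intros [d [Hd0 Hd]].
  assert (Hs : (0 < sqrt 2)%R) by (apply sqrt_lt_R0; lra).
  assert (He : (0 < d / sqrt 2)%R) by now apply Rdiv_lt_0_compat.
  exists (mkposreal _ He). intros y Hy. apply Hd.
  apply C_NormedModule_mixin_compat2 in Hy. simpl in Hy.
  replace (sqrt 2 * (d / sqrt 2))%R with d in Hy by (field; lra). exact Hy.
Qed.

Lemma locally_C2 (x y : C) (P : C * C -> Prop) :
  locally (T := C2) (x, y) P <->
  exists d : R, (0 < d)%R /\ forall x' y', (Cmod (x' - x) < d)%R ->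
    (Cmod (y' - y) < d)%R -> P (x', y').
Proof.
split.
- intros [d Hd]. exists d; split; [apply cond_pos|].
  intros x' y' Hx Hy. apply Hd. split; apply C_NormedModule_mixin_compat1; assumption.
- intros [d [Hd0 Hd]].
  assert (Hs : (0 < sqrt 2)%R) by (apply sqrt_lt_R0; lra).
  assert (He : (0 < d / sqrt 2)%R) by now apply Rdiv_lt_0_compat.
  exists (mkposreal _ He). intros [x' y'] [Hx Hy].
  apply C_NormedModule_mixin_compat2 in Hx, Hy. simpl in Hx, Hy.
  replace (sqrt 2 * (d / sqrt 2))%R with d in Hx, Hy by (field; lra).
  now apply Hd.
Qed.

Lemma continuous_Cplus {T : UniformSpace} (f g : T -> C) (p : T) :
  continuous f p -> continuous g p -> continuous (fun q => f q + g q) p.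
Proof. apply (continuous_plus (V := C_NormedModule)). Qed.

Lemma continuous_Copp {T : UniformSpace} (f : T -> C) (p : T) :
  continuous f p -> continuous (fun q => - f q) p.
Proof. apply (continuous_opp (V := C_NormedModule)). Qed.

Lemma continuous_Cminus {T : UniformSpace} (f g : T -> C) (p : T) :
  continuous f p -> continuous g p -> continuous (fun q => f q - g q) p.
Proof. apply (continuous_minus (V := C_NormedModule)). Qed.

Lemma continuous_Cmult {T : UniformSpace} (f g : T -> C) (p : T) :
  continuous f p -> continuous g p -> continuous (fun q => f q * g q) p.
Proof.
rewrite !continuous_Cmod. intros Hf Hg eps He.
set (M := (Cmod (f p) + Cmod (g p) + 1)%R).
assert (HM : (1 <= M)%R).
{ unfold M. assert (H1 := Cmod_ge_0 (f p)). assert (H2 := Cmod_ge_0 (g p)). lra. }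
set (e := Rmin 1 (eps / (2 * M))).
assert (H0 : (0 < eps / (2 * M))%R) by (apply Rdiv_lt_0_compat; lra).
assert (He' : (0 < e)%R) by (apply Rmin_pos; lra).
generalize (filter_and _ _ (Hf e He') (Hg e He')). apply filter_imp.
intros q [H1 H2].
replace (f q * g q - f p * g p) with ((f q - f p) * g q + f p * (g q - g p)) by ring.
eapply Rle_lt_trans; [apply Cmod_triangle|]. rewrite !Cmod_mult.
assert (H3 : (Cmod (g q) <= M)%R).
{ assert (H := Cmod_triangle_rev (g q) (g p)). assert (Ha := Rmin_l 1 (eps / (2 * M))).
  assert (H5 := Cmod_ge_0 (f p)). unfold M. fold e in Ha. lra. }
assert (H4 : (Cmod (f p) <= M)%R).
{ assert (H5 := Cmod_ge_0 (g p)). unfold M. lra. }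
assert (Hb : (e <= eps / (2 * M))%R) by apply Rmin_r.
assert (Hc : (e * M <= eps / 2)%R).
{ apply Rle_trans with (eps / (2 * M) * M)%R; [apply Rmult_le_compat_r; lra|].
  right; field; lra. }
assert (P1 := Cmod_ge_0 (f q - f p)). assert (P2 := Cmod_ge_0 (g q - g p)).
assert (P3 := Cmod_ge_0 (g q)). assert (P4 := Cmod_ge_0 (f p)).
assert (Cmod (f q - f p) * Cmod (g q) <= Cmod (f q - f p) * M)%R by (apply Rmult_le_compat_l; lra).
assert (Cmod (f p) * Cmod (g q - g p) <= M * Cmod (g q - g p))%R by (apply Rmult_le_compat_r; lra).
assert (Cmod (f q - f p) * M < e * M)%R by (apply Rmult_lt_compat_r; lra).
assert (M * Cmod (g q - g p) < M * e)%R by (apply Rmult_lt_compat_l; lra).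
lra.
Qed.

Lemma continuous_Cinv_id (x : C) : x <> 0 -> continuous Cinv x.
Proof.
intros Hx. apply continuous_Cmod. intros eps He. apply locally_C.
assert (Hp : (0 < Cmod x)%R) by now apply Cmod_gt_0.
set (d := Rmin (Cmod x / 2) (eps * (Cmod x * Cmod x) / 2)).
assert (Hd : (0 < d)%R).
{ apply Rmin_pos; [lra|]. apply Rdiv_lt_0_compat; [|lra].
  apply Rmult_lt_0_compat; [lra|]. now apply Rmult_lt_0_compat. }
exists d; split; [exact Hd|]. intros y Hy.
assert (H1 := Cmod_triangle_rev x y). rewrite Cmod_minus_sym in H1.
assert (Ha : (d <= Cmod x / 2)%R) by apply Rmin_l.
assert (Hb : (d <= eps * (Cmod x * Cmod x) / 2)%R) by apply Rmin_r.
assert (Hyp : (Cmod x / 2 < Cmod y)%R) by lra.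
assert (Hy0 : y <> 0) by (apply Cmod_gt_0; lra).
replace (/ y - / x) with ((x - y) / (x * y)) by (field; auto).
rewrite Cmod_div by (apply Cmult_neq_0; auto).
rewrite Cmod_mult, (Cmod_minus_sym x y).
apply Rmult_lt_reg_r with (Cmod x * Cmod y)%R; [apply Rmult_lt_0_compat; lra|].
unfold Rdiv. rewrite Rmult_assoc, Rinv_l, Rmult_1_r.
- eapply Rlt_le_trans; [exact Hy|]. eapply Rle_trans; [exact Hb|].
  apply Rle_trans with (eps * (Cmod x * (Cmod x / 2)))%R; [right; field|].
  apply Rmult_le_compat_l; [lra|]. apply Rmult_le_compat_l; lra.
- apply Rgt_not_eq, Rmult_lt_0_compat; lra.
Qed.

Lemma continuous_Cinv {T : UniformSpace} (f : T -> C) (p : T) :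
  continuous f p -> f p <> 0 -> continuous (fun q => / f q) p.
Proof.
intros Hf H0. apply (continuous_comp f Cinv); [exact Hf|]. now apply continuous_Cinv_id.
Qed.

Lemma is_C_derive_continuous (f : C -> C) (x l : C) : is_C_derive f x l -> continuous f x.
Proof.
intros H. rewrite is_C_derive_eps in H. apply continuous_Cmod. intros eps He. apply locally_C.
destruct (H 1%R Rlt_0_1) as [d [Hd0 Hd]].
set (M := (1 + Cmod l)%R). assert (HM : (1 <= M)%R) by (unfold M; assert (P := Cmod_ge_0 l); lra).
exists (Rmin d (eps / M)); split.
- apply Rmin_pos; [lra|]. apply Rdiv_lt_0_compat; lra.
- intros y Hy.
  assert (H1 := Hd y (Rlt_le_trans _ _ _ Hy (Rmin_l _ _))).
  assert (H2 := Rlt_le_trans _ _ _ Hy (Rmin_r _ _)).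
  assert (H3 := Cmod_triangle_rev (f y - f x) ((y - x) * l)).
  rewrite Cmod_mult in H3.
  apply Rle_lt_trans with (M * Cmod (y - x))%R; [unfold M; lra|].
  apply Rlt_le_trans with (M * (eps / M))%R; [apply Rmult_lt_compat_l; lra|].
  right; field; lra.
Qed.

(** Caratheodory's criterion. It suits functions whose difference quotient is explicit, such as
    [Cinv] and the univalent function itself. *)
Lemma is_C_derive_factor (f q : C -> C) (x : C) (d : R) :
  (0 < d)%R -> (forall y, (Cmod (y - x) < d)%R -> f y - f x = (y - x) * q y) ->
  continuous q x -> is_C_derive f x (q x).
Proof.
intros Hd Hf Hq. apply is_C_derive_eps. intros eps He.
rewrite continuous_Cmod in Hq. destruct (proj1 (locally_C _ _) (Hq eps He)) as [d' [Hd' H]].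
exists (Rmin d d'); split; [now apply Rmin_pos|].
intros y Hy. rewrite Hf by (eapply Rlt_le_trans; [exact Hy|apply Rmin_l]).
replace ((y - x) * q y - (y - x) * q x) with ((q y - q x) * (y - x)) by ring.
rewrite Cmod_mult. apply Rmult_le_compat_r; [apply Cmod_ge_0|].
left. apply H. eapply Rlt_le_trans; [exact Hy|apply Rmin_r].
Qed.

Lemma is_C_derive_Cinv (x : C) : x <> 0 -> is_C_derive Cinv x (- (/ x * / x)).
Proof.
intros Hx. assert (Hp : (0 < Cmod x)%R) by now apply Cmod_gt_0.
eapply is_C_derive_eq.
- apply (is_C_derive_factor _ (fun y => - (/ y * / x)) _ (Cmod x) Hp).
  + intros y Hy.
    assert (Hy0 : y <> 0).
    { intros ->. rewrite Cmod_minus_sym in Hy. replace (x - 0) with x in Hy by ring. lra. }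
    field; auto.
  + apply continuous_Copp, continuous_Cmult; [now apply continuous_Cinv_id|apply continuous_const].
- reflexivity.
Qed.

Lemma is_C_derive_inv (f : C -> C) (x a : C) :
  is_C_derive f x a -> f x <> 0 ->
  is_C_derive (fun y => / f y) x (- (a * (/ f x * / f x))).
Proof.
intros Hf H0. eapply is_C_derive_eq.
- apply (is_C_derive_comp Cinv f); [apply is_C_derive_Cinv, H0|exact Hf].
- cbv beta; ring.
Qed.

(** * The complex exponential *)

Lemma Cexp_plus (z w : C) : Cexp (z + w) = Cexp z * Cexp w.
Proof.
destruct z as [a b], w as [c d]. unfold Cexp, Cplus, Cmult; simpl.
rewrite exp_plus, cos_plus, sin_plus. f_equal; ring.
Qed.

Lemma Cexp_0 : Cexp 0 = 1.
Proof. unfold Cexp; simpl. rewrite exp_0, cos_0, sin_0. unfold RtoC; f_equal; ring. Qed.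

Lemma Cexp_neq_0 (z : C) : Cexp z <> 0.
Proof.
intros H. assert (H1 : Cexp (z + - z) = 1) by (rewrite Cplus_opp_r; apply Cexp_0).
rewrite Cexp_plus, H in H1. apply (f_equal fst) in H1. simpl in H1. lra.
Qed.

Lemma Cexp_opp (z : C) : Cexp (- z) = / Cexp z.
Proof.
assert (H1 : Cexp (z + - z) = 1) by (rewrite Cplus_opp_r; apply Cexp_0).
rewrite Cexp_plus in H1. assert (H := Cexp_neq_0 z).
replace (Cexp (- z)) with (Cexp z * Cexp (- z) * / Cexp z) by (field; exact H).
rewrite H1. ring.
Qed.

Lemma little_o_of_derive (f : R -> R) (l : R) : is_derive f 0 l ->
  forall eps : R, (0 < eps)%R -> exists d : R, (0 < d)%R /\
    forall h, (Rabs h < d -> Rabs (f h - f 0 - h * l) <= eps * Rabs h)%R.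
Proof.
intros [_ H] eps He.
assert (Hx : is_filter_lim (locally (T := R_UniformSpace) 0%R) 0%R) by now intros P HP.
destruct (H 0%R Hx (mkposreal eps He)) as [d Hd].
exists d; split; [apply cond_pos|].
intros h Hh. specialize (Hd h).
replace (h * l)%R with ((h - 0) * l)%R by ring.
assert (Hb : ball (M := R_UniformSpace) 0%R d h).
{ change (Rabs (h - 0) < d)%R. now rewrite Rminus_0_r. }
assert (HH := Hd Hb). change (Rabs (f h - f 0 - (h - 0) * l) <= eps * Rabs (h - 0))%R in HH.
now rewrite (Rminus_0_r h) in HH |- *.
Qed.

Lemma is_C_derive_Cexp_0 : is_C_derive Cexp 0 1.
Proof.
apply is_C_derive_eps. intros eps He.
(* The four error terms [K1] to [K4] cost 1, 3, 3 and 2 sixteenths of [eps |h|]; the factor 3 bounds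
   [exp a] for [a <= 1]. *)
assert (He' : (0 < eps / 16)%R) by lra.
destruct (little_o_of_derive exp 1) with (eps / 16)%R as [d1 [P1 H1]]; [|lra|].
{ auto_derive; [auto|rewrite exp_0; ring]. }
destruct (little_o_of_derive cos 0) with (eps / 16)%R as [d2 [P2 H2]]; [|lra|].
{ auto_derive; [auto|rewrite sin_0; ring]. }
destruct (little_o_of_derive sin 1) with (eps / 16)%R as [d3 [P3 H3]]; [|lra|].
{ auto_derive; [auto|rewrite cos_0; ring]. }
set (d := Rmin (Rmin 1 (eps / 16)) (Rmin d1 (Rmin d2 d3))).
assert (Hd : (0 < d)%R) by (repeat apply Rmin_pos; lra).
assert (Hda : (d <= 1 /\ d <= eps / 16 /\ d <= d1 /\ d <= d2 /\ d <= d3)%R).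
{ unfold d. repeat split.
  - eapply Rle_trans; [apply Rmin_l|apply Rmin_l].
  - eapply Rle_trans; [apply Rmin_l|apply Rmin_r].
  - eapply Rle_trans; [apply Rmin_r|apply Rmin_l].
  - eapply Rle_trans; [apply Rmin_r|]. eapply Rle_trans; [apply Rmin_r|apply Rmin_l].
  - eapply Rle_trans; [apply Rmin_r|]. eapply Rle_trans; [apply Rmin_r|apply Rmin_r]. }
exists d; split; [exact Hd|].
intros h Hh. replace (h - 0) with h in Hh |- * by ring.
rewrite Cexp_0. set (m := Cmod h) in *.
assert (Ha := fst_le_Cmod h). assert (Hb := snd_le_Cmod h). fold m in Ha, Hb.
destruct h as [a b]; simpl in Ha, Hb.
specialize (H1 a ltac:(lra)). specialize (H2 b ltac:(lra)). specialize (H3 b ltac:(lra)).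
rewrite exp_0 in H1. rewrite cos_0 in H2. rewrite sin_0 in H3.
eapply Rle_trans; [apply Cmod_le_fst_snd|].
unfold Cexp; simpl.
replace (exp a * cos b + - (1) + - (a * 1 - b * 0))%R
  with ((exp a - 1 - a * 1) + exp a * (cos b - 1 - b * 0))%R by ring.
replace (exp a * sin b + - 0 + - (a * 0 + b * 1))%R
  with (exp a * (sin b - 0 - b * 1) + (exp a - 1) * b)%R by ring.
assert (He1 : (0 < exp a <= 3)%R).
{ split; [apply exp_pos|]. apply Rle_trans with (exp 1); [|apply exp_le_3].
  destruct (Rle_lt_or_eq_dec a 1) as [Hl| ->]; [apply Rabs_le_between in Ha; lra| |lra].
  left; now apply exp_increasing. }
assert (Hm : (0 <= m)%R) by apply Cmod_ge_0.
assert (K1 : (Rabs (exp a - 1 - a * 1) <= eps / 16 * m)%R).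
{ eapply Rle_trans; [exact H1|]. apply Rmult_le_compat_l; lra. }
assert (K2 : (Rabs (exp a * (cos b - 1 - b * 0)) <= 3 * (eps / 16 * m))%R).
{ rewrite Rabs_mult, (Rabs_pos_eq (exp a)) by lra.
  apply Rmult_le_compat; try lra; try apply Rabs_pos.
  eapply Rle_trans; [exact H2|]. apply Rmult_le_compat_l; lra. }
assert (K3 : (Rabs (exp a * (sin b - 0 - b * 1)) <= 3 * (eps / 16 * m))%R).
{ rewrite Rabs_mult, (Rabs_pos_eq (exp a)) by lra.
  apply Rmult_le_compat; try lra; try apply Rabs_pos.
  eapply Rle_trans; [exact H3|]. apply Rmult_le_compat_l; lra. }
assert (K4 : (Rabs ((exp a - 1) * b) <= (eps / 16 * m) + m * (eps / 16))%R).
{ replace ((exp a - 1) * b)%R with ((exp a - 1 - a * 1) * b + a * b)%R by ring.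
  eapply Rle_trans; [apply Rabs_triang|]. rewrite !Rabs_mult.
  apply Rplus_le_compat.
  - rewrite <- (Rmult_1_r (eps / 16 * m)). apply Rmult_le_compat; try apply Rabs_pos; lra.
  - apply Rmult_le_compat; try apply Rabs_pos; lra. }
eapply Rle_trans; [apply Rplus_le_compat; apply Rabs_triang|].
assert (0 <= eps * m)%R by (apply Rmult_le_pos; lra). lra.
Qed.

Lemma is_C_derive_Cexp (z : C) : is_C_derive Cexp z (Cexp z).
Proof.
apply is_C_derive_ext_loc with (f := fun y => Cexp z * Cexp (y - z)) (d := 1%R); [lra| |].
- intros y _. rewrite <- Cexp_plus. f_equal; ring.
- eapply is_C_derive_eq.
  + apply is_C_derive_scal. apply (is_C_derive_comp Cexp (fun y => y - z)).
    * replace (z - z) with (RtoC 0) by ring. apply is_C_derive_Cexp_0.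
    * apply is_C_derive_minus; [apply is_C_derive_id|apply is_C_derive_const].
  + ring.
Qed.

Lemma continuous_Cexp {T : UniformSpace} (f : T -> C) (p : T) :
  continuous f p -> continuous (fun q => Cexp (f q)) p.
Proof.
intros Hf. apply (continuous_comp f Cexp); [exact Hf|].
eapply is_C_derive_continuous, is_C_derive_Cexp.
Qed.

(** * Complex series *)

Definition csum (u : nat -> C) (n : nat) : C := sum_n (G := C_AbelianGroup) u n.

Lemma csum_0 (u : nat -> C) : csum u 0 = u 0%nat.
Proof. exact (sum_O (G := C_AbelianGroup) u). Qed.

Lemma csum_S (u : nat -> C) (n : nat) : csum u (S n) = csum u n + u (S n).
Proof. exact (sum_Sn (G := C_AbelianGroup) u n). Qed.

Lemma csum_ext (u v : nat -> C) (n : nat) :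
  (forall k, (k <= n)%nat -> u k = v k) -> csum u n = csum v n.
Proof.
induction n as [|n IH]; intros H.
- rewrite !csum_0. now apply H.
- rewrite !csum_S, IH by (intros; apply H; lia). now rewrite (H (S n)).
Qed.

Lemma csum_plus (u v : nat -> C) (n : nat) :
  csum (fun k => u k + v k) n = csum u n + csum v n.
Proof. induction n as [|n IH]; [now rewrite !csum_0|rewrite !csum_S, IH; ring]. Qed.

Lemma csum_minus (u v : nat -> C) (n : nat) :
  csum (fun k => u k - v k) n = csum u n - csum v n.
Proof. induction n as [|n IH]; [now rewrite !csum_0|rewrite !csum_S, IH; ring]. Qed.

Lemma csum_scal (c : C) (u : nat -> C) (n : nat) :
  csum (fun k => c * u k) n = c * csum u n.
Proof. induction n as [|n IH]; [now rewrite !csum_0|rewrite !csum_S, IH; ring]. Qed.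

Lemma csum_zero (u : nat -> C) (n : nat) :
  (forall k, (k <= n)%nat -> u k = 0) -> csum u n = 0.
Proof.
intros H. rewrite (csum_ext u (fun k => 0 * 0) n) by (intros; rewrite H by lia; ring).
rewrite csum_scal. ring.
Qed.

Lemma csum_first (u : nat -> C) (n : nat) :
  csum u (S n) = u 0%nat + csum (fun k => u (S k)) n.
Proof.
induction n as [|n IH]; [now rewrite csum_S, !csum_0|].
rewrite csum_S, IH, csum_S. ring.
Qed.

Lemma csum_rev (u : nat -> C) (n : nat) : csum u n = csum (fun k => u (n - k)%nat) n.
Proof.
revert u. induction n as [|n IH]; intros u; [now rewrite !csum_0|].
rewrite csum_first, csum_S, IH, Nat.sub_diag, Cplus_comm. f_equal.
apply csum_ext. intros k Hk. f_equal. lia.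
Qed.

Lemma csum_bound (u : nat -> C) (B : R) (n : nat) :
  (forall k, (k <= n)%nat -> Cmod (u k) <= B)%R -> (Cmod (csum u n) <= INR (S n) * B)%R.
Proof.
induction n as [|n IH]; intros H.
- rewrite csum_0. simpl. rewrite Rmult_1_l. now apply H.
- rewrite csum_S, S_INR. eapply Rle_trans; [apply Cmod_triangle|].
  assert (H1 := IH ltac:(intros; apply H; lia)). assert (H2 := H (S n) (le_n _)). lra.
Qed.

Definition is_Cseries (u : nat -> C) (l : C) : Prop :=
  is_series (K := C_AbsRing) (V := C_NormedModule) u l.

Lemma is_Cseries_eps (u : nat -> C) (l : C) :
  is_Cseries u l <-> forall eps : R, (0 < eps)%R ->
    exists N, forall n, (N <= n)%nat -> (Cmod (csum u n - l) < eps)%R.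
Proof.
split.
- intros H eps He.
  assert (HL := H _ (proj2 (locally_C l (fun y => (Cmod (y - l) < eps)%R))
     (ex_intro _ eps (conj He (fun y Hy => Hy))))).
  exact HL.
- intros H P HP. apply locally_C in HP. destruct HP as [d [Hd HP]].
  destruct (H d Hd) as [N HN]. exists N. intros n Hn. apply HP, HN, Hn.
Qed.

Lemma is_Cseries_unique (u : nat -> C) (l l' : C) : is_Cseries u l -> is_Cseries u l' -> l = l'.
Proof.
intros H H'. exact (filterlim_locally_unique (V := C_NormedModule) _ _ _ H H').
Qed.

Lemma is_Cseries_ext (u v : nat -> C) (l : C) :
  (forall n, u n = v n) -> is_Cseries u l -> is_Cseries v l.
Proof. apply (is_series_ext (K := C_AbsRing) (V := C_NormedModule)). Qed.

Lemma is_Cseries_plus (u v : nat -> C) (l m : C) :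
  is_Cseries u l -> is_Cseries v m -> is_Cseries (fun n => u n + v n) (l + m).
Proof. apply (is_series_plus (K := C_AbsRing) (V := C_NormedModule)). Qed.

Lemma is_Cseries_scal (c : C) (u : nat -> C) (l : C) :
  is_Cseries u l -> is_Cseries (fun n => c * u n) (c * l).
Proof. apply (is_series_scal (K := C_AbsRing) (V := C_NormedModule)). Qed.

Lemma is_Cseries_minus (u v : nat -> C) (l m : C) :
  is_Cseries u l -> is_Cseries v m -> is_Cseries (fun n => u n - v n) (l - m).
Proof.
intros H1 H2. apply (is_Cseries_ext (fun n => u n + (-(1)) * v n)); [intros; ring|].
replace (l - m) with (l + (-(1)) * m) by ring.
now apply is_Cseries_plus; [|apply is_Cseries_scal].
Qed.

Lemma is_Cseries_tail (u : nat -> C) (l : C) :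
  is_Cseries u l <-> is_Cseries (fun n => u (S n)) (l - u 0%nat).
Proof.
split; intros H.
- apply (is_series_incr_1 (K := C_AbsRing) (V := C_NormedModule)).
  change (is_Cseries u (l - u 0%nat + u 0%nat)).
  now replace (l - u 0%nat + u 0%nat) with l by ring.
- now apply (is_series_decr_1 (K := C_AbsRing) (V := C_NormedModule)).
Qed.

Lemma is_Cseries_single (u : nat -> C) :
  (forall n, u (S n) = 0) -> is_Cseries u (u 0%nat).
Proof.
intros H. apply is_Cseries_eps. intros eps He. exists 0%nat. intros n _.
replace (csum u n) with (u 0%nat).
- replace (u 0%nat - u 0%nat) with (RtoC 0) by ring. now rewrite Cmod_0.
- destruct n; [now rewrite csum_0|].
  rewrite csum_first, (csum_zero (fun k => u (S k))); [ring|auto].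
Qed.

Lemma is_Cseries_zero (u : nat -> C) : (forall n, u n = 0) -> is_Cseries u 0.
Proof. intros H. rewrite <- (H 0%nat). now apply is_Cseries_single. Qed.

Lemma ex_Cseries (u : nat -> C) (M : nat -> R) :
  (forall n, Cmod (u n) <= M n)%R -> ex_series M -> exists l, is_Cseries u l.
Proof.
intros H HM.
exact (ex_series_le (K := C_AbsRing) (V := C_CompleteNormedModule) u M H HM).
Qed.

Lemma is_Cseries_bound (u : nat -> C) (M : nat -> R) (l : C) (m : R) :
  (forall n, Cmod (u n) <= M n)%R -> is_series M m -> is_Cseries u l -> (Cmod l <= m)%R.
Proof.
intros H HM Hu. apply le_epsilon. intros eps He.
destruct (proj1 (is_Cseries_eps _ _) Hu (eps / 2)%R ltac:(lra)) as [N1 H1].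
assert (He2 : (0 < eps / 2)%R) by lra.
destruct (proj1 (filterlim_locally _ _) HM (mkposreal _ He2)) as [N2 H2].
set (n := max N1 N2).
specialize (H1 n (Nat.le_max_l _ _)). specialize (H2 n (Nat.le_max_r _ _)).
change (Rabs (sum_n M n - m) < eps / 2)%R in H2.
assert (H3 : (Cmod (csum u n) <= sum_n M n)%R).
{ clear - H. induction n as [|n IH].
  - rewrite csum_0, sum_O. apply H.
  - rewrite csum_S, sum_Sn. eapply Rle_trans; [apply Cmod_triangle|].
    apply Rplus_le_compat; auto. }
assert (H4 := Cmod_triangle_rev l (csum u n)). rewrite Cmod_minus_sym in H4.
apply Rabs_lt_between in H2. lra.
Qed.

Lemma is_Cseries_terms_bounded (u : nat -> C) (l : C) :
  is_Cseries u l -> exists A : R, forall n, (Cmod (u n) <= A)%R.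
Proof.
intros H. destruct (proj1 (is_Cseries_eps _ _) H 1%R Rlt_0_1) as [N HN].
assert (HB : exists B : R, forall n, (n <= S N)%nat -> (Cmod (u n) <= B)%R).
{ generalize (S N). intros k. induction k as [|k [B HB]].
  - exists (Cmod (u 0%nat)). intros n Hn. replace n with 0%nat by lia. apply Rle_refl.
  - exists (Rmax B (Cmod (u (S k)))). intros n Hn.
    destruct (Nat.eq_dec n (S k)) as [->|]; [apply Rmax_r|].
    eapply Rle_trans; [apply HB; lia|apply Rmax_l]. }
destruct HB as [B HB]. exists (Rmax B 2). intros n.
destruct (Compare_dec.le_lt_dec n (S N)) as [Hn|Hn].
- eapply Rle_trans; [now apply HB|apply Rmax_l].
- eapply Rle_trans; [|apply Rmax_r].
  destruct n as [|n]; [lia|].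
  replace (u (S n)) with ((csum u (S n) - l) - (csum u n - l)) by (rewrite csum_S; ring).
  eapply Rle_trans; [apply Cmod_minus_le|].
  assert (H1 := HN (S n) ltac:(lia)). assert (H2 := HN n ltac:(lia)). lra.
Qed.

Lemma is_series_geom_scal (A q : R) : (0 <= q < 1)%R ->
  is_series (fun n => A * q ^ n)%R (A / (1 - q))%R.
Proof.
intros Hq. apply (is_series_scal (V := R_NormedModule) A (fun n => q ^ n)%R).
apply is_series_geom. rewrite Rabs_pos_eq; lra.
Qed.

(* A junk value when the series diverges. *)
Definition Csum (u : nat -> C) : C :=
  (Series (fun n => fst (u n)), Series (fun n => snd (u n))).

Lemma Csum_unique (u : nat -> C) (l : C) : is_Cseries u l -> Csum u = l.
Proof.
intros H. destruct l as [a b]. unfold Csum.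
assert (E : forall n, csum u n = (sum_n (fun n => fst (u n)) n, sum_n (fun n => snd (u n)) n)).
{ induction n as [|n IH].
  - rewrite csum_0, !sum_O. apply surjective_pairing.
  - rewrite csum_S, IH, !sum_Sn. reflexivity. }
rewrite is_Cseries_eps in H. f_equal; apply is_series_unique.
- apply filterlim_locally. intros eps. destruct (H eps (cond_pos eps)) as [N HN].
  exists N. intros n Hn. specialize (HN n Hn). rewrite E in HN.
  eapply Rle_lt_trans; [apply (fst_le_Cmod ((sum_n (fun n => fst (u n)) n, sum_n (fun n => snd (u n)) n) - (a, b)))|exact HN].
- apply filterlim_locally. intros eps. destruct (H eps (cond_pos eps)) as [N HN].
  exists N. intros n Hn. specialize (HN n Hn). rewrite E in HN.
  eapply Rle_lt_trans; [apply (snd_le_Cmod ((sum_n (fun n => fst (u n)) n, sum_n (fun n => snd (u n)) n) - (a, b)))|exact HN].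
Qed.

Lemma Csum_ext (u v : nat -> C) : (forall n, u n = v n) -> Csum u = Csum v.
Proof. intros H. unfold Csum. f_equal; apply Series_ext; intros n; now rewrite H. Qed.

Lemma Cpow_0_S (n : nat) : (0 : C) ^ (S n) = 0.
Proof. rewrite Cpow_S. ring. Qed.

(** At a point of modulus [q r] the terms after the first are dominated by a geometric series of sum
    [A q / (1 - q)], which tends to 0 with [q]. Only [w <> 0] is assumed, because functions near
    infinity are known at [x = 1 / z] for [x <> 0] only. *)
Lemma pow_series_coef0 (c : nat -> C) (rho : R) : (0 < rho)%R ->
  (forall w : C, (0 < Cmod w < rho)%R -> is_Cseries (fun n => w ^ n * c n) 0) -> c 0%nat = 0.
Proof.
intros Hr H. set (r := (rho / 2)%R).
assert (Hrr : Cmod (RtoC r) = r) by (rewrite Cmod_R; apply Rabs_pos_eq; unfold r; lra).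
destruct (is_Cseries_terms_bounded _ _ (H (RtoC r) ltac:(rewrite Hrr; unfold r; lra))) as [A HA].
assert (HA0 : (0 <= A)%R) by (eapply Rle_trans; [apply Cmod_ge_0|apply (HA 0%nat)]).
apply Cmod_eq0_eps. intros eps He.
(* The bound 1/2 makes the tail at most [2 A q], and the other bound makes this at most [eps]. *)
set (q := Rmin (1 / 2) (eps / (2 * A + 1))).
assert (Hq : (0 < q <= 1 / 2)%R).
{ split; [apply Rmin_pos; [lra|apply Rdiv_lt_0_compat; lra]|apply Rmin_l]. }
assert (Hq2 : (q * (2 * A + 1) <= eps)%R).
{ apply Rle_trans with (eps / (2 * A + 1) * (2 * A + 1))%R.
  - apply Rmult_le_compat_r; [lra|apply Rmin_r].
  - right; field; lra. }
assert (Hqr : Cmod (RtoC (q * r)) = (q * r)%R).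
{ rewrite Cmod_R. apply Rabs_pos_eq, Rmult_le_pos; unfold r; lra. }
assert (Hs := H (RtoC (q * r)) ltac:(rewrite Hqr; unfold r; nra)).
apply is_Cseries_tail in Hs.
assert (Hb : forall n, (Cmod (RtoC (q * r) ^ S n * c (S n)) <= (A * q) * q ^ n)%R).
{ intros n. rewrite RtoC_mult, Cpow_mult_l, <- Cmult_assoc, Cmod_mult, Cmod_pow.
  rewrite (Cmod_R q), Rabs_pos_eq by lra.
  replace ((A * q) * q ^ n)%R with (q ^ S n * A)%R by (simpl; ring).
  apply Rmult_le_compat_l; [apply pow_le; lra|apply (HA (S n))]. }
assert (HB := is_Cseries_bound _ _ _ _ Hb (is_series_geom_scal (A * q) q ltac:(lra)) Hs).
replace (0 - RtoC (q * r) ^ 0 * c 0%nat) with (- c 0%nat) in HB by (simpl; ring).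
rewrite Cmod_opp in HB. eapply Rle_trans; [exact HB|].
apply Rle_trans with (A * q / (1 / 2))%R.
- apply Rmult_le_compat_l; [apply Rmult_le_pos; lra|]. apply Rinv_le_contravar; lra.
- apply Rle_trans with (q * (2 * A + 1))%R; [|exact Hq2]. nra.
Qed.

Lemma pow_series_zero (c : nat -> C) (rho : R) : (0 < rho)%R ->
  (forall w : C, (0 < Cmod w < rho)%R -> is_Cseries (fun n => w ^ n * c n) 0) ->
  forall n, c n = 0.
Proof.
intros Hr H n. revert c H. induction n as [|n IH]; intros c H.
- eapply pow_series_coef0; eauto.
- apply (IH (fun k => c (S k))). intros w Hw.
  assert (H0 := pow_series_coef0 c rho Hr H).
  assert (Hw0 : w <> 0) by (apply Cmod_gt_0; lra).
  assert (Hs := H w Hw). apply is_Cseries_tail, (is_Cseries_scal (/ w)) in Hs.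
  rewrite H0 in Hs. replace (/ w * (0 - w ^ 0 * 0)) with (RtoC 0) in Hs by (simpl; ring).
  eapply is_Cseries_ext; [|exact Hs]. intros k. cbv beta. rewrite Cpow_S. field. exact Hw0.
Qed.

Lemma pow_series_inj (c c' : nat -> C) (f : C -> C) (rho : R) : (0 < rho)%R ->
  (forall w : C, (0 < Cmod w < rho)%R -> is_Cseries (fun n => w ^ n * c n) (f w)) ->
  (forall w : C, (0 < Cmod w < rho)%R -> is_Cseries (fun n => w ^ n * c' n) (f w)) ->
  forall n, c n = c' n.
Proof.
intros Hr H H' n.
assert (E : c n - c' n = 0).
{ apply (pow_series_zero (fun n => c n - c' n) rho Hr). intros w Hw.
  assert (Hm := is_Cseries_minus _ _ _ _ (H w Hw) (H' w Hw)).
  replace (f w - f w) with (RtoC 0) in Hm by ring.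
  eapply is_Cseries_ext; [|exact Hm]. intros k. cbv beta. ring. }
replace (c n) with (c n - c' n + c' n) by ring. rewrite E. ring.
Qed.

(** * Integrals over circles and the Taylor expansion on the unit disc *)

Definition cis (t : R) : C := (cos t, sin t).

Lemma cis_plus (s t : R) : cis (s + t) = cis s * cis t.
Proof. unfold cis, Cmult; simpl. rewrite cos_plus, sin_plus. f_equal; ring. Qed.

Lemma cis_0 : cis 0 = 1.
Proof. unfold cis. now rewrite cos_0, sin_0. Qed.

Lemma cis_opp (t : R) : cis t * cis (- t) = 1.
Proof. rewrite <- cis_plus, Rplus_opp_r. apply cis_0. Qed.

Lemma Cmod_cis (t : R) : Cmod (cis t) = 1%R.
Proof.
unfold Cmod, cis; simpl. rewrite !Rmult_1_r.
generalize (sin2_cos2 t). unfold Rsqr. intros E.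
rewrite Rplus_comm, E. apply sqrt_1.
Qed.

Lemma continuous_pair_C {T : UniformSpace} (f g : T -> R) (p : T) :
  continuous f p -> continuous g p -> continuous (fun q => (f q, g q) : C) p.
Proof.
intros Hf Hg. apply continuous_Cmod. intros eps He.
assert (He2 : (0 < eps / 2)%R) by lra.
assert (L1 := proj1 (filterlim_locally f (f p)) Hf (mkposreal _ He2)).
assert (L2 := proj1 (filterlim_locally g (g p)) Hg (mkposreal _ He2)).
generalize (filter_and _ _ L1 L2). apply filter_imp. intros q [H1 H2].
eapply Rle_lt_trans; [apply Cmod_le_fst_snd|].
change (Rabs (f q - f p) < eps / 2)%R in H1. change (Rabs (g q - g p) < eps / 2)%R in H2.
change (Rabs (f q - f p) + Rabs (g q - g p) < eps)%R. lra.
Qed.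

Lemma continuous_fst_C {T : UniformSpace} (f : T -> C) (p : T) :
  continuous f p -> continuous (fun q => fst (f q)) p.
Proof.
intros H. apply (continuous_comp f fst); [exact H|].
apply (continuous_fst (U := R_UniformSpace) (V := R_UniformSpace)).
Qed.

Lemma continuous_snd_C {T : UniformSpace} (f : T -> C) (p : T) :
  continuous f p -> continuous (fun q => snd (f q)) p.
Proof.
intros H. apply (continuous_comp f snd); [exact H|].
apply (continuous_snd (U := R_UniformSpace) (V := R_UniformSpace)).
Qed.

Lemma continuous_RtoC {T : UniformSpace} (f : T -> R) (p : T) :
  continuous f p -> continuous (fun q => RtoC (f q)) p.
Proof. intros H. apply continuous_pair_C; [exact H|apply continuous_const]. Qed.

Lemma continuous_cis {T : UniformSpace} (f : T -> R) (p : T) :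
  continuous f p -> continuous (fun q => cis (f q)) p.
Proof.
intros H. apply continuous_pair_C.
- apply (continuous_comp f cos); [exact H|].
  apply (ex_derive_continuous (K := R_AbsRing) (V := R_NormedModule)). auto_derive; auto.
- apply (continuous_comp f sin); [exact H|].
  apply (ex_derive_continuous (K := R_AbsRing) (V := R_NormedModule)). auto_derive; auto.
Qed.

Definition path_derive (g : R -> C) (t : R) (d : C) : Prop :=
  is_derive (fun s => fst (g s)) t (fst d) /\ is_derive (fun s => snd (g s)) t (snd d).

Lemma is_derive_R_eps (f : R -> R) (x l : R) :
  is_derive f x l <->
  forall eps : R, (0 < eps)%R -> exists d : R, (0 < d)%R /\
    forall y, (Rabs (y - x) < d -> Rabs (f y - f x - (y - x) * l) <= eps * Rabs (y - x))%R.
Proof.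
split.
- intros [_ H] eps He.
  assert (Hx : is_filter_lim (locally (T := R_UniformSpace) x) x) by now intros P HP.
  destruct (H x Hx (mkposreal eps He)) as [d Hd].
  exists d; split; [apply cond_pos|]. intros y Hy. exact (Hd y Hy).
- intros H; split; [apply is_linear_scal_l|].
  intros x' Hx'. apply (is_filter_lim_locally_unique (V := R_NormedModule)) in Hx'.
  rewrite <- Hx'.
  intros eps. destruct (H eps (cond_pos eps)) as [d [Hd0 Hd]].
  exists (mkposreal d Hd0). intros y Hy. exact (Hd y Hy).
Qed.

Lemma path_derive_eps (g : R -> C) (t : R) (l : C) :
  path_derive g t l <->
  forall eps : R, (0 < eps)%R -> exists d : R, (0 < d)%R /\
    forall s, (Rabs (s - t) < d)%R ->
      (Cmod (g s - g t - RtoC (s - t) * l) <= eps * Rabs (s - t))%R.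
Proof.
assert (E1 : forall s, fst (g s - g t - RtoC (s - t) * l)
   = (fst (g s) - fst (g t) - (s - t) * fst l)%R) by (intros; simpl; ring).
assert (E2 : forall s, snd (g s - g t - RtoC (s - t) * l)
   = (snd (g s) - snd (g t) - (s - t) * snd l)%R) by (intros; simpl; ring).
unfold path_derive. rewrite !is_derive_R_eps. split.
- intros [H1 H2] eps He.
  destruct (H1 (eps / 2)%R ltac:(lra)) as [d1 [P1 K1]].
  destruct (H2 (eps / 2)%R ltac:(lra)) as [d2 [P2 K2]].
  exists (Rmin d1 d2); split; [now apply Rmin_pos|]. intros s Hs.
  eapply Rle_trans; [apply Cmod_le_fst_snd|]. rewrite E1, E2.
  assert (A1 := K1 s (Rlt_le_trans _ _ _ Hs (Rmin_l _ _))).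
  assert (A2 := K2 s (Rlt_le_trans _ _ _ Hs (Rmin_r _ _))). lra.
- intros H; split; intros eps He; destruct (H eps He) as [d [P K]];
    exists d; (split; [exact P|]); intros s Hs.
  + rewrite <- E1. eapply Rle_trans; [apply fst_le_Cmod|auto].
  + rewrite <- E2. eapply Rle_trans; [apply snd_le_Cmod|auto].
Qed.

Lemma path_derive_comp (f : C -> C) (g : R -> C) (t : R) (l d : C) :
  is_C_derive f (g t) l -> path_derive g t d -> path_derive (fun s => f (g s)) t (d * l).
Proof.
rewrite is_C_derive_eps, !path_derive_eps. intros Hf Hg eps He.
set (M := (Cmod d + 1)%R). assert (PM : (1 <= M)%R) by (unfold M; assert (H := Cmod_ge_0 d); lra).
set (N := (Cmod l + 1)%R). assert (PN : (1 <= N)%R) by (unfold N; assert (H := Cmod_ge_0 l); lra).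
destruct (Hf (eps / (2 * M))%R ltac:(apply Rdiv_lt_0_compat; lra)) as [d1 [P1 K1]].
destruct (Hg 1%R Rlt_0_1) as [d2 [P2 K2]].
destruct (Hg (eps / (2 * N))%R ltac:(apply Rdiv_lt_0_compat; lra)) as [d3 [P3 K3]].
exists (Rmin (d1 / M) (Rmin d2 d3)); split.
{ repeat apply Rmin_pos; auto. apply Rdiv_lt_0_compat; lra. }
intros s Hs.
assert (B1 := Rlt_le_trans _ _ _ Hs (Rmin_l _ _)).
assert (B2 := Rlt_le_trans _ _ _ (Rlt_le_trans _ _ _ Hs (Rmin_r _ _)) (Rmin_l _ _)).
assert (B3 := Rlt_le_trans _ _ _ (Rlt_le_trans _ _ _ Hs (Rmin_r _ _)) (Rmin_r _ _)).
specialize (K2 s B2). specialize (K3 s B3).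
assert (G : (Cmod (g s - g t) <= M * Rabs (s - t))%R).
{ assert (H := Cmod_triangle_rev (g s - g t) (RtoC (s - t) * d)).
  rewrite Cmod_mult, Cmod_R in H. unfold M. lra. }
assert (G1 : (Cmod (g s - g t) < d1)%R).
{ eapply Rle_lt_trans; [exact G|]. apply Rlt_le_trans with (M * (d1 / M))%R.
  - apply Rmult_lt_compat_l; lra.
  - right; field; lra. }
specialize (K1 _ G1).
replace (f (g s) - f (g t) - RtoC (s - t) * (d * l)) with
  ((f (g s) - f (g t) - (g s - g t) * l) + (g s - g t - RtoC (s - t) * d) * l) by ring.
eapply Rle_trans; [apply Cmod_triangle|]. rewrite (Cmod_mult _ l).
assert (Q1 : (eps / (2 * M) * Cmod (g s - g t) <= eps / 2 * Rabs (s - t))%R).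
{ apply Rle_trans with (eps / (2 * M) * (M * Rabs (s - t)))%R.
  - apply Rmult_le_compat_l; [apply Rlt_le, Rdiv_lt_0_compat; lra|exact G].
  - right; field; lra. }
assert (Q2 : (Cmod (g s - g t - RtoC (s - t) * d) * Cmod l <= eps / 2 * Rabs (s - t))%R).
{ apply Rle_trans with (eps / (2 * N) * Rabs (s - t) * N)%R.
  - apply Rmult_le_compat; try apply Cmod_ge_0; [exact K3|unfold N; lra].
  - right; field; lra. }
lra.
Qed.

Definition Cint (g : R -> C) : C :=
  (RInt (fun t => fst (g t)) 0 (2 * PI), RInt (fun t => snd (g t)) 0 (2 * PI)).

Lemma Cint_ext (f g : R -> C) : (forall t, f t = g t) -> Cint f = Cint g.
Proof. intros H. unfold Cint. f_equal; apply RInt_ext; intros; now rewrite H. Qed.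

Lemma ex_RInt_fst (g : R -> C) (a b : R) :
  (forall t, continuous g t) -> ex_RInt (fun t => fst (g t)) a b.
Proof.
intros H. apply (ex_RInt_continuous (V := R_CompleteNormedModule)).
intros t _. apply continuous_fst_C, H.
Qed.

Lemma ex_RInt_snd (g : R -> C) (a b : R) :
  (forall t, continuous g t) -> ex_RInt (fun t => snd (g t)) a b.
Proof.
intros H. apply (ex_RInt_continuous (V := R_CompleteNormedModule)).
intros t _. apply continuous_snd_C, H.
Qed.

Lemma Cint_plus (f g : R -> C) :
  (forall t, continuous f t) -> (forall t, continuous g t) ->
  Cint (fun t => f t + g t) = Cint f + Cint g.
Proof.
intros Hf Hg. unfold Cint. simpl. unfold Cplus; simpl. f_equal.
- now apply (RInt_plus (V := R_CompleteNormedModule)); apply ex_RInt_fst.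
- now apply (RInt_plus (V := R_CompleteNormedModule)); apply ex_RInt_snd.
Qed.

Lemma Cint_scal (c : C) (f : R -> C) :
  (forall t, continuous f t) -> Cint (fun t => c * f t) = c * Cint f.
Proof.
intros Hf. unfold Cint. simpl. unfold Cmult; simpl.
assert (E1 := ex_RInt_fst f 0 (2 * PI) Hf). assert (E2 := ex_RInt_snd f 0 (2 * PI) Hf).
assert (S : forall (k : R) (h : R -> R), ex_RInt h 0 (2 * PI) ->
  RInt (fun t => k * h t)%R 0 (2 * PI) = (k * RInt h 0 (2 * PI))%R).
{ intros k h Hh. apply (RInt_scal (V := R_CompleteNormedModule)), Hh. }
assert (X : forall (k : R) (h : R -> R), ex_RInt h 0 (2 * PI) -> ex_RInt (fun t => k * h t)%R 0 (2 * PI)).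
{ intros k h Hh. apply (ex_RInt_scal (V := R_NormedModule)), Hh. }
f_equal.
- rewrite <- !S by assumption.
  apply (RInt_minus (V := R_CompleteNormedModule)); now apply X.
- rewrite <- !S by assumption.
  apply (RInt_plus (V := R_CompleteNormedModule)); now apply X.
Qed.

Lemma Cint_const (c : C) : Cint (fun _ => c) = RtoC (2 * PI) * c.
Proof.
unfold Cint. rewrite !RInt_const. destruct c as [a b].
unfold RtoC, Cmult, scal; simpl. unfold mult; simpl. f_equal; ring.
Qed.

Lemma two_PI_pos : (0 < 2 * PI)%R.
Proof. assert (H := PI_RGT_0). lra. Qed.

(** The factor 2 comes from estimating real and imaginary parts separately. It only affects
    constants in growth bounds. *)
Lemma Cint_bound (f : R -> C) (M : R) :
  (forall t, continuous f t) -> (forall t, (0 <= t <= 2 * PI)%R -> (Cmod (f t) <= M)%R) ->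
  (Cmod (Cint f) <= 2 * (2 * PI * M))%R.
Proof.
intros Hf HM. eapply Rle_trans; [apply Cmod_le_fst_snd|]. unfold Cint; simpl.
assert (P := two_PI_pos).
assert (B1 : (Rabs (RInt (fun t => fst (f t)) 0 (2 * PI)) <= (2 * PI - 0) * M)%R).
{ apply abs_RInt_le_const; [lra|now apply ex_RInt_fst|].
  intros t Ht. eapply Rle_trans; [apply fst_le_Cmod|auto]. }
assert (B2 : (Rabs (RInt (fun t => snd (f t)) 0 (2 * PI)) <= (2 * PI - 0) * M)%R).
{ apply abs_RInt_le_const; [lra|now apply ex_RInt_snd|].
  intros t Ht. eapply Rle_trans; [apply snd_le_Cmod|auto]. }
lra.
Qed.

Lemma Cint_derive (g dg : R -> C) :
  (forall t, path_derive g t (dg t)) -> (forall t, continuous dg t) ->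
  Cint dg = g (2 * PI)%R - g 0%R.
Proof.
intros H Hc. unfold Cint.
assert (E1 : RInt (fun t => fst (dg t)) 0 (2 * PI) = (fst (g (2 * PI)%R) - fst (g 0%R))%R).
{ apply is_RInt_unique. apply (is_RInt_derive (V := R_CompleteNormedModule) (fun t => fst (g t))).
  - intros t _. apply H.
  - intros t _. apply continuous_fst_C, Hc. }
assert (E2 : RInt (fun t => snd (dg t)) 0 (2 * PI) = (snd (g (2 * PI)%R) - snd (g 0%R))%R).
{ apply is_RInt_unique. apply (is_RInt_derive (V := R_CompleteNormedModule) (fun t => snd (g t))).
  - intros t _. apply H.
  - intros t _. apply continuous_snd_C, Hc. }
rewrite E1, E2. reflexivity.
Qed.

Lemma path_derive_cis (k t : R) :
  path_derive (fun s => cis (k * s)) t (RtoC k * (Ci * cis (k * t))).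
Proof.
split; unfold cis, Ci; simpl; auto_derive; auto; ring.
Qed.

Lemma cis_2PI (n : nat) : cis (INR n * (2 * PI)) = 1.
Proof.
unfold cis, RtoC. replace (INR n * (2 * PI))%R with (0 + 2 * INR n * PI)%R by ring.
now rewrite cos_period, sin_period, cos_0, sin_0.
Qed.

Lemma Cint_cis (n : nat) : (n <> 0)%nat -> Cint (fun t => cis (- INR n * t)) = 0.
Proof.
intros Hn.
assert (Hk : RtoC (- INR n) * Ci <> 0).
{ intros E. apply (f_equal snd) in E. simpl in E.
  assert (INR n <> 0%R) by now apply not_0_INR. lra. }
assert (Hc : forall t, continuous (fun t => cis (- INR n * t)) t).
{ intros t. apply continuous_cis. apply (continuous_mult (K := R_AbsRing)).
  - apply continuous_const.
  - apply continuous_id. }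
assert (E : Cint (fun t => RtoC (- INR n) * Ci * cis (- INR n * t)) = 0).
{ rewrite (Cint_derive (fun t => cis (- INR n * t))).
  - replace (cis (- INR n * (2 * PI))) with (RtoC 1).
    + rewrite Rmult_0_r, cis_0. ring.
    + rewrite <- (cis_opp (INR n * (2 * PI))), cis_2PI, Cmult_1_l. f_equal. ring.
  - intros t. rewrite <- Cmult_assoc. apply path_derive_cis.
  - intros t. apply continuous_Cmult; [apply continuous_const|apply Hc]. }
rewrite Cint_scal in E by exact Hc.
replace (Cint (fun t => cis (- INR n * t))) with
  (/ (RtoC (- INR n) * Ci) * (RtoC (- INR n) * Ci * Cint (fun t => cis (- INR n * t)))).
- rewrite E. ring.
- rewrite Cmult_assoc, Cinv_l, Cmult_1_l by exact Hk. reflexivity.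
Qed.

Lemma continuous_bounded_period (g : R -> C) : (forall t, continuous g t) ->
  exists M : R, forall t, (0 <= t <= 2 * PI)%R -> (Cmod (g t) <= M)%R.
Proof.
intros Hg. assert (P := two_PI_pos).
destruct (continuity_ab_maj (fun t => Cmod (g t)) 0 (2 * PI)) as [m [Hm _]]; [lra| |].
- intros c _. apply continuity_pt_filterlim.
  apply (filterlim_comp _ _ _ g Cmod _ (locally (g c))); [apply Hg|].
  apply (filterlim_norm (K := C_AbsRing) (V := C_NormedModule)).
- exists (Cmod (g m)). exact Hm.
Qed.

(* With [w = q r], this is [z / (z - w)] at the point [z = r cis t]. *)
Definition kern (q : C) (t : R) : C := / (1 - q * cis (- t)).

Lemma one_minus_neq_0 (u : C) : (Cmod u < 1)%R -> 1 - u <> 0.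
Proof.
intros H E. assert (H1 := Cmod_triangle_rev 1 u). rewrite E, Cmod_0, Cmod_1 in H1. lra.
Qed.

Lemma kern_neq_0 (q : C) (t : R) : (Cmod q < 1)%R -> 1 - q * cis (- t) <> 0.
Proof. intros H. apply one_minus_neq_0. rewrite Cmod_mult, Cmod_cis. lra. Qed.

Lemma continuous_cis_scal (k t : R) : continuous (fun t => cis (k * t)) t.
Proof.
apply continuous_cis, (continuous_mult (K := R_AbsRing)).
- apply continuous_const.
- apply continuous_id.
Qed.

Lemma continuous_kern (q : C) (t : R) : (Cmod q < 1)%R -> continuous (kern q) t.
Proof.
intros H. apply continuous_Cinv; [|now apply kern_neq_0].
apply continuous_Cminus; [apply continuous_const|].
apply continuous_Cmult; [apply continuous_const|].
apply continuous_cis, (continuous_opp (V := R_NormedModule)), continuous_id.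
Qed.

Lemma Cmod_kern (q : C) (t : R) : (Cmod q < 1)%R -> (Cmod (kern q t) <= / (1 - Cmod q))%R.
Proof.
intros H. unfold kern. rewrite Cmod_inv by now apply kern_neq_0.
apply Rinv_le_contravar; [lra|].
assert (H1 := Cmod_triangle_rev 1 (q * cis (- t))).
rewrite Cmod_mult, Cmod_cis, Cmod_1 in H1. lra.
Qed.

Lemma is_Cseries_of_remainder (u : nat -> C) (l : C) (A q : R) : (0 <= q < 1)%R ->
  (forall n, (Cmod (l - csum u n) <= A * q ^ n)%R) -> is_Cseries u l.
Proof.
intros Hq H. apply is_Cseries_eps. intros eps He.
assert (HA : (0 <= A)%R).
{ assert (H0 := H 0%nat). simpl in H0. assert (H1 := Cmod_ge_0 (l - csum u 0)). lra. }
destruct (pow_lt_1_zero q ltac:(rewrite Rabs_pos_eq; lra) (eps / (A + 1))%R) as [N HN].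
{ apply Rdiv_lt_0_compat; lra. }
exists N. intros n Hn. rewrite Cmod_minus_sym. eapply Rle_lt_trans; [apply H|].
specialize (HN n Hn). rewrite Rabs_pos_eq in HN by (apply pow_le; lra).
apply Rle_lt_trans with ((A + 1) * q ^ n)%R.
- apply Rmult_le_compat_r; [apply pow_le|]; lra.
- apply Rlt_le_trans with ((A + 1) * (eps / (A + 1)))%R; [apply Rmult_lt_compat_l; lra|].
  right; field; lra.
Qed.

(** The geometric series of [kern] is integrated with its exact remainder, which replaces an
    interchange of sum and integral: after [n + 1] terms the remainder is [q ^ (n + 1) * J (n + 1)],
    and the [J n] are uniformly bounded. *)
Lemma kern_series (g : R -> C) (q : C) : (forall t, continuous g t) -> (Cmod q < 1)%R ->
  is_Cseries (fun n => q ^ n * Cint (fun t => g t * cis (- INR n * t)))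
    (Cint (fun t => g t * kern q t)).
Proof.
intros Hg Hq.
set (I := fun n => Cint (fun t => g t * cis (- INR n * t))).
set (J := fun n => Cint (fun t => (g t * cis (- INR n * t)) * kern q t)).
assert (Hgc : forall n t, continuous (fun t => g t * cis (- INR n * t)) t).
{ intros n t. apply continuous_Cmult; [apply Hg|apply continuous_cis_scal]. }
assert (Hgk : forall n t, continuous (fun t => (g t * cis (- INR n * t)) * kern q t) t).
{ intros n t. apply continuous_Cmult; [apply Hgc|now apply continuous_kern]. }
assert (E0 : Cint (fun t => g t * kern q t) = J 0%nat).
{ apply Cint_ext. intros t. simpl. rewrite Ropp_0, Rmult_0_l, cis_0. ring. }
assert (ES : forall n, J n = I n + q * J (S n)).
{ intros n. unfold I, J. rewrite <- Cint_scal, <- Cint_plus by (auto; intros; apply continuous_Cmult; auto; apply continuous_const).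
  apply Cint_ext. intros t. rewrite S_INR.
  replace (- (INR n + 1) * t)%R with (- INR n * t + - t)%R by ring.
  rewrite cis_plus. unfold kern. field. now apply kern_neq_0. }
assert (ER : forall n, J 0%nat - csum (fun n => q ^ n * I n) n = q ^ (S n) * J (S n)).
{ induction n as [|n IH].
  - rewrite csum_0, (ES 0%nat). simpl. ring.
  - rewrite csum_S. replace (J 0%nat - (csum (fun n => q ^ n * I n) n + q ^ S n * I (S n)))
      with ((J 0%nat - csum (fun n => q ^ n * I n) n) - q ^ S n * I (S n)) by ring.
    rewrite IH, (ES (S n)), (Cpow_S q (S n)). ring. }
destruct (continuous_bounded_period g Hg) as [M HM].
assert (HJ : forall n, (Cmod (J n) <= 2 * (2 * PI * (M * / (1 - Cmod q))))%R).
{ intros n. apply Cint_bound; [apply Hgk|]. intros t Ht.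
  rewrite !Cmod_mult, Cmod_cis, Rmult_1_r.
  apply Rmult_le_compat; try apply Cmod_ge_0; [now apply HM|now apply Cmod_kern]. }
rewrite E0. apply is_Cseries_of_remainder with (A := (2 * (2 * PI * (M * / (1 - Cmod q))))%R) (q := Cmod q).
{ split; [apply Cmod_ge_0|exact Hq]. }
intros n. rewrite ER, Cmod_mult, Cmod_pow, Rmult_comm.
assert (P := Cmod_ge_0 q).
apply Rmult_le_compat; try apply Cmod_ge_0; [apply pow_le, P|apply HJ|].
simpl. rewrite <- (Rmult_1_l (Cmod q ^ n)) at 2.
apply Rmult_le_compat_r; [apply pow_le|]; lra.
Qed.

(** Take [g = 1] in [kern_series]: every term after the first is an integral of [cis (- n t)] with
    [n <> 0], hence 0. *)
Lemma Cint_kern (q : C) : (Cmod q < 1)%R -> Cint (kern q) = RtoC (2 * PI).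
Proof.
intros Hq. assert (H := kern_series (fun _ => 1) q (fun t => continuous_const _ _) Hq).
assert (E : forall n, Cint (fun t => 1 * cis (- INR n * t)) = Cint (fun t => cis (- INR n * t))).
{ intros n. apply Cint_ext. intros; ring. }
assert (H1 := is_Cseries_single (fun n => q ^ n * Cint (fun t => 1 * cis (- INR n * t)))).
assert (E2 := is_Cseries_unique _ _ _ H (H1 (fun n => ltac:(cbv beta; rewrite E, Cint_cis by lia; ring)))).
rewrite (Cint_ext (kern q) (fun t => 1 * kern q t)) by (intros; ring).
rewrite E2. rewrite (Cint_ext _ (fun _ => 1)).
- rewrite Cint_const. simpl. ring.
- intros t. simpl. rewrite Ropp_0, Rmult_0_l, cis_0. ring.
Qed.

Section Cauchy.

Variables (f f' : C -> C).
Hypothesis Hf : forall u, (Cmod u < 1)%R -> is_C_derive f u (f' u).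
Hypothesis Hf' : forall u, (Cmod u < 1)%R -> continuous f' u.

(** The parameter may leave [0, 1] on both sides, so that derivatives in [s] make sense at the
    endpoints. With [d = (1 - r) / 4] the modulus is less than
    [(1 + 2 d) r = (1 + 2 d) (1 - 4 d) < 1] outside [0, 1]. *)
Lemma homotopy_bound (r : R) (w : C) (s t : R) : (Cmod w < r)%R -> (r < 1)%R ->
  (- ((1 - r) / 4) < s < 1 + (1 - r) / 4)%R ->
  (Cmod (w + RtoC s * (RtoC r * cis t - w)) < 1)%R.
Proof.
intros Hw Hr Hs. assert (P := Cmod_ge_0 w).
replace (w + RtoC s * (RtoC r * cis t - w)) with (RtoC (1 - s) * w + RtoC (s * r) * cis t).
2:{ rewrite RtoC_minus, RtoC_mult. ring. }
eapply Rle_lt_trans; [apply Cmod_triangle|].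
rewrite !Cmod_mult, Cmod_cis, !Cmod_R, Rabs_mult, (Rabs_pos_eq r) by lra.
assert (D : (0 < (1 - r) / 4)%R) by lra. set (d := ((1 - r) / 4)%R) in *.
assert (r = 1 - 4 * d)%R by (unfold d; lra).
destruct (Rcase_abs s) as [S1|S1].
- rewrite (Rabs_left s), (Rabs_pos_eq (1 - s)) by lra. nra.
- destruct (Rcase_abs (1 - s)) as [S2|S2].
  + rewrite (Rabs_right s), (Rabs_left (1 - s)) by lra. nra.
  + rewrite (Rabs_right s), (Rabs_right (1 - s)) by lra. nra.
Qed.

Lemma continuous_on_circle (r : R) : (0 <= r < 1)%R ->
  forall t, continuous (fun t => f (RtoC r * cis t)) t.
Proof.
intros Hr t. apply (continuous_comp (fun t => RtoC r * cis t) f).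
- apply continuous_Cmult; [apply continuous_const|apply continuous_cis, continuous_id].
- eapply is_C_derive_continuous, Hf.
  rewrite Cmod_mult, Cmod_cis, Cmod_R, Rabs_pos_eq; lra.
Qed.

(* [s -> int f (w + s (z - w)) z / (z - w)] over the circle [|z| = r] has
   derivative [int f' (w + s (z - w)) z], an integral of a derivative in the
   angle; hence it is constant on [0, 1]. *)
Lemma Cauchy_formula (r : R) (w : C) : (Cmod w < r)%R -> (r < 1)%R ->
  Cint (fun t => f (RtoC r * cis t) * kern (w / RtoC r) t) = RtoC (2 * PI) * f w.
Proof.
intros Hw Hr. assert (Pw := Cmod_ge_0 w).
assert (Hr0 : RtoC r <> 0).
{ apply Cmod_gt_0. rewrite Cmod_R, Rabs_pos_eq; lra. }
set (q := w / RtoC r).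
assert (Hq : (Cmod q < 1)%R).
{ unfold q. rewrite Cmod_div, Cmod_R, Rabs_pos_eq by (auto; lra).
  apply Rmult_lt_reg_r with r; [lra|]. unfold Rdiv. rewrite Rmult_assoc, Rinv_l; lra. }
set (Z := fun s t => w + RtoC s * (RtoC r * cis t - w)).
set (G := fun s t => f (Z s t) * kern q t).
set (G' := fun s t => f' (Z s t) * (RtoC r * cis t)).
set (d := ((1 - r) / 4)%R).
assert (HZ : forall s t, (- d < s < 1 + d)%R -> (Cmod (Z s t) < 1)%R).
{ intros s t Hs. now apply homotopy_bound. }
assert (Dd : (0 < d)%R) by (unfold d; lra).
assert (CZ : forall s t, continuous (fun p : R * R => Z (fst p) (snd p)) (s, t)).
{ intros s t. unfold Z. apply continuous_Cplus; [apply continuous_const|].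
  apply continuous_Cmult.
  - apply continuous_RtoC, (continuous_fst (U := R_UniformSpace) (V := R_UniformSpace)).
  - apply continuous_Cminus; [|apply continuous_const].
    apply continuous_Cmult; [apply continuous_const|].
    apply continuous_cis, (continuous_snd (U := R_UniformSpace) (V := R_UniformSpace)). }
assert (CG' : forall s t, (- d < s < 1 + d)%R ->
  continuous (fun p : R * R => G' (fst p) (snd p)) (s, t)).
{ intros s t Hs. unfold G'. apply continuous_Cmult.
  - apply (continuous_comp (fun p : R * R => Z (fst p) (snd p)) f'); [apply CZ|].
    apply Hf', HZ, Hs.
  - apply continuous_Cmult; [apply continuous_const|].
    apply continuous_cis, (continuous_snd (U := R_UniformSpace) (V := R_UniformSpace)). }
assert (CZt : forall s t, continuous (Z s) t).
{ intros s t. unfold Z. apply continuous_Cplus; [apply continuous_const|].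
  apply continuous_Cmult; [apply continuous_const|].
  apply continuous_Cminus; [|apply continuous_const].
  apply continuous_Cmult; [apply continuous_const|apply continuous_cis, continuous_id]. }
assert (CG : forall s t, (- d < s < 1 + d)%R -> continuous (G s) t).
{ intros s t Hs. unfold G. apply continuous_Cmult; [|now apply continuous_kern].
  apply (continuous_comp (Z s) f); [apply CZt|].
  eapply is_C_derive_continuous, Hf, HZ, Hs. }
assert (CG't : forall s t, (- d < s < 1 + d)%R -> continuous (G' s) t).
{ intros s t Hs. unfold G'. apply continuous_Cmult.
  - apply (continuous_comp (Z s) f'); [apply CZt|]. apply Hf', HZ, Hs.
  - apply continuous_Cmult; [apply continuous_const|apply continuous_cis, continuous_id]. }
assert (DG : forall s t, (- d < s < 1 + d)%R -> path_derive (fun s => G s t) s (G' s t)).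
{ intros s t Hs.
  (* [kern q t] is [z / (z - w)] at [z = r cis t], so the factor [z - w] produced by the chain rule
     cancels its pole. *)
  assert (E : G' s t = (RtoC r * cis t - w) * (f' (Z s t) * kern q t)).
  { unfold G', kern, q.
    assert (K := kern_neq_0 q t Hq). unfold q in K.
    assert (X := cis_opp t).
    transitivity (f' (Z s t) * ((RtoC r * cis t - w * (cis t * cis (- t))) * / (1 - w / RtoC r * cis (- t)))).
    - field. split; [exact Hr0|].
      intros F. apply K. rewrite <- (Cinv_l (RtoC r)) by exact Hr0.
      replace (/ RtoC r * RtoC r - w / RtoC r * cis (- t)) with (/ RtoC r * (RtoC r - w * cis (- t))) by (field; exact Hr0).
      rewrite F. ring.
    - rewrite X. ring. }
  rewrite E.
  apply (path_derive_comp (fun u => f u * kern q t) (fun s => Z s t)).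
  - eapply is_C_derive_eq.
    + apply is_C_derive_mult; [apply Hf, HZ, Hs|apply is_C_derive_const].
    + cbv beta; ring.
  - unfold Z. generalize (RtoC r * cis t - w). intros [a b].
    split; simpl; auto_derive; auto; ring. }
(* For [s <> 0], [i s G' s t] is the derivative in [t] of the periodic function [f (Z s t)]. At
   [s = 0] one cannot divide, but there [G'] is the constant [f' w] times [r cis t]. *)
assert (HJ : forall s, (- d < s < 1 + d)%R -> Cint (G' s) = 0).
{ intros s Hs. destruct (Req_dec s 0) as [->|Hs0].
  - rewrite (Cint_ext _ (fun t => (f' w * RtoC r * Ci) * (/ Ci * cis (1 * t)))).
    2:{ intros t. unfold G', Z. rewrite Rmult_1_l. replace (w + RtoC 0 * (RtoC r * cis t - w)) with w by ring.
        field. intros E; apply (f_equal snd) in E; simpl in E; lra. }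
    assert (Hci : Ci <> 0) by (intros E; apply (f_equal snd) in E; simpl in E; lra).
    rewrite Cint_scal.
    2:{ intros t. apply continuous_Cmult; [apply continuous_const|apply continuous_cis_scal]. }
    rewrite (Cint_derive (fun t => - cis (1 * t))).
    + rewrite Rmult_1_l, Rmult_0_r, cis_0.
      replace (2 * PI)%R with (INR 1 * (2 * PI))%R by (simpl; ring). rewrite cis_2PI. ring.
    + intros t.
      split; unfold cis, Ci; simpl; auto_derive; auto; field.
    + intros t. apply continuous_Cmult; [apply continuous_const|apply continuous_cis_scal].
  - assert (Hk : RtoC s * Ci <> 0).
    { intros E; apply (f_equal snd) in E; simpl in E; lra. }
    assert (E : Cint (fun t => RtoC s * Ci * G' s t) = 0).
    { rewrite (Cint_derive (fun t => f (Z s t))).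
      - unfold Z. replace (2 * PI)%R with (INR 1 * (2 * PI))%R by (simpl; ring).
        rewrite cis_2PI, cis_0. ring.
      - intros t. replace (RtoC s * Ci * G' s t) with (RtoC (s * r) * (Ci * cis t) * f' (Z s t))
          by (unfold G'; rewrite RtoC_mult; ring).
        apply (path_derive_comp f (Z s)); [apply Hf, HZ, Hs|].
        unfold Z. destruct w as [a b]. split; unfold cis, Ci; simpl; auto_derive; auto; ring.
      - intros t. apply continuous_Cmult; [apply continuous_const|now apply CG't]. }
    rewrite Cint_scal in E by (intros; now apply CG't).
    replace (Cint (G' s)) with (/ (RtoC s * Ci) * (RtoC s * Ci * Cint (G' s))).
    + rewrite E. ring.
    + rewrite Cmult_assoc, Cinv_l, Cmult_1_l by exact Hk. reflexivity. }
assert (DC : forall s, (0 <= s <= 1)%R -> path_derive (fun s => Cint (G s)) s 0).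
{ intros s Hs. assert (Hs' : (- d < s < 1 + d)%R) by lra.
  assert (NB : forall P : R -> Prop, (forall y, (- d < y < 1 + d)%R -> P y) -> locally s P).
  { intros P HP. exists (mkposreal d Dd). intros y Hy. apply HP.
    change (Rabs (y - s) < d)%R in Hy. apply Rabs_lt_between in Hy. lra. }
  assert (NB2 : forall t (P : R -> R -> Prop), (forall y v, (- d < y < 1 + d)%R -> P y v) -> locally_2d P s t).
  { intros t P HP. exists (mkposreal d Dd). intros u v Hu Hv. apply HP.
    apply Rabs_lt_between in Hu. simpl in Hu. lra. }
  rewrite <- (HJ s Hs'). split; simpl.
  - rewrite <- (RInt_ext (fun t => Derive (fun z => fst (G z t)) s)).
    2:{ intros t _. apply is_derive_unique, DG, Hs'. }
    apply (is_derive_RInt_param (fun s t => fst (G s t))).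
    + apply NB. intros y Hy t _. exists (fst (G' y t)). exact (proj1 (DG y t Hy)).
    + intros t _. apply continuity_2d_pt_ext_loc with (f := fun u v => fst (G' u v)).
      * apply NB2. intros y v Hy. symmetry. exact (is_derive_unique _ _ _ (proj1 (DG y v Hy))).
      * apply continuity_2d_pt_filterlim.
        apply (continuous_fst_C (fun p : R * R => G' (fst p) (snd p)) (s, t)), CG', Hs'.
    + apply NB. intros y Hy. apply ex_RInt_fst. intros t. now apply CG.
  - rewrite <- (RInt_ext (fun t => Derive (fun z => snd (G z t)) s)).
    2:{ intros t _. apply is_derive_unique, DG, Hs'. }
    apply (is_derive_RInt_param (fun s t => snd (G s t))).
    + apply NB. intros y Hy t _. exists (snd (G' y t)). exact (proj2 (DG y t Hy)).
    + intros t _. apply continuity_2d_pt_ext_loc with (f := fun u v => snd (G' u v)).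
      * apply NB2. intros y v Hy. symmetry. exact (is_derive_unique _ _ _ (proj2 (DG y v Hy))).
      * apply continuity_2d_pt_filterlim.
        apply (continuous_snd_C (fun p : R * R => G' (fst p) (snd p)) (s, t)), CG', Hs'.
    + apply NB. intros y Hy. apply ex_RInt_snd. intros t. now apply CG. }
assert (E01 : Cint (G 0%R) = Cint (G 1%R)).
{ rewrite (surjective_pairing (Cint (G 0%R))), (surjective_pairing (Cint (G 1%R))). f_equal.
  - apply (eq_is_derive (V := R_NormedModule) (fun s => fst (Cint (G s)))); [|lra].
    intros s Hs. apply (DC s Hs).
  - apply (eq_is_derive (V := R_NormedModule) (fun s => snd (Cint (G s)))); [|lra].
    intros s Hs. apply (DC s Hs). }
rewrite (Cint_ext _ (G 1%R)).
2:{ intros t. unfold G, Z. do 2 f_equal. ring. }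
rewrite <- E01, (Cint_ext _ (fun t => f w * kern q t)).
2:{ intros t. unfold G, Z. do 2 f_equal. ring. }
rewrite Cint_scal by (intros; now apply continuous_kern).
rewrite Cint_kern by exact Hq. ring.
Qed.

(** The coefficient integrals depend a priori on the radius. Uniqueness of power series identifies
    all of them with those at radius 1/2, so that one sequence serves the whole disc and Cauchy's
    estimate holds for it at every radius. *)
Theorem disc_expansion : exists c : nat -> C,
  (forall u, (Cmod u < 1)%R -> is_Cseries (fun n => u ^ n * c n) (f u)) /\
  (forall r M, (0 < r < 1)%R -> (forall t, (0 <= t <= 2 * PI)%R -> (Cmod (f (RtoC r * cis t)%C) <= M)%R) ->
     forall n, (Cmod (c n) * r ^ n <= 2 * M)%R).
Proof.
set (a := fun r n => Cint (fun t => f (RtoC r * cis t) * cis (- INR n * t)) / (RtoC (2 * PI) * RtoC r ^ n)).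
assert (P := two_PI_pos).
assert (HP : RtoC (2 * PI) <> 0).
{ apply Cmod_gt_0. rewrite Cmod_R, Rabs_pos_eq; lra. }
assert (HR : forall r, (0 < r)%R -> RtoC r <> 0).
{ intros r Hr. apply Cmod_gt_0. rewrite Cmod_R, Rabs_pos_eq; lra. }
assert (HS : forall r u, (r < 1)%R -> (Cmod u < r)%R -> is_Cseries (fun n => u ^ n * a r n) (f u)).
{ intros r u Hr Hu. assert (Pu := Cmod_ge_0 u). assert (Hr0 : RtoC r <> 0) by (apply HR; lra).
  assert (Hq : (Cmod (u / RtoC r) < 1)%R).
  { rewrite Cmod_div, Cmod_R, Rabs_pos_eq by (auto; lra).
    apply Rmult_lt_reg_r with r; [lra|]. unfold Rdiv. rewrite Rmult_assoc, Rinv_l; lra. }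
  assert (K := kern_series (fun t => f (RtoC r * cis t)) (u / RtoC r)
    (continuous_on_circle r ltac:(lra)) Hq).
  cbv beta in K. rewrite Cauchy_formula in K by assumption.
  apply (is_Cseries_scal (/ RtoC (2 * PI))) in K.
  replace (/ RtoC (2 * PI) * (RtoC (2 * PI) * f u)) with (f u) in K by (field; exact HP).
  eapply is_Cseries_ext; [|exact K]. intros n. cbv beta. unfold a.
  unfold Cdiv. rewrite Cpow_mult_l, Cpow_inv by exact Hr0. field.
  split; [apply Cpow_nz|]; assumption. }
assert (HE : forall r n, (0 < r < 1)%R -> a r n = a (1 / 2)%R n).
{ intros r n Hr. apply (pow_series_inj (a r) (a (1 / 2)%R) f (Rmin r (1 / 2))).
  - apply Rmin_pos; lra.
  - intros w Hw. apply HS; [lra|]. eapply Rlt_le_trans; [apply Hw|apply Rmin_l].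
  - intros w Hw. apply HS; [lra|]. eapply Rlt_le_trans; [apply Hw|apply Rmin_r]. }
exists (a (1 / 2)%R). split.
- intros u Hu. assert (Pu := Cmod_ge_0 u). set (r := ((1 + Cmod u) / 2)%R).
  eapply is_Cseries_ext; [|apply (HS r); unfold r; lra].
  intros n. cbv beta. rewrite HE; [reflexivity|unfold r; lra].
- intros r M Hr HM n. rewrite <- (HE r n Hr). unfold a.
  rewrite Cmod_div by (apply Cmult_neq_0; [exact HP|apply Cpow_nz, HR; lra]).
  rewrite Cmod_mult, Cmod_pow, !Cmod_R, !Rabs_pos_eq by lra.
  assert (B : (Cmod (Cint (fun t => (f (RtoC r * cis t) * cis (- INR n * t))%C) ) <= 2 * (2 * PI * M))%R).
  { apply Cint_bound.
    - intros t. apply continuous_Cmult; [apply (continuous_on_circle r); lra|apply continuous_cis_scal].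
    - intros t Ht. rewrite (Cmod_mult _ (cis _)), Cmod_cis, Rmult_1_r. now apply HM. }
  assert (Pr : (0 < r ^ n)%R) by (apply pow_lt; lra).
  apply Rle_trans with (2 * (2 * PI * M) / (2 * PI * r ^ n) * r ^ n)%R.
  + apply Rmult_le_compat_r; [lra|]. apply Rmult_le_compat_r; [|exact B].
    apply Rlt_le, Rinv_0_lt_compat, Rmult_lt_0_compat; lra.
  + right. field. lra.
Qed.

End Cauchy.

(** * Double power series *)

(** Subexponential growth, that is, convergence on the whole open bidisc. Since every [r < 1] is
    allowed, losing some radius in an estimate is harmless. *)
Definition dgrowth (a : nat -> nat -> C) : Prop :=
  forall r : R, (0 < r < 1)%R -> exists A : R, forall m n, (Cmod (a m n) * r ^ (m + n) <= A)%R.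

(** The weight is the number of terms on the antidiagonal of (m, n). A bound on weighted
    coefficients thus bounds a whole homogeneous part, and it also dominates the factors created by
    differentiation. *)
Definition wt (a : nat -> nat -> C) (m n : nat) : C := RtoC (INR (S (m + n))) * a m n.
Definition Dx (a : nat -> nat -> C) (m n : nat) : C := RtoC (INR (S m)) * a (S m) n.
Definition Dy (a : nat -> nat -> C) (m n : nat) : C := RtoC (INR (S n)) * a m (S n).

(* The double power series [sum a_mn x^m y^n] is summed along the antidiagonals
   [m + n = s]. *)
Definition hom (a : nat -> nat -> C) (s : nat) (x y : C) : C :=
  csum (fun m => a m (s - m)%nat * (x ^ m * y ^ (s - m))) s.
Definition dser (a : nat -> nat -> C) (x y : C) : C := Csum (fun s => hom a s x y).

Lemma Cmod_INR (n : nat) : Cmod (RtoC (INR n)) = INR n.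
Proof. rewrite Cmod_R. apply Rabs_pos_eq, pos_INR. Qed.

Lemma linear_geom_bounded (q : R) : (0 < q < 1)%R ->
  exists B : R, (0 < B)%R /\ forall n, (INR (S n) * q ^ n <= B)%R.
Proof.
intros Hq. set (d := (/ q - 1)%R).
assert (Hd : (0 < d)%R).
{ unfold d. assert (H := Rinv_lt_contravar q 1 ltac:(lra) ltac:(lra)). rewrite Rinv_1 in H. lra. }
exists (1 + / d)%R. split.
{ assert (H := Rinv_0_lt_compat d Hd). lra. }
intros n. assert (H := poly n d Hd).
assert (Hp : (0 < q ^ n)%R) by (apply pow_lt; lra).
assert (E : ((1 + d) ^ n * q ^ n = 1)%R).
{ rewrite <- Rpow_mult_distr. unfold d. replace ((1 + (/ q - 1)) * q)%R with 1%R by (field; lra). apply pow1. }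
assert (H2 : ((1 + INR n * d) * q ^ n <= 1)%R).
{ rewrite <- E. apply Rmult_le_compat_r; lra. }
assert (Hq1 : (q ^ n <= 1)%R).
{ rewrite <- (pow1 n). apply pow_incr. lra. }
rewrite S_INR.
assert (H3 : (INR n * q ^ n <= / d)%R).
{ apply Rmult_le_reg_l with d; [exact Hd|]. rewrite Rinv_r by lra. nra. }
lra.
Qed.

(** With [r = s * s], one factor [s ^ (m + n)] absorbs the weight and the other is left for [a]. *)
Lemma dgrowth_wt (a : nat -> nat -> C) : dgrowth a -> dgrowth (wt a).
Proof.
intros H r Hr. set (s := sqrt r).
assert (Hs : (0 < s < 1)%R).
{ split; [apply sqrt_lt_R0; lra|]. rewrite <- sqrt_1. apply sqrt_lt_1; lra. }
assert (Es : r = (s * s)%R) by (symmetry; apply sqrt_sqrt; lra).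
destruct (H s Hs) as [A HA]. destruct (linear_geom_bounded s Hs) as [B [HB0 HB]].
exists (B * A)%R. intros m n. unfold wt. rewrite Cmod_mult, Cmod_INR.
rewrite Es, Rpow_mult_distr.
replace (INR (S (m + n)) * Cmod (a m n) * (s ^ (m + n) * s ^ (m + n)))%R with
  ((INR (S (m + n)) * s ^ (m + n)) * (Cmod (a m n) * s ^ (m + n)))%R by ring.
apply Rmult_le_compat; auto.
- apply Rmult_le_pos; [apply pos_INR|apply pow_le; lra].
- apply Rmult_le_pos; [apply Cmod_ge_0|apply pow_le; lra].
Qed.

Lemma dgrowth_Dx (a : nat -> nat -> C) : dgrowth a -> dgrowth (Dx a).
Proof.
intros H r Hr. destruct (dgrowth_wt a H r Hr) as [A HA].
exists (A / r)%R. intros m n. specialize (HA (S m) n). unfold wt in HA. unfold Dx.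
rewrite Cmod_mult, Cmod_INR in *.
apply Rmult_le_reg_r with r; [lra|]. unfold Rdiv. rewrite (Rmult_assoc A), Rinv_l, Rmult_1_r by lra.
eapply Rle_trans; [|exact HA]. simpl (S m + n)%nat. rewrite <- (tech_pow_Rmult r).
rewrite (S_INR (S (m + n))), !S_INR, plus_INR.
assert (P1 := pos_INR m). assert (P2 := pos_INR n).
assert (P3 := Cmod_ge_0 (a (S m) n)). assert (P4 : (0 <= r ^ (m + n))%R) by (apply pow_le; lra).
assert (P5 : (0 <= Cmod (a (S m) n) * (r * r ^ (m + n)))%R) by (repeat apply Rmult_le_pos; lra).
replace ((INR m + 1) * Cmod (a (S m) n) * r ^ (m + n) * r)%R with
  ((INR m + 1) * (Cmod (a (S m) n) * (r * r ^ (m + n))))%R by ring.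
rewrite Rmult_assoc. apply Rmult_le_compat_r; lra.
Qed.

Lemma dgrowth_transpose (a : nat -> nat -> C) : dgrowth a -> dgrowth (fun m n => a n m).
Proof.
intros H r Hr. destruct (H r Hr) as [A HA]. exists A. intros m n.
rewrite (Nat.add_comm m n). apply HA.
Qed.

Lemma dgrowth_Dy (a : nat -> nat -> C) : dgrowth a -> dgrowth (Dy a).
Proof. intros H. exact (dgrowth_transpose _ (dgrowth_Dx _ (dgrowth_transpose _ H))). Qed.

(** A coefficient bound at a radius [t] strictly between [r] and 1 becomes geometric decay with
    ratio [r / t], uniformly on the bidisc of radius [r]. *)
Lemma hom_bound (a : nat -> nat -> C) (r : R) : dgrowth a -> (0 < r < 1)%R ->
  exists A q : R, (0 <= q < 1)%R /\ forall s x y, (Cmod x <= r)%R -> (Cmod y <= r)%R ->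
    (Cmod (hom a s x y) <= A * q ^ s)%R.
Proof.
intros Ha Hr. set (t := ((1 + r) / 2)%R). assert (Ht : (r < t < 1)%R) by (unfold t; lra).
destruct (dgrowth_wt a Ha t ltac:(lra)) as [A HA].
exists A, (r / t)%R. split.
{ split; [apply Rlt_le, Rdiv_lt_0_compat; lra|].
  apply Rmult_lt_reg_r with t; [lra|]. unfold Rdiv. rewrite Rmult_assoc, Rinv_l; lra. }
intros s x y Hx Hy.
assert (Hts : (0 < t ^ s)%R) by (apply pow_lt; lra).
assert (PS : (0 < INR (S s))%R) by (apply lt_0_INR; lia).
replace (A * (r / t) ^ s)%R with (INR (S s) * (A / (INR (S s) * t ^ s) * r ^ s))%R.
2:{ unfold Rdiv at 2. rewrite Rpow_mult_distr, pow_inv. field. split; lra. }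
apply csum_bound. intros m Hm. rewrite !Cmod_mult, !Cmod_pow.
assert (HB := HA m (s - m)%nat). unfold wt in HB.
replace (m + (s - m))%nat with s in HB by lia.
rewrite Cmod_mult, Cmod_INR in HB.
apply Rmult_le_compat; [apply Cmod_ge_0| | |].
- apply Rmult_le_pos; apply pow_le, Cmod_ge_0.
- apply Rmult_le_reg_r with (INR (S s) * t ^ s)%R; [apply Rmult_lt_0_compat; lra|].
  unfold Rdiv. rewrite (Rmult_assoc A), Rinv_l by (apply Rgt_not_eq, Rmult_lt_0_compat; lra). lra.
- replace s with (m + (s - m))%nat at 2 by lia. rewrite pow_add.
  apply Rmult_le_compat; try (apply pow_le, Cmod_ge_0); apply pow_incr; (split; [apply Cmod_ge_0|lra]).
Qed.

Lemma radius_between (x y : C) : (Cmod x < 1)%R -> (Cmod y < 1)%R ->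
  exists r, (0 < r < 1)%R /\ (Cmod x < r)%R /\ (Cmod y < r)%R.
Proof.
intros Hx Hy. exists ((1 + Rmax (Cmod x) (Cmod y)) / 2)%R.
assert (P := Cmod_ge_0 x). assert (Q := Cmod_ge_0 y).
assert (L := Rmax_l (Cmod x) (Cmod y)). assert (L' := Rmax_r (Cmod x) (Cmod y)).
assert (U := Rmax_lub_lt _ _ _ Hx Hy). lra.
Qed.

Lemma is_dser (a : nat -> nat -> C) (x y : C) : dgrowth a -> (Cmod x < 1)%R -> (Cmod y < 1)%R ->
  is_Cseries (fun s => hom a s x y) (dser a x y).
Proof.
intros Ha Hx Hy. destruct (radius_between x y Hx Hy) as [r [Hr [H1 H2]]].
destruct (hom_bound a r Ha Hr) as [A [q [Hq HB]]].
destruct (ex_Cseries (fun s => hom a s x y) (fun s => A * q ^ s)%R) as [l Hl].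
- intros s. apply HB; lra.
- eexists. apply (is_series_geom_scal A q Hq).
- unfold dser. rewrite (Csum_unique _ _ Hl). exact Hl.
Qed.

Lemma dser_eq (a : nat -> nat -> C) (x y l : C) :
  is_Cseries (fun s => hom a s x y) l -> dser a x y = l.
Proof. apply Csum_unique. Qed.

Lemma hom_ext (a b : nat -> nat -> C) (s : nat) (x y : C) :
  (forall m n, a m n = b m n) -> hom a s x y = hom b s x y.
Proof. intros H. apply csum_ext. intros k _. now rewrite H. Qed.

Lemma dser_ext (a b : nat -> nat -> C) (x y : C) :
  (forall m n, a m n = b m n) -> dser a x y = dser b x y.
Proof. intros H. apply Csum_ext. intros s. now apply hom_ext. Qed.

Lemma hom_transpose (a : nat -> nat -> C) (s : nat) (x y : C) :
  hom a s x y = hom (fun m n => a n m) s y x.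
Proof.
unfold hom. rewrite csum_rev. apply csum_ext. intros k Hk.
replace (s - (s - k))%nat with k by lia. ring.
Qed.

Lemma dser_transpose (a : nat -> nat -> C) (x y : C) :
  dser a x y = dser (fun m n => a n m) y x.
Proof. apply Csum_ext. intros s. apply hom_transpose. Qed.

(** The inequality is multiplied through by [r], so that the bound contains [r ^ m] and no exponent
    [m - 1]; [r ^ 2] has the same purpose in [pow_taylor_bound]. *)
Lemma pow_diff_bound (r : R) (x X : C) (m : nat) : (0 < r)%R -> (Cmod x <= r)%R -> (Cmod X <= r)%R ->
  (r * Cmod (X ^ m - x ^ m) <= INR m * r ^ m * Cmod (X - x))%R.
Proof.
intros Hr Hx HX. assert (Ph := Cmod_ge_0 (X - x)). induction m as [|m IH].
- simpl. replace (1 - 1) with (RtoC 0) by ring. rewrite Cmod_0. lra.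
- replace (X ^ S m - x ^ S m) with (X * (X ^ m - x ^ m) + x ^ m * (X - x)) by (rewrite !Cpow_S; ring).
  apply Rle_trans with (r * (Cmod X * Cmod (X ^ m - x ^ m) + Cmod x ^ m * Cmod (X - x)))%R.
  { apply Rmult_le_compat_l; [lra|]. eapply Rle_trans; [apply Cmod_triangle|].
    rewrite !Cmod_mult, Cmod_pow. apply Rle_refl. }
  assert (Pp : (Cmod x ^ m <= r ^ m)%R) by (apply pow_incr; split; [apply Cmod_ge_0|lra]).
  assert (P1 := Cmod_ge_0 (X ^ m - x ^ m)).
  assert (H1 : (Cmod X * (r * Cmod (X ^ m - x ^ m)) <= r * (INR m * r ^ m * Cmod (X - x)))%R).
  { apply Rmult_le_compat; auto; [apply Cmod_ge_0|apply Rmult_le_pos; lra]. }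
  assert (H2 : (r * (Cmod x ^ m * Cmod (X - x)) <= r * (r ^ m * Cmod (X - x)))%R).
  { apply Rmult_le_compat_l; [lra|]. apply Rmult_le_compat_r; lra. }
  rewrite S_INR, <- tech_pow_Rmult. lra.
Qed.

Lemma pow_taylor_bound (r : R) (x X : C) (m : nat) : (0 < r)%R -> (Cmod x <= r)%R -> (Cmod X <= r)%R ->
  (r ^ 2 * Cmod (X ^ m - x ^ m - (X - x) * (RtoC (INR m) * x ^ (m - 1)))
   <= INR m ^ 2 * r ^ m * Cmod (X - x) ^ 2)%R.
Proof.
intros Hr Hx HX. assert (Ph := Cmod_ge_0 (X - x)). induction m as [|m IH].
- simpl. replace (1 - 1 - (X - x) * (0 * 1)) with (RtoC 0) by ring. rewrite Cmod_0. lra.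
- set (E := X ^ m - x ^ m - (X - x) * (RtoC (INR m) * x ^ (m - 1))) in *.
  assert (ES : X ^ S m - x ^ S m - (X - x) * (RtoC (INR (S m)) * x ^ (S m - 1))
    = X * E + RtoC (INR m) * x ^ (m - 1) * ((X - x) * (X - x))).
  { unfold E. rewrite S_INR, RtoC_plus, !Cpow_S. replace (S m - 1)%nat with m by lia.
    destruct m as [|m].
    { change (INR 0) with 0%R. change (0 - 1)%nat with 0%nat. change (X ^ 0) with (RtoC 1). change (x ^ 0) with (RtoC 1). ring. }
    replace (S m - 1)%nat with m by lia. rewrite !Cpow_S. ring. }
  rewrite ES.
  apply Rle_trans with (r ^ 2 * (Cmod X * Cmod E + INR m * Cmod x ^ (m - 1) * (Cmod (X - x) * Cmod (X - x))))%R.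
  { apply Rmult_le_compat_l; [apply pow_le; lra|]. eapply Rle_trans; [apply Cmod_triangle|].
    rewrite !Cmod_mult, Cmod_pow, Cmod_INR. apply Rle_refl. }
  assert (P1 := Cmod_ge_0 E). assert (Pm := pos_INR m).
  assert (H1 : (Cmod X * (r ^ 2 * Cmod E) <= r * (INR m ^ 2 * r ^ m * Cmod (X - x) ^ 2))%R).
  { apply Rmult_le_compat; auto; [apply Cmod_ge_0|apply Rmult_le_pos; [apply pow_le|]; lra]. }
  assert (H2 : (r ^ 2 * (INR m * Cmod x ^ (m - 1)) <= INR m * r ^ S m)%R).
  { destruct m as [|m]; [simpl; lra|]. replace (S m - 1)%nat with m by lia.
    assert (Pp : (Cmod x ^ m <= r ^ m)%R) by (apply pow_incr; split; [apply Cmod_ge_0|lra]).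
    replace (INR (S m) * r ^ S (S m))%R with (r ^ 2 * (INR (S m) * r ^ m))%R by (simpl; ring).
    apply Rmult_le_compat_l; [apply pow_le; lra|]. apply Rmult_le_compat_l; lra. }
  assert (H3 : (r ^ 2 * (INR m * Cmod x ^ (m - 1)) * (Cmod (X - x) * Cmod (X - x))
     <= INR m * r ^ S m * (Cmod (X - x) * Cmod (X - x)))%R).
  { apply Rmult_le_compat_r; [nra|exact H2]. }
  assert (P2 : (0 <= r ^ S m * Cmod (X - x) ^ 2)%R).
  { apply Rmult_le_pos; apply pow_le; lra. }
  assert (P3 : (INR m ^ 2 + INR m <= INR (S m) ^ 2)%R) by (rewrite S_INR; nra).
  apply Rle_trans with ((INR m ^ 2 + INR m) * (r ^ S m * Cmod (X - x) ^ 2))%R.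
  + simpl in *. lra.
  + rewrite (Rmult_assoc (INR (S m) ^ 2)). apply Rmult_le_compat_r; assumption.
Qed.

Definition mono2 (x y X Y : C) (m n : nat) : C :=
  X ^ m * Y ^ n - x ^ m * y ^ n
  - (X - x) * (RtoC (INR m) * x ^ (m - 1) * y ^ n)
  - (Y - y) * (x ^ m * (RtoC (INR n) * y ^ (n - 1))).

Lemma mono2_bound (r : R) (x y X Y : C) (m n : nat) : (0 < r)%R ->
  (Cmod x <= r)%R -> (Cmod X <= r)%R -> (Cmod y <= r)%R -> (Cmod Y <= r)%R ->
  (r ^ 2 * Cmod (mono2 x y X Y m n)
   <= INR (m + n) ^ 2 * r ^ (m + n) * (Cmod (X - x) + Cmod (Y - y)) ^ 2)%R.
Proof.
intros Hr Hx HX Hy HY.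
set (Em := X ^ m - x ^ m - (X - x) * (RtoC (INR m) * x ^ (m - 1))).
set (En := Y ^ n - y ^ n - (Y - y) * (RtoC (INR n) * y ^ (n - 1))).
(* Each of the three terms is of second order in the increments: two Taylor remainders in one
   variable and a product of first-order changes. *)
assert (E : mono2 x y X Y m n = Em * Y ^ n + ((X - x) * (RtoC (INR m) * x ^ (m - 1))) * (Y ^ n - y ^ n) + x ^ m * En).
{ unfold mono2, Em, En. ring. }
assert (B1 := pow_taylor_bound r x X m Hr Hx HX). fold Em in B1.
assert (B2 := pow_taylor_bound r y Y n Hr Hy HY). fold En in B2.
assert (B3 := pow_diff_bound r y Y n Hr Hy HY).
assert (Pm := pos_INR m). assert (Pn := pos_INR n).
set (h := Cmod (X - x)) in *. set (k := Cmod (Y - y)) in *.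
assert (Ph : (0 <= h)%R) by apply Cmod_ge_0. assert (Pk : (0 <= k)%R) by apply Cmod_ge_0.
assert (rm : (0 < r ^ m)%R) by now apply pow_lt. assert (rn : (0 < r ^ n)%R) by now apply pow_lt.
assert (Y1 : (Cmod Y ^ n <= r ^ n)%R) by (apply pow_incr; split; [apply Cmod_ge_0|lra]).
assert (X1 : (Cmod x ^ m <= r ^ m)%R) by (apply pow_incr; split; [apply Cmod_ge_0|lra]).
assert (C1 : (r ^ 2 * Cmod (Em * Y ^ n) <= INR m ^ 2 * r ^ m * h ^ 2 * r ^ n)%R).
{ rewrite Cmod_mult, Cmod_pow, <- Rmult_assoc. apply Rmult_le_compat; auto.
  - apply Rmult_le_pos; [apply pow_le; lra|apply Cmod_ge_0].
  - apply pow_le, Cmod_ge_0. }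
assert (C3 : (r ^ 2 * Cmod (x ^ m * En) <= r ^ m * (INR n ^ 2 * r ^ n * k ^ 2))%R).
{ rewrite Cmod_mult, Cmod_pow.
  replace (r ^ 2 * (Cmod x ^ m * Cmod En))%R with (Cmod x ^ m * (r ^ 2 * Cmod En))%R by ring.
  apply Rmult_le_compat; auto.
  - apply pow_le, Cmod_ge_0.
  - apply Rmult_le_pos; [apply pow_le; lra|apply Cmod_ge_0]. }
assert (C2 : (r ^ 2 * Cmod (((X - x) * (RtoC (INR m) * x ^ (m - 1))) * (Y ^ n - y ^ n))
   <= (h * (INR m * r ^ m)) * (INR n * r ^ n * k))%R).
{ rewrite !Cmod_mult, Cmod_pow, Cmod_INR. fold h.
  replace (r ^ 2 * (h * (INR m * Cmod x ^ (m - 1)) * Cmod (Y ^ n - y ^ n)))%R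
    with ((h * (r * (INR m * Cmod x ^ (m - 1)))) * (r * Cmod (Y ^ n - y ^ n)))%R by ring.
  apply Rmult_le_compat; auto.
  - assert (0 <= Cmod x ^ (m - 1))%R by (apply pow_le, Cmod_ge_0).
    repeat apply Rmult_le_pos; lra.
  - apply Rmult_le_pos; [lra|apply Cmod_ge_0].
  - apply Rmult_le_compat_l; [lra|].
    destruct m as [|m]; [simpl; lra|]. replace (S m - 1)%nat with m by lia.
    assert (Pp : (Cmod x ^ m <= r ^ m)%R) by (apply pow_incr; split; [apply Cmod_ge_0|lra]).
    replace (INR (S m) * r ^ S m)%R with (r * (INR (S m) * r ^ m))%R by (simpl; ring).
    apply Rmult_le_compat_l; [lra|]. apply Rmult_le_compat_l; lra. }
apply Rle_trans with (r ^ 2 * (Cmod (Em * Y ^ n) + Cmod (((X - x) * (RtoC (INR m) * x ^ (m - 1))) * (Y ^ n - y ^ n)) + Cmod (x ^ m * En)))%R.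
{ apply Rmult_le_compat_l; [apply pow_le; lra|]. rewrite E.
  eapply Rle_trans; [apply Cmod_triangle|]. apply Rplus_le_compat_r, Cmod_triangle. }
rewrite plus_INR, pow_add.
apply Rle_trans with ((INR m ^ 2 * h ^ 2 + INR m * INR n * (h * k) + INR n ^ 2 * k ^ 2) * (r ^ m * r ^ n))%R; [lra|].
replace ((INR m + INR n) ^ 2 * (r ^ m * r ^ n) * (h + k) ^ 2)%R with
  ((INR m + INR n) ^ 2 * (h + k) ^ 2 * (r ^ m * r ^ n))%R by ring.
apply Rmult_le_compat_r; [apply Rmult_le_pos; lra|].
set (M := INR m) in *. set (N := INR n) in *.
assert (Q : (0 <= M * h)%R) by now apply Rmult_le_pos.
assert (Q2 : (0 <= N * k)%R) by now apply Rmult_le_pos.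
assert (Q3 : (0 <= N * h)%R) by now apply Rmult_le_pos.
assert (Q4 : (0 <= M * k)%R) by now apply Rmult_le_pos.
replace ((M + N) ^ 2 * (h + k) ^ 2)%R with ((M * h + N * k + (N * h + M * k)) ^ 2)%R by ring.
set (u := (M * h)%R) in *. set (v := (N * k)%R) in *. set (w := (N * h + M * k)%R).
assert (0 <= w)%R by (unfold w; lra).
replace (M ^ 2 * h ^ 2 + M * N * (h * k) + N ^ 2 * k ^ 2)%R with (u ^ 2 + u * v + v ^ 2)%R by (unfold u, v; ring).
nra.
Qed.

(** Differentiation lowers the degree, so degree [S s] of [a] is paired with degree [s] of [Dx a]
    and [Dy a]; degree 0 is constant and drops out. *)
Lemma hom_taylor (a : nat -> nat -> C) (s : nat) (x y X Y : C) :
  hom a (S s) X Y - hom a (S s) x y - (X - x) * hom (Dx a) s x y - (Y - y) * hom (Dy a) s x y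
  = csum (fun m => a m (S s - m)%nat * mono2 x y X Y m (S s - m)) (S s).
Proof.
assert (E1 : hom (Dx a) s x y
  = csum (fun m => a m (S s - m)%nat * (RtoC (INR m) * x ^ (m - 1) * y ^ (S s - m))) (S s)).
{ rewrite csum_first.
  replace (a 0%nat (S s - 0)%nat * (RtoC (INR 0) * x ^ (0 - 1) * y ^ (S s - 0))) with (RtoC 0) by (simpl; ring).
  rewrite Cplus_0_l. apply csum_ext. intros m Hm. unfold Dx.
  replace (S s - S m)%nat with (s - m)%nat by lia. replace (S m - 1)%nat with m by lia. ring. }
assert (E2 : hom (Dy a) s x y
  = csum (fun m => a m (S s - m)%nat * (x ^ m * (RtoC (INR (S s - m)) * y ^ (S s - m - 1)))) (S s)).
{ rewrite csum_S.
  replace (S s - S s)%nat with 0%nat by lia.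
  replace (a (S s) 0%nat * (x ^ S s * (RtoC (INR 0) * y ^ (0 - 1)))) with (RtoC 0) by (simpl; ring).
  rewrite Cplus_0_r. apply csum_ext. intros m Hm. unfold Dy.
  replace (S s - m)%nat with (S (s - m)) by lia. replace (S (s - m) - 1)%nat with (s - m)%nat by lia. ring. }
rewrite E1, E2. unfold hom at 1 2. rewrite <- !csum_scal, <- !csum_minus.
apply csum_ext. intros m _. unfold mono2. ring.
Qed.

Lemma hom_0 (a : nat -> nat -> C) (x y : C) : hom a 0 x y = a 0%nat 0%nat.
Proof. unfold hom. rewrite csum_0. simpl. ring. Qed.

(** The quadratic remainder, uniform on a smaller bidisc, gives joint differentiability, the chain
    rule and continuity together. *)
Lemma dser_taylor (a : nat -> nat -> C) (r : R) : dgrowth a -> (0 < r < 1)%R ->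
  exists K : R, forall x y X Y,
    (Cmod x <= r)%R -> (Cmod y <= r)%R -> (Cmod X <= r)%R -> (Cmod Y <= r)%R ->
    (Cmod (dser a X Y - dser a x y - (X - x) * dser (Dx a) x y - (Y - y) * dser (Dy a) x y)
     <= K * (Cmod (X - x) + Cmod (Y - y)) ^ 2)%R.
Proof.
intros Ha Hr. set (t := ((1 + r) / 2)%R). assert (Ht : (r < t < 1)%R) by (unfold t; lra).
(* Three weights: one pays for the number of terms on an antidiagonal, two for the square of the
   degree in [mono2_bound]. *)
destruct (dgrowth_wt _ (dgrowth_wt _ (dgrowth_wt a Ha)) t ltac:(lra)) as [A HA].
set (q := (r / t)%R).
assert (Hq : (0 <= q < 1)%R).
{ unfold q. split; [apply Rlt_le, Rdiv_lt_0_compat; lra|].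
  apply Rmult_lt_reg_r with t; [lra|]. unfold Rdiv. rewrite Rmult_assoc, Rinv_l; lra. }
exists (A * / r ^ 2 * q / (1 - q))%R.
intros x y X Y Hx Hy HX HY.
set (D := ((Cmod (X - x) + Cmod (Y - y)) ^ 2)%R).
assert (HD : (0 <= D)%R).
{ unfold D. apply pow_le. assert (P1 := Cmod_ge_0 (X - x)). assert (P2 := Cmod_ge_0 (Y - y)). lra. }
assert (Hs : is_Cseries (fun s => hom a (S s) X Y - hom a (S s) x y
     - (X - x) * hom (Dx a) s x y - (Y - y) * hom (Dy a) s x y)
   (dser a X Y - dser a x y - (X - x) * dser (Dx a) x y - (Y - y) * dser (Dy a) x y)).
{ assert (T1 := proj1 (is_Cseries_tail _ _) (is_dser a X Y Ha ltac:(lra) ltac:(lra))).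
  assert (T2 := proj1 (is_Cseries_tail _ _) (is_dser a x y Ha ltac:(lra) ltac:(lra))).
  cbv beta in T1, T2. rewrite hom_0 in T1, T2.
  assert (T3 := is_Cseries_scal (X - x) _ _ (is_dser _ x y (dgrowth_Dx a Ha) ltac:(lra) ltac:(lra))).
  assert (T4 := is_Cseries_scal (Y - y) _ _ (is_dser _ x y (dgrowth_Dy a Ha) ltac:(lra) ltac:(lra))).
  assert (T := is_Cseries_minus _ _ _ _ (is_Cseries_minus _ _ _ _ (is_Cseries_minus _ _ _ _ T1 T2) T3) T4).
  cbv beta in T.
  replace (dser a X Y - dser a x y) with
    (dser a X Y - a 0%nat 0%nat - (dser a x y - a 0%nat 0%nat)) by ring.
  exact T. }
replace (A * / r ^ 2 * q / (1 - q) * D)%R with (A * / r ^ 2 * q * D / (1 - q))%R by (field; split; lra).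
apply (is_Cseries_bound _ (fun s => A * / r ^ 2 * q * D * q ^ s)%R _ _) with (2 := is_series_geom_scal _ q Hq) (3 := Hs).
intros s. cbv beta. rewrite hom_taylor.
assert (PS : (0 < INR (S (S s)))%R) by (apply lt_0_INR; lia).
assert (Pt : (0 < t ^ S s)%R) by (apply pow_lt; lra).
replace (A * / r ^ 2 * q * D * q ^ s)%R with
  (INR (S (S s)) * (A / (INR (S (S s)) ^ 3 * t ^ S s) * (/ r ^ 2 * (INR (S (S s)) ^ 2 * r ^ S s * D))))%R.
2:{ unfold q. replace (A * / r ^ 2 * (r / t) * D * (r / t) ^ s)%R with (A * / r ^ 2 * D * (r / t) ^ S s)%R by (simpl; ring).
    unfold Rdiv at 2. rewrite Rpow_mult_distr, pow_inv. field. repeat split; lra. }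
apply csum_bound. intros m Hm. rewrite Cmod_mult.
apply Rmult_le_compat; try apply Cmod_ge_0.
- assert (HB := HA m (S s - m)%nat). unfold wt in HB.
  replace (m + (S s - m))%nat with (S s) in HB by lia.
  rewrite !Cmod_mult, Cmod_INR in HB.
  assert (P3 : (0 < INR (S (S s)) ^ 3 * t ^ S s)%R) by (apply Rmult_lt_0_compat; [apply pow_lt|]; lra).
  apply Rmult_le_reg_r with (INR (S (S s)) ^ 3 * t ^ S s)%R; [exact P3|].
  unfold Rdiv. rewrite (Rmult_assoc A), Rinv_l by lra. rewrite Rmult_1_r.
  eapply Rle_trans; [|exact HB]. right; ring.
- assert (HB := mono2_bound r x y X Y m (S s - m) ltac:(lra) Hx HX Hy HY).
  replace (m + (S s - m))%nat with (S s) in HB by lia. fold D in HB.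
  assert (P2 : (0 < r ^ 2)%R) by (apply pow_lt; lra).
  apply Rmult_le_reg_l with (r ^ 2)%R; [exact P2|].
  rewrite <- Rmult_assoc, Rinv_r, Rmult_1_l by lra.
  eapply Rle_trans; [exact HB|].
  apply Rmult_le_compat_r; [exact HD|]. apply Rmult_le_compat_r; [apply pow_le; lra|].
  apply pow_incr. split; [apply pos_INR|apply le_INR; lia].
Qed.

(** * Differentiation of power series and the identity theorem *)

Definition disc (x : C) : Prop := (Cmod x < 1)%R.

Lemma disc_0 : disc 0.
Proof. unfold disc. rewrite Cmod_0. lra. Qed.

Lemma is_C_derive_lipschitz (f : C -> C) (x l : C) : is_C_derive f x l ->
  exists M d : R, (0 <= M)%R /\ (0 < d)%R /\
    forall y, (Cmod (y - x) < d)%R -> (Cmod (f y - f x) <= M * Cmod (y - x))%R.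
Proof.
intros H. rewrite is_C_derive_eps in H. destruct (H 1%R Rlt_0_1) as [d [Hd0 Hd]].
exists (1 + Cmod l)%R, d. split; [|split; [exact Hd0|]].
- assert (P := Cmod_ge_0 l). lra.
- intros y Hy. assert (H1 := Hd y Hy).
  assert (H3 := Cmod_triangle_rev (f y - f x) ((y - x) * l)). rewrite Cmod_mult in H3. lra.
Qed.

Lemma is_C_derive_quadratic (f : C -> C) (x : C) (K d : R) : (0 < d)%R -> f x = 0 ->
  (forall y, (Cmod (y - x) < d)%R -> (Cmod (f y) <= K * Cmod (y - x) ^ 2)%R) ->
  is_C_derive f x 0.
Proof.
intros Hd H0 H. apply is_C_derive_eps. intros eps He.
assert (HK : (0 < Rabs K + 1)%R) by (assert (P := Rabs_pos K); lra).
exists (Rmin d (eps / (Rabs K + 1))). split.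
{ apply Rmin_pos; [exact Hd|now apply Rdiv_lt_0_compat]. }
intros y Hy. rewrite H0. replace (f y - 0 - (y - x) * 0) with (f y) by ring.
assert (P := Cmod_ge_0 (y - x)).
assert (Hy1 := Rlt_le_trans _ _ _ Hy (Rmin_l _ _)).
assert (Hy2 := Rlt_le_trans _ _ _ Hy (Rmin_r _ _)).
eapply Rle_trans; [now apply H|].
replace (K * Cmod (y - x) ^ 2)%R with (K * Cmod (y - x) * Cmod (y - x))%R by ring.
apply Rmult_le_compat_r; [exact P|].
apply Rle_trans with ((Rabs K + 1) * (eps / (Rabs K + 1)))%R; [|right; field; lra].
apply Rle_trans with ((Rabs K + 1) * Cmod (y - x))%R.
- apply Rmult_le_compat_r; [exact P|]. assert (Q := Rle_abs K). lra.
- apply Rmult_le_compat_l; lra.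
Qed.

(** The inner functions depend on separate variables [z] and [w]. With [u = v = Cinv] this is joint
    holomorphy of the Laurent series, and with [w' = z'] it is the chain rule along a curve such as
    the diagonal. *)
Lemma dser_frechet (a : nat -> nat -> C) (u v : C -> C) (z w u' v' : C) : dgrowth a ->
  disc (u z) -> disc (v w) -> is_C_derive u z u' -> is_C_derive v w v' ->
  forall eps : R, (0 < eps)%R -> exists d : R, (0 < d)%R /\ forall z' w',
    (Cmod (z' - z) < d)%R -> (Cmod (w' - w) < d)%R ->
    (Cmod (dser a (u z') (v w') - dser a (u z) (v w)
        - ((z' - z) * (u' * dser (Dx a) (u z) (v w)) + (w' - w) * (v' * dser (Dy a) (u z) (v w))))
      <= eps * (Cmod (z' - z) + Cmod (w' - w)))%R.
Proof.
intros Ha Hu Hv Du Dv eps He.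
set (x := u z) in *. set (y := v w) in *.
set (A := dser (Dx a) x y). set (B := dser (Dy a) x y).
destruct (radius_between x y Hu Hv) as [r [Hr [H1 H2]]].
destruct (dser_taylor a r Ha Hr) as [K HK].
destruct (is_C_derive_lipschitz _ _ _ Du) as [M1 [d1 [P1 [Q1 L1]]]].
destruct (is_C_derive_lipschitz _ _ _ Dv) as [M2 [d2 [P2 [Q2 L2]]]].
rewrite is_C_derive_eps in Du, Dv.
assert (PA := Cmod_ge_0 A). assert (PB := Cmod_ge_0 B). assert (PK := Rabs_pos K).
set (e1 := (eps / (2 * (Cmod A + Cmod B + 1)))%R).
assert (He1 : (0 < e1)%R) by (apply Rdiv_lt_0_compat; lra).
assert (Ee1 : (e1 * (Cmod A + Cmod B + 1) = eps / 2)%R) by (unfold e1; field; lra).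
destruct (Du e1 He1) as [d3 [Q3 L3]]. destruct (Dv e1 He1) as [d4 [Q4 L4]].
assert (PKM : (0 < (Rabs K + 1) * (M1 + M2 + 1) ^ 2)%R).
{ apply Rmult_lt_0_compat; [lra|]. apply pow_lt. lra. }
set (e2 := (eps / (4 * ((Rabs K + 1) * (M1 + M2 + 1) ^ 2)))%R).
assert (He2 : (0 < e2)%R) by (apply Rdiv_lt_0_compat; lra).
assert (Ee2 : (e2 * ((Rabs K + 1) * (M1 + M2 + 1) ^ 2) = eps / 4)%R) by (unfold e2; field; lra).
set (d5 := ((r - Cmod x) / (M1 + 1))%R). set (d6 := ((r - Cmod y) / (M2 + 1))%R).
assert (Q5 : (0 < d5)%R) by (apply Rdiv_lt_0_compat; lra).
assert (Q6 : (0 < d6)%R) by (apply Rdiv_lt_0_compat; lra).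
assert (Ee5 : ((M1 + 1) * d5 = r - Cmod x)%R) by (unfold d5; field; lra).
assert (Ee6 : ((M2 + 1) * d6 = r - Cmod y)%R) by (unfold d6; field; lra).
exists (Rmin (Rmin (Rmin d1 d2) (Rmin d3 d4)) (Rmin (Rmin d5 d6) e2)). split.
{ repeat apply Rmin_pos; assumption. }
intros z' w' Hz' Hw'.
set (h := Cmod (z' - z)) in *. set (k := Cmod (w' - w)) in *.
assert (Ph : (0 <= h)%R) by apply Cmod_ge_0. assert (Pk : (0 <= k)%R) by apply Cmod_ge_0.
repeat match goal with
  | H : (_ < Rmin _ _)%R |- _ => apply Rmin_Rgt in H; destruct H
  | H : (Rmin _ _ > _)%R |- _ => apply Rmin_Rgt in H; destruct H
  end.
specialize (L1 z' ltac:(assumption)). specialize (L2 w' ltac:(assumption)).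
specialize (L3 z' ltac:(assumption)). specialize (L4 w' ltac:(assumption)).
fold x in L1, L3. fold y in L2, L4. fold h in L1, L3. fold k in L2, L4.
set (X := u z') in *. set (Y := v w') in *.
assert (X1 := Cmod_triangle_rev X x). assert (Y1 := Cmod_triangle_rev Y y).
assert (X2 : (M1 * h <= (M1 + 1) * d5)%R) by (apply Rmult_le_compat; lra).
assert (Y2 : (M2 * k <= (M2 + 1) * d6)%R) by (apply Rmult_le_compat; lra).
assert (HT := HK x y X Y ltac:(lra) ltac:(lra) ltac:(lra) ltac:(lra)). fold A B in HT.
replace (dser a X Y - dser a x y - ((z' - z) * (u' * A) + (w' - w) * (v' * B)))
  with ((dser a X Y - dser a x y - (X - x) * A - (Y - y) * B)
    + ((X - x - (z' - z) * u') * A + (Y - y - (w' - w) * v') * B)) by ring.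
eapply Rle_trans; [apply Cmod_triangle|].
assert (T1 : (Cmod ((X - x - (z' - z) * u') * A + (Y - y - (w' - w) * v') * B)
  <= e1 * h * Cmod A + e1 * k * Cmod B)%R).
{ eapply Rle_trans; [apply Cmod_triangle|]. rewrite !(Cmod_mult _ A), !(Cmod_mult _ B).
  apply Rplus_le_compat; apply Rmult_le_compat_r; assumption. }
assert (T2 : (e1 * h * Cmod A + e1 * k * Cmod B <= eps / 2 * (h + k))%R).
{ rewrite <- Ee1.
  assert (0 <= e1 * h)%R by (apply Rmult_le_pos; lra). assert (0 <= e1 * k)%R by (apply Rmult_le_pos; lra).
  assert (0 <= e1 * h * Cmod B)%R by (now apply Rmult_le_pos).
  assert (0 <= e1 * k * Cmod A)%R by (now apply Rmult_le_pos). lra. }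
assert (T3 : (K * (Cmod (X - x) + Cmod (Y - y)) ^ 2 <= eps / 2 * (h + k))%R).
{ apply Rle_trans with ((Rabs K + 1) * ((M1 + M2 + 1) * (h + k)) ^ 2)%R.
  - assert (D0 : (0 <= Cmod (X - x) + Cmod (Y - y))%R).
    { assert (U1 := Cmod_ge_0 (X - x)). assert (U2 := Cmod_ge_0 (Y - y)). lra. }
    apply Rle_trans with ((Rabs K + 1) * (Cmod (X - x) + Cmod (Y - y)) ^ 2)%R.
    + apply Rmult_le_compat_r; [now apply pow_le|]. assert (U := Rle_abs K). lra.
    + apply Rmult_le_compat_l; [lra|]. apply pow_incr. split; [exact D0|].
      assert (0 <= M1 * k)%R by now apply Rmult_le_pos.
      assert (0 <= M2 * h)%R by now apply Rmult_le_pos. lra.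
  - replace ((Rabs K + 1) * ((M1 + M2 + 1) * (h + k)) ^ 2)%R with
      (((Rabs K + 1) * (M1 + M2 + 1) ^ 2) * (h + k) * (h + k))%R by ring.
    apply Rmult_le_compat_r; [lra|].
    apply Rle_trans with (((Rabs K + 1) * (M1 + M2 + 1) ^ 2) * (2 * e2))%R; [|lra].
    apply Rmult_le_compat_l; lra. }
lra.
Qed.

Lemma dser_chain (a : nat -> nat -> C) (u v : C -> C) (z u' v' : C) : dgrowth a ->
  disc (u z) -> disc (v z) -> is_C_derive u z u' -> is_C_derive v z v' ->
  is_C_derive (fun t => dser a (u t) (v t)) z
    (u' * dser (Dx a) (u z) (v z) + v' * dser (Dy a) (u z) (v z)).
Proof.
intros Ha Hu Hv Du Dv. apply is_C_derive_eps. intros eps He.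
destruct (dser_frechet a u v z z u' v' Ha Hu Hv Du Dv (eps / 2)%R ltac:(lra)) as [d [Hd H]].
exists d; split; [exact Hd|]. intros y Hy. rewrite Cmult_plus_distr_l.
eapply Rle_trans; [now apply H|]. lra.
Qed.

Lemma dser_derive_x (a : nat -> nat -> C) (x y : C) : dgrowth a ->
  (Cmod x < 1)%R -> (Cmod y < 1)%R ->
  is_C_derive (fun x => dser a x y) x (dser (Dx a) x y).
Proof.
intros Ha Hx Hy. eapply is_C_derive_eq.
- apply (dser_chain a (fun x => x) (fun _ => y)); auto;
    [apply is_C_derive_id|apply is_C_derive_const].
- cbv beta. ring.
Qed.

Lemma dser_derive_y (a : nat -> nat -> C) (x y : C) : dgrowth a ->
  (Cmod x < 1)%R -> (Cmod y < 1)%R ->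
  is_C_derive (fun y => dser a x y) y (dser (Dy a) x y).
Proof.
intros Ha Hx Hy. eapply is_C_derive_eq.
- apply (dser_chain a (fun _ => x) (fun y => y)); auto;
    [apply is_C_derive_const|apply is_C_derive_id].
- cbv beta. ring.
Qed.

Lemma dser_continuous (a : nat -> nat -> C) (x y : C) : dgrowth a -> disc x -> disc y ->
  continuous (fun p : C2 => dser a (fst p) (snd p)) (x, y).
Proof.
intros Ha Hx Hy.
destruct (dser_frechet a (fun x => x) (fun y => y) x y 1 1 Ha Hx Hy (is_C_derive_id x)
  (is_C_derive_id y) 1%R Rlt_0_1) as [d [Hd H]].
set (A := dser (Dx a) x y) in *. set (B := dser (Dy a) x y) in *.
set (M := (Cmod A + Cmod B + 2)%R).
assert (PA := Cmod_ge_0 A). assert (PB := Cmod_ge_0 B).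
apply continuous_Cmod. intros eps He. apply locally_C2.
exists (Rmin d (eps / M)). split.
{ apply Rmin_pos; [exact Hd|]. apply Rdiv_lt_0_compat; unfold M; lra. }
intros X Y HX HY. simpl.
assert (K := H X Y (Rlt_le_trans _ _ _ HX (Rmin_l _ _)) (Rlt_le_trans _ _ _ HY (Rmin_l _ _))).
assert (HX' := Rlt_le_trans _ _ _ HX (Rmin_r _ _)). assert (HY' := Rlt_le_trans _ _ _ HY (Rmin_r _ _)).
replace (dser a X Y - dser a x y) with
  ((dser a X Y - dser a x y - ((X - x) * (1 * A) + (Y - y) * (1 * B))) + ((X - x) * A + (Y - y) * B)) by ring.
eapply Rle_lt_trans; [apply Cmod_triangle|].
assert (T : (Cmod ((X - x) * A + (Y - y) * B) <= Cmod (X - x) * Cmod A + Cmod (Y - y) * Cmod B)%R).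
{ eapply Rle_trans; [apply Cmod_triangle|]. rewrite !Cmod_mult. apply Rle_refl. }
assert (E : (M * (eps / M) = eps)%R) by (unfold M; field; lra).
assert (Cmod (X - x) * Cmod A <= eps / M * Cmod A)%R by (apply Rmult_le_compat_r; lra).
assert (Cmod (Y - y) * Cmod B <= eps / M * Cmod B)%R by (apply Rmult_le_compat_r; lra).
unfold M in E at 1. lra.
Qed.

Lemma dser_continuous_comp {T : UniformSpace} (a : nat -> nat -> C) (u v : T -> C) (p : T) :
  dgrowth a -> (Cmod (u p) < 1)%R -> (Cmod (v p) < 1)%R ->
  continuous u p -> continuous v p -> continuous (fun q => dser a (u q) (v q)) p.
Proof.
intros Ha Hu Hv Cu Cv.
apply (continuous_comp_2 (U := T) (V := C_UniformSpace) (W := C_UniformSpace) (X := C_UniformSpace) u v (dser a));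
  auto. now apply dser_continuous.
Qed.

Definition shx (a : nat -> nat -> C) (m n : nat) : C :=
  match m with 0%nat => 0 | S m => a m n end.

Lemma dgrowth_of_le (a b : nat -> nat -> C) : dgrowth a ->
  (forall m n, (Cmod (b m n) <= Cmod (a m n))%R) -> dgrowth b.
Proof.
intros H HB r Hr. destruct (H r Hr) as [A HA]. exists A. intros m n.
eapply Rle_trans; [|apply (HA m n)]. apply Rmult_le_compat_r; [apply pow_le; lra|apply HB].
Qed.

Lemma dgrowth_ext (a b : nat -> nat -> C) : dgrowth a -> (forall m n, a m n = b m n) -> dgrowth b.
Proof. intros H E. apply (dgrowth_of_le a); auto. intros m n. rewrite E. apply Rle_refl. Qed.

Lemma dgrowth_shx (a : nat -> nat -> C) : dgrowth a -> dgrowth (shx a).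
Proof.
intros H r Hr. destruct (H r Hr) as [A HA]. exists (Rmax 0 A). intros m n.
destruct m as [|m]; simpl.
- rewrite Cmod_0, Rmult_0_l. apply Rmax_l.
- eapply Rle_trans; [|apply Rmax_r]. eapply Rle_trans; [|apply (HA m n)].
  rewrite <- Rmult_assoc, (Rmult_comm _ r), Rmult_assoc.
  rewrite <- (Rmult_1_l (Cmod (a m n) * r ^ (m + n))) at 2.
  apply Rmult_le_compat_r; [|lra]. apply Rmult_le_pos; [apply Cmod_ge_0|apply pow_le; lra].
Qed.

Lemma hom_shx (a : nat -> nat -> C) (s : nat) (x y : C) :
  hom (shx a) (S s) x y = x * hom a s x y.
Proof.
unfold hom. rewrite csum_first. simpl (shx a 0 _). rewrite Cmult_0_l, Cplus_0_l, <- csum_scal.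
apply csum_ext. intros m Hm. simpl. ring.
Qed.

Lemma dser_shx (a : nat -> nat -> C) (x y : C) : dgrowth a -> (Cmod x < 1)%R -> (Cmod y < 1)%R ->
  dser (shx a) x y = x * dser a x y.
Proof.
intros Ha Hx Hy. apply dser_eq, is_Cseries_tail.
rewrite hom_0. simpl. replace (x * dser a x y - 0) with (x * dser a x y) by ring.
eapply is_Cseries_ext; [|apply is_Cseries_scal, is_dser; eauto].
intros s. cbv beta. now rewrite hom_shx.
Qed.

Lemma csum_last (u : nat -> C) (n : nat) : (forall k, (k < n)%nat -> u k = 0) -> csum u n = u n.
Proof.
intros H. destruct n as [|n]; [apply csum_0|].
rewrite csum_S, csum_zero; [ring|intros; apply H; lia].
Qed.

Lemma hom_y0 (a : nat -> nat -> C) (s : nat) (x : C) : hom a s x 0 = x ^ s * a s 0%nat.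
Proof.
unfold hom. rewrite csum_last.
- rewrite Nat.sub_diag. simpl. ring.
- intros k Hk. replace (s - k)%nat with (S (s - k - 1)) by lia. rewrite Cpow_0_S. ring.
Qed.

Lemma dser_y0 (a : nat -> nat -> C) (x : C) : dgrowth a -> (Cmod x < 1)%R ->
  is_Cseries (fun n => x ^ n * a n 0%nat) (dser a x 0).
Proof.
intros Ha Hx. eapply is_Cseries_ext; [|apply is_dser; auto].
- intros s. apply hom_y0.
- rewrite Cmod_0. lra.
Qed.

Lemma dser_00 (a : nat -> nat -> C) : dser a 0 0 = a 0%nat 0%nat.
Proof.
apply dser_eq. rewrite <- (hom_0 a 0 0) at 1.
apply (is_Cseries_single (fun s => hom a s 0 0)).
intros n. rewrite hom_y0, Cpow_0_S. ring.
Qed.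

(** A one-variable series viewed as a double series constant in [y], so that the results on [dser]
    cover both. *)
Definition emb (c : nat -> C) (m n : nat) : C := match n with 0%nat => c m | _ => 0 end.

Definition sgrowth (c : nat -> C) : Prop :=
  forall r : R, (0 < r < 1)%R -> exists A : R, forall n, (Cmod (c n) * r ^ n <= A)%R.

Lemma dgrowth_emb (c : nat -> C) : sgrowth c -> dgrowth (emb c).
Proof.
intros H r Hr. destruct (H r Hr) as [A HA]. exists (Rmax 0 A). intros m n. destruct n as [|n]; simpl.
- rewrite Nat.add_0_r. eapply Rle_trans; [apply HA|apply Rmax_r].
- rewrite Cmod_0, Rmult_0_l. apply Rmax_l.
Qed.

Lemma hom_emb (c : nat -> C) (s : nat) (x y : C) : hom (emb c) s x y = x ^ s * c s.
Proof.
unfold hom. rewrite csum_last.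
- rewrite Nat.sub_diag. simpl. ring.
- intros k Hk. replace (s - k)%nat with (S (s - k - 1)) by lia. simpl. ring.
Qed.

Lemma dser_emb (c : nat -> C) (x y l : C) :
  is_Cseries (fun n => x ^ n * c n) l -> dser (emb c) x y = l.
Proof.
intros H. apply dser_eq. eapply is_Cseries_ext; [|exact H]. intros; now rewrite hom_emb.
Qed.

Lemma sgrowth_of_series (c : nat -> C) (f : C -> C) :
  (forall x, (0 < Cmod x < 1)%R -> is_Cseries (fun n => x ^ n * c n) (f x)) -> sgrowth c.
Proof.
intros H r Hr.
assert (E : Cmod (RtoC r) = r) by (rewrite Cmod_R; apply Rabs_pos_eq; lra).
destruct (is_Cseries_terms_bounded _ _ (H (RtoC r) ltac:(rewrite E; lra))) as [A HA].
exists A. intros n. specialize (HA n). rewrite Cmod_mult, Cmod_pow, E in HA. lra.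
Qed.

Definition C1_disc (f f' : C -> C) : Prop :=
  forall u, (Cmod u < 1)%R -> is_C_derive f u (f' u) /\ continuous f' u.

Lemma disc_dser (f f' : C -> C) : C1_disc f f' ->
  exists c, sgrowth c /\
    (forall x, (Cmod x < 1)%R -> is_Cseries (fun n => x ^ n * c n) (f x)) /\
    (forall r M, (0 < r < 1)%R -> (forall t, (0 <= t <= 2 * PI)%R -> (Cmod (f (RtoC r * cis t)%C) <= M)%R) ->
     forall n, (Cmod (c n) * r ^ n <= 2 * M)%R).
Proof.
intros H.
destruct (disc_expansion f f' (fun u Hu => proj1 (H u Hu)) (fun u Hu => proj2 (H u Hu))) as [c [H1 H2]].
exists c. split; [|split; assumption].
apply (sgrowth_of_series c f). intros x Hx. apply H1, Hx.
Qed.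

Lemma iter_Dx_coef (a : nat -> nat -> C) (n m j : nat) :
  Nat.iter n Dx a m j = RtoC (INR (fact (m + n)) / INR (fact m)) * a (m + n)%nat j.
Proof.
revert m. induction n as [|n IH]; intros m.
- rewrite Nat.add_0_r. simpl. unfold Rdiv. rewrite Rinv_r by apply INR_fact_neq_0. ring.
- simpl Nat.iter. unfold Dx at 1. rewrite IH.
  replace (S m + n)%nat with (m + S n)%nat by lia.
  rewrite Cmult_assoc, <- RtoC_mult. f_equal. f_equal.
  rewrite fact_simpl, mult_INR. field. split; [apply INR_fact_neq_0|apply not_0_INR; lia].
Qed.

Lemma iter_Dx_00 (a : nat -> nat -> C) (n j : nat) :
  Nat.iter n Dx a 0%nat j = RtoC (INR (fact n)) * a n j.
Proof. rewrite iter_Dx_coef. simpl. do 2 f_equal. field. Qed.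

Lemma dgrowth_iter_Dx (a : nat -> nat -> C) (n : nat) : dgrowth a -> dgrowth (Nat.iter n Dx a).
Proof. intros H. induction n; simpl; auto using dgrowth_Dx. Qed.

Lemma dgrowth_iter_Dy (a : nat -> nat -> C) (n : nat) : dgrowth a -> dgrowth (Nat.iter n Dy a).
Proof. intros H. induction n; simpl; auto using dgrowth_Dy. Qed.

(** Higher derivatives are explicit data here, instead of iterates of [C_derive]. An iterated
    derivative is then computed by exhibiting a second tower over the same function. *)
Definition tower (D : C -> Prop) (f : nat -> C -> C) : Prop :=
  forall n z, D z -> is_C_derive (f n) z (f (S n) z).

Lemma disc_nbhd (x : C) : disc x -> exists d : R, (0 < d)%R /\ forall y, (Cmod (y - x) < d)%R -> disc y.
Proof.
intros H. exists (1 - Cmod x)%R. unfold disc in *. split; [lra|].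
intros y Hy. assert (H1 := Cmod_triangle_rev y x). lra.
Qed.

Lemma tower_unique (D : C -> Prop) (f g : nat -> C -> C) :
  (forall z, D z -> exists d : R, (0 < d)%R /\ forall y, (Cmod (y - z) < d)%R -> D y) ->
  tower D f -> tower D g -> (forall z, D z -> f 0%nat z = g 0%nat z) ->
  forall n z, D z -> f n z = g n z.
Proof.
intros HD Hf Hg H0 n. induction n as [|n IH]; [exact H0|].
intros z Hz. apply (is_C_derive_uniq (f n) z); [now apply Hf|].
destruct (HD z Hz) as [d [Hd HDd]].
apply (is_C_derive_ext_loc (g n) (f n) z _ d Hd); [|now apply Hg].
intros y Hy. symmetry. apply IH. auto.
Qed.

Lemma tower_dser_x (a : nat -> nat -> C) (y : C) : dgrowth a -> disc y ->
  tower disc (fun n x => dser (Nat.iter n Dx a) x y).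
Proof. intros Ha Hy n x Hx. apply dser_derive_x; auto. now apply dgrowth_iter_Dx. Qed.

Lemma tower_dser_y (a : nat -> nat -> C) (x : C) : dgrowth a -> disc x ->
  tower disc (fun n y => dser (Nat.iter n Dy a) x y).
Proof. intros Ha Hx n y Hy. apply dser_derive_y; auto. now apply dgrowth_iter_Dy. Qed.

(** The Cauchy estimate is part of the conclusion because [smooth_dser] needs it for this same
    sequence [c], with constants independent of a parameter. *)
Lemma tower_taylor (f : nat -> C -> C) : tower disc f ->
  exists c, sgrowth c /\ (forall x, disc x -> is_Cseries (fun n => x ^ n * c n) (f 0%nat x)) /\
    (forall r M, (0 < r < 1)%R -> (forall t, (0 <= t <= 2 * PI)%R -> (Cmod (f 0%nat (RtoC r * cis t)%C) <= M)%R) ->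
     forall n, (Cmod (c n) * r ^ n <= 2 * M)%R) /\
    forall n, f n 0 = RtoC (INR (fact n)) * c n.
Proof.
intros Hf. destruct (disc_dser (f 0%nat) (f 1%nat)) as [c [H1 [H2 H3]]].
{ intros u Hu. split; [now apply Hf|]. eapply is_C_derive_continuous. now apply Hf. }
exists c. split; [exact H1|split; [exact H2|split; [exact H3|]]].
intros n.
assert (E := tower_unique disc f _ disc_nbhd Hf (tower_dser_x (emb c) 0 (dgrowth_emb c H1) disc_0)).
rewrite E; [|intros z Hz; simpl; symmetry; apply dser_emb; auto|apply disc_0].
rewrite dser_00, iter_Dx_00. reflexivity.
Qed.

Lemma RtoC_fact_neq_0 (n : nat) : RtoC (INR (fact n)) <> 0.
Proof. intros E. apply RtoC_inj in E. now apply INR_fact_neq_0 in E. Qed.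

Lemma Cmult_cancel_l (k x y : C) : k <> 0 -> k * x = k * y -> x = y.
Proof.
intros Hk E. replace x with (/ k * (k * x)) by (field; exact Hk). rewrite E. field. exact Hk.
Qed.

Lemma tower_ext_0 (f g : nat -> C -> C) : tower disc f -> tower disc g ->
  (forall n, f n 0 = g n 0) -> forall x, disc x -> f 0%nat x = g 0%nat x.
Proof.
intros Hf Hg E x Hx.
destruct (tower_taylor f Hf) as [c [_ [H2 [_ H3]]]]. destruct (tower_taylor g Hg) as [c' [_ [H2' [_ H3']]]].
apply (is_Cseries_unique (fun n => x ^ n * c n)); [now apply H2|].
eapply is_Cseries_ext; [|apply H2', Hx]. intros n. cbv beta. f_equal.
apply (Cmult_cancel_l (RtoC (INR (fact n)))); [apply RtoC_fact_neq_0|].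
now rewrite <- H3, <- H3', E.
Qed.

(** The coefficient at (m, n) is, up to factorials, the value at the origin after [m] derivatives in
    [x] and [n] in [y]. *)
Lemma dser_inj (a b : nat -> nat -> C) : dgrowth a -> dgrowth b ->
  (forall x y, disc x -> disc y -> dser a x y = dser b x y) -> forall m n, a m n = b m n.
Proof.
intros Ha Hb E m n.
assert (E1 : forall x y, disc x -> disc y -> dser (Nat.iter m Dx a) x y = dser (Nat.iter m Dx b) x y).
{ intros x y Hx Hy.
  apply (tower_unique disc _ _ disc_nbhd (tower_dser_x a y Ha Hy) (tower_dser_x b y Hb Hy)); auto. }
assert (E2 : dser (Nat.iter n Dy (Nat.iter m Dx a)) 0 0 = dser (Nat.iter n Dy (Nat.iter m Dx b)) 0 0).
{ apply (tower_unique disc _ _ disc_nbhd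
    (tower_dser_y _ 0 (dgrowth_iter_Dx a m Ha) disc_0) (tower_dser_y _ 0 (dgrowth_iter_Dx b m Hb) disc_0)).
  - intros z Hz. apply E1; auto using disc_0.
  - apply disc_0. }
rewrite !dser_00 in E2.
assert (T : forall a n j, Nat.iter n Dy a j 0%nat = Nat.iter n Dx (fun m n => a n m) 0%nat j).
{ clear. intros a n. assert (G : forall i j, Nat.iter n Dy a j i = Nat.iter n Dx (fun m n => a n m) i j).
  { induction n as [|n IH]; intros i j; simpl; auto. unfold Dx at 1, Dy at 1. now rewrite IH. }
  intros j. apply G. }
rewrite !T, !iter_Dx_00 in E2. cbv beta in E2. rewrite ?iter_Dx_00 in E2.
apply Cmult_cancel_l in E2; [|apply RtoC_fact_neq_0].
now apply Cmult_cancel_l in E2; [|apply RtoC_fact_neq_0].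
Qed.

(** Recentred at [p] and rescaled, the largest disc about [p] becomes the unit disc, where all power
    series coefficients vanish. *)
Lemma C1_disc_zero_ball (f f' : C -> C) (p : C) (d : R) : C1_disc f f' -> disc p -> (0 < d)%R ->
  (forall x, (Cmod (x - p) < d)%R -> f x = 0) ->
  forall x, (Cmod (x - p) < 1 - Cmod p)%R -> f x = 0.
Proof.
intros Hf Hp Hd H0 x Hx. unfold disc in Hp. set (rho := (1 - Cmod p)%R) in *.
assert (Hr : (0 < rho)%R) by (unfold rho; lra).
assert (Er : Cmod (RtoC rho) = rho) by (rewrite Cmod_R; apply Rabs_pos_eq; lra).
assert (Nr : RtoC rho <> 0) by (apply Cmod_gt_0; lra).
assert (Hin : forall u, (Cmod u < 1)%R -> (Cmod (p + RtoC rho * u) < 1)%R).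
{ intros u Hu. eapply Rle_lt_trans; [apply Cmod_triangle|]. rewrite Cmod_mult, Er.
  assert (rho * Cmod u < rho * 1)%R by (apply Rmult_lt_compat_l; lra). unfold rho in *. lra. }
destruct (disc_dser (fun u => f (p + RtoC rho * u)) (fun u => RtoC rho * f' (p + RtoC rho * u))) as [c [_ [H2 _]]].
{ intros u Hu. destruct (Hf _ (Hin u Hu)) as [K1 K2]. split.
  - apply (is_C_derive_comp f (fun u => p + RtoC rho * u)); [exact K1|].
    eapply is_C_derive_eq.
    + apply is_C_derive_plus; [apply is_C_derive_const|apply is_C_derive_scal, is_C_derive_id].
    + ring.
  - apply continuous_Cmult; [apply continuous_const|].
    apply (continuous_comp (fun u => p + RtoC rho * u) f'); [|exact K2].
    apply continuous_Cplus; [apply continuous_const|].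
    apply continuous_Cmult; [apply continuous_const|apply continuous_id]. }
assert (Hc : forall n, c n = 0).
{ apply (pow_series_zero c (Rmin 1 (d / rho))).
  { apply Rmin_pos; [lra|now apply Rdiv_lt_0_compat]. }
  intros w [Hw0 Hw].
  assert (W1 := Rlt_le_trans _ _ _ Hw (Rmin_l _ _)). assert (W2 := Rlt_le_trans _ _ _ Hw (Rmin_r _ _)).
  rewrite <- (H0 (p + RtoC rho * w)); [now apply H2|].
  replace (p + RtoC rho * w - p) with (RtoC rho * w) by ring. rewrite Cmod_mult, Er.
  apply Rlt_le_trans with (rho * (d / rho))%R; [now apply Rmult_lt_compat_l|right; field; lra]. }
set (u := (x - p) / RtoC rho).
assert (Hu : (Cmod u < 1)%R).
{ unfold u. rewrite Cmod_div, Er by exact Nr. apply Rmult_lt_reg_r with rho; [exact Hr|].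
  unfold Rdiv. rewrite Rmult_assoc, Rinv_l; lra. }
replace x with (p + RtoC rho * u) by (unfold u; field; exact Nr).
apply (is_Cseries_unique (fun n => u ^ n * c n)); [now apply H2|].
apply is_Cseries_zero. intros n. rewrite Hc. ring.
Qed.

Lemma C1_disc_identity (f f' : C -> C) (p : C) (d : R) : C1_disc f f' -> disc p -> (0 < d)%R ->
  (forall x, (Cmod (x - p) < d)%R -> f x = 0) -> forall x, disc x -> f x = 0.
Proof.
intros Hf Hp Hd H0. unfold disc in Hp. set (e := ((1 - Cmod p) / 2)%R).
assert (He : (0 < e)%R) by (unfold e; lra).
assert (Z : exists d, (0 < d)%R /\ forall x, (Cmod (x - 0) < d)%R -> f x = 0).
(* The centre moves radially from [p] to 0 in steps of length [e]. Every centre [q] satisfies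
   [|q| <= |p|], so its zero disc has radius at least [2 e] and contains a disc about the next
   centre. From the centre 0 that disc is the whole unit disc. *)
{ assert (W : forall n q, (Cmod q <= Cmod p)%R -> (Cmod q <= INR n * e)%R ->
    (exists d, (0 < d)%R /\ forall x, (Cmod (x - q) < d)%R -> f x = 0) ->
    exists d, (0 < d)%R /\ forall x, (Cmod (x - 0) < d)%R -> f x = 0).
  { induction n as [|n IH]; intros q Hq1 Hq2 [d' [Hd' Hz]].
    - simpl in Hq2. rewrite Rmult_0_l in Hq2.
      assert (q = 0). { apply Cmod_eq_0. assert (P := Cmod_ge_0 q). lra. }
      subst q. now exists d'.
    - assert (Hb := C1_disc_zero_ball f f' q d' Hf ltac:(unfold disc; lra) Hd' Hz).
      destruct (Rle_lt_dec (Cmod q) e) as [Hle|Hlt].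
      + exists (1 - Cmod q - Cmod q)%R. split; [unfold e in *; lra|].
        intros x Hx. apply Hb. replace (x - q) with ((x - 0) - q) by ring.
        eapply Rle_lt_trans; [apply Cmod_minus_le|]. lra.
      + set (k := (1 - e / Cmod q)%R).
        assert (Ek : (0 <= e / Cmod q <= 1)%R).
        { split; [apply Rlt_le, Rdiv_lt_0_compat; lra|].
          apply Rmult_le_reg_r with (Cmod q); [lra|]. unfold Rdiv. rewrite Rmult_assoc, Rinv_l; lra. }
        assert (Mq : Cmod (RtoC k * q) = (Cmod q - e)%R).
        { rewrite Cmod_mult, Cmod_R, Rabs_pos_eq by (unfold k; lra). unfold k. field. lra. }
        assert (Dq : Cmod (RtoC k * q - q) = e).
        { replace (RtoC k * q - q) with (RtoC (- (e / Cmod q)) * q) by (unfold k; rewrite RtoC_minus, RtoC_opp; ring).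
          rewrite Cmod_mult, Cmod_R, Rabs_Ropp, Rabs_pos_eq by lra. field. lra. }
        apply (IH (RtoC k * q)).
        * rewrite Mq. lra.
        * rewrite Mq. rewrite S_INR in Hq2. lra.
        * exists (1 - Cmod q - e)%R. split; [unfold e in *; lra|].
          intros x Hx. apply Hb. replace (x - q) with ((x - RtoC k * q) + (RtoC k * q - q)) by ring.
          eapply Rle_lt_trans; [apply Cmod_triangle|]. rewrite Dq. lra. }
  destruct (INR_unbounded (Cmod p / e)) as [n Hn].
  apply (W n p); [lra| |now exists d].
  apply Rlt_le. apply Rmult_lt_reg_r with (/ e)%R; [now apply Rinv_0_lt_compat|].
  rewrite Rmult_assoc, Rinv_r by lra. unfold Rdiv in Hn. lra. }
destruct Z as [d0 [Hd0 Hz]]. intros x Hx.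
apply (C1_disc_zero_ball f f' 0 d0 Hf disc_0 Hd0 Hz).
unfold disc in Hx. rewrite Cmod_0. replace (x - 0) with x by ring. lra.
Qed.

(** * Smooth functions on the bidisc *)

Definition bicontinuous (F : C -> C -> C) : Prop :=
  forall x y, disc x -> disc y -> continuous (fun p : C2 => F (fst p) (snd p)) (x, y).

Definition partials (F Fx Fy : C -> C -> C) : Prop :=
  forall x y, disc x -> disc y ->
    is_C_derive (fun x => F x y) x (Fx x y) /\ is_C_derive (F x) y (Fy x y).

(** The partial derivatives are existential, so closure under sums, products and inverses is an
    induction that exhibits formulas for them. Once smoothness is known, [Px] and [Py] name them. *)
Fixpoint diffn (n : nat) (F : C -> C -> C) : Prop :=
  bicontinuous F /\
  match n with
  | 0%nat => True
  | S n => exists Fx Fy, partials F Fx Fy /\ diffn n Fx /\ diffn n Fy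
  end.

Definition smooth (F : C -> C -> C) : Prop := forall n, diffn n F.

Lemma diffn_bicontinuous (n : nat) (F : C -> C -> C) : diffn n F -> bicontinuous F.
Proof. destruct n; intros H; apply H. Qed.

Lemma diffn_le (n : nat) (F : C -> C -> C) : diffn (S n) F -> diffn n F.
Proof.
revert F. induction n as [|n IH]; intros F [H1 [Fx [Fy [H2 [H3 H4]]]]]; (split; [exact H1|]); [exact I|].
exists Fx, Fy. auto.
Qed.

Lemma bicontinuous_ext (F G : C -> C -> C) :
  (forall x y, disc x -> disc y -> F x y = G x y) -> bicontinuous F -> bicontinuous G.
Proof.
intros E H x y Hx Hy.
destruct (disc_nbhd x Hx) as [d [Hd Dd]]. destruct (disc_nbhd y Hy) as [d' [Hd' Dd']].
apply (continuous_ext_loc (T := C2) (U := C_UniformSpace) (fun p => G (fst p) (snd p)) (fun p => F (fst p) (snd p)) (x, y)).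
- apply locally_C2. exists (Rmin d d'); split; [now apply Rmin_pos|].
  intros x' y' Hx' Hy'. simpl. apply E.
  + apply Dd. eapply Rlt_le_trans; [exact Hx'|apply Rmin_l].
  + apply Dd'. eapply Rlt_le_trans; [exact Hy'|apply Rmin_r].
- now apply H.
Qed.

Lemma partials_ext (F G Fx Fy : C -> C -> C) :
  (forall x y, disc x -> disc y -> F x y = G x y) -> partials F Fx Fy -> partials G Fx Fy.
Proof.
intros E H x y Hx Hy. destruct (H x y Hx Hy) as [H1 H2].
destruct (disc_nbhd x Hx) as [d [Hd Dd]]. destruct (disc_nbhd y Hy) as [d' [Hd' Dd']].
split.
- apply (is_C_derive_ext_loc (fun x => F x y) _ _ _ d Hd); [|exact H1]. intros; apply E; auto.
- apply (is_C_derive_ext_loc (F x) _ _ _ d' Hd'); [|exact H2]. intros; apply E; auto.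
Qed.

Lemma diffn_ext (n : nat) (F G : C -> C -> C) :
  (forall x y, disc x -> disc y -> F x y = G x y) -> diffn n F -> diffn n G.
Proof.
destruct n as [|n]; intros E [H1 H2]; (split; [now apply (bicontinuous_ext F)|]); [exact I|].
destruct H2 as [Fx [Fy [H2 H3]]]. exists Fx, Fy. split; [now apply (partials_ext F)|exact H3].
Qed.

Lemma diffn_plus (n : nat) (F G : C -> C -> C) :
  diffn n F -> diffn n G -> diffn n (fun x y => F x y + G x y).
Proof.
revert F G. induction n as [|n IH]; intros F G [F1 F2] [G1 G2];
  (split; [intros x y Hx Hy; apply continuous_Cplus; auto|]); [exact I|].
destruct F2 as [Fx [Fy [F2 [F3 F4]]]]. destruct G2 as [Gx [Gy [G2 [G3 G4]]]].
exists (fun x y => Fx x y + Gx x y), (fun x y => Fy x y + Gy x y).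
split; [|split; apply IH; assumption].
intros x y Hx Hy. destruct (F2 x y Hx Hy) as [Fa Fb]. destruct (G2 x y Hx Hy) as [Ga Gb].
split; now apply is_C_derive_plus.
Qed.

Lemma diffn_opp (n : nat) (F : C -> C -> C) : diffn n F -> diffn n (fun x y => - F x y).
Proof.
revert F. induction n as [|n IH]; intros F [F1 F2];
  (split; [intros x y Hx Hy; apply continuous_Copp; auto|]); [exact I|].
destruct F2 as [Fx [Fy [F2 [F3 F4]]]].
exists (fun x y => - Fx x y), (fun x y => - Fy x y).
split; [|split; apply IH; assumption].
intros x y Hx Hy. destruct (F2 x y Hx Hy) as [Fa Fb].
split; now apply is_C_derive_opp.
Qed.

Lemma diffn_minus (n : nat) (F G : C -> C -> C) :
  diffn n F -> diffn n G -> diffn n (fun x y => F x y - G x y).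
Proof. intros HF HG. apply (diffn_plus n F (fun x y => - G x y)); auto using diffn_opp. Qed.

Lemma diffn_mult (n : nat) (F G : C -> C -> C) :
  diffn n F -> diffn n G -> diffn n (fun x y => F x y * G x y).
Proof.
revert F G. induction n as [|n IH]; intros F G HF HG; assert (HF' := HF); assert (HG' := HG);
  destruct HF as [F1 F2]; destruct HG as [G1 G2];
  (split; [intros x y Hx Hy; apply continuous_Cmult; auto|]); [exact I|].
apply diffn_le in HF', HG'.
destruct F2 as [Fx [Fy [F2 [F3 F4]]]]. destruct G2 as [Gx [Gy [G2 [G3 G4]]]].
exists (fun x y => Fx x y * G x y + F x y * Gx x y), (fun x y => Fy x y * G x y + F x y * Gy x y).
split; [|split; apply diffn_plus; apply IH; assumption].
intros x y Hx Hy. destruct (F2 x y Hx Hy) as [Fa Fb]. destruct (G2 x y Hx Hy) as [Ga Gb].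
split.
- now apply (is_C_derive_mult (fun x => F x y) (fun x => G x y)).
- now apply (is_C_derive_mult (F x) (G x)).
Qed.

Lemma diffn_inv (n : nat) (F : C -> C -> C) : (forall x y, disc x -> disc y -> F x y <> 0) ->
  diffn n F -> diffn n (fun x y => / F x y).
Proof.
intros H0. induction n as [|n IH]; intros HF; assert (HF' := HF); destruct HF as [F1 F2];
  (split; [intros x y Hx Hy; apply continuous_Cinv; [now apply F1|now apply H0]|]); [exact I|].
apply diffn_le, IH in HF'.
destruct F2 as [Fx [Fy [F2 [F3 F4]]]].
exists (fun x y => - (Fx x y * (/ F x y * / F x y))), (fun x y => - (Fy x y * (/ F x y * / F x y))).
split; [|split; apply diffn_opp, diffn_mult; auto using diffn_mult].
intros x y Hx Hy. destruct (F2 x y Hx Hy) as [Fa Fb].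
split.
- apply (is_C_derive_inv (fun x => F x y)); auto.
- apply (is_C_derive_inv (F x)); auto.
Qed.

Lemma diffn_const (n : nat) (c : C) : diffn n (fun _ _ => c).
Proof.
revert c. induction n as [|n IH]; intros c; (split; [intros x y _ _; apply continuous_const|]); [exact I|].
exists (fun _ _ => 0), (fun _ _ => 0). split; auto.
intros x y _ _. split; apply is_C_derive_const.
Qed.

Lemma diffn_fst (n : nat) : diffn n (fun x _ => x).
Proof.
destruct n as [|n]; (split; [intros x y _ _; apply (continuous_fst (U := C_UniformSpace) (V := C_UniformSpace))|]); [exact I|].
exists (fun _ _ => 1), (fun _ _ => 0). split; auto using diffn_const.
intros x y _ _. split; [apply is_C_derive_id|apply is_C_derive_const].
Qed.

Lemma diffn_snd (n : nat) : diffn n (fun _ y => y).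
Proof.
destruct n as [|n]; (split; [intros x y _ _; apply (continuous_snd (U := C_UniformSpace) (V := C_UniformSpace))|]); [exact I|].
exists (fun _ _ => 0), (fun _ _ => 1). split; auto using diffn_const.
intros x y _ _. split; [apply is_C_derive_const|apply is_C_derive_id].
Qed.

Lemma diffn_dser (n : nat) (a : nat -> nat -> C) : dgrowth a -> diffn n (dser a).
Proof.
revert a. induction n as [|n IH]; intros a Ha;
  (split; [intros x y Hx Hy; now apply dser_continuous|]); [exact I|].
exists (dser (Dx a)), (dser (Dy a)). split; [|split; apply IH; auto using dgrowth_Dx, dgrowth_Dy].
intros x y Hx Hy. split; [now apply dser_derive_x|now apply dser_derive_y].
Qed.

Definition Px (F : C -> C -> C) (x y : C) : C := C_derive (fun x => F x y) x.
Definition Py (F : C -> C -> C) (x y : C) : C := C_derive (F x) y.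

Lemma smooth_partials (F : C -> C -> C) : smooth F -> partials F (Px F) (Py F).
Proof.
intros H x y Hx Hy. destruct (H 1%nat) as [_ [Fx [Fy [H2 _]]]].
destruct (H2 x y Hx Hy) as [Fa Fb]. unfold Px, Py.
rewrite (is_C_derive_unique _ _ _ Fa), (is_C_derive_unique _ _ _ Fb). now split.
Qed.

Lemma smooth_Px (F : C -> C -> C) : smooth F -> smooth (Px F).
Proof.
intros H n. destruct (H (S n)) as [_ [Fx [Fy [H2 [H3 H4]]]]].
apply (diffn_ext n Fx); [|exact H3]. intros x y Hx Hy. symmetry.
apply is_C_derive_unique, (H2 x y Hx Hy).
Qed.

Lemma smooth_Py (F : C -> C -> C) : smooth F -> smooth (Py F).
Proof.
intros H n. destruct (H (S n)) as [_ [Fx [Fy [H2 [H3 H4]]]]].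
apply (diffn_ext n Fy); [|exact H4]. intros x y Hx Hy. symmetry.
apply is_C_derive_unique, (H2 x y Hx Hy).
Qed.

Lemma smooth_iter_Px (F : C -> C -> C) (n : nat) : smooth F -> smooth (Nat.iter n Px F).
Proof. intros H. induction n; simpl; auto using smooth_Px. Qed.

Lemma smooth_iter_Py (F : C -> C -> C) (n : nat) : smooth F -> smooth (Nat.iter n Py F).
Proof. intros H. induction n; simpl; auto using smooth_Py. Qed.

Lemma smooth_tower_x (F : C -> C -> C) (y : C) : smooth F -> disc y ->
  tower disc (fun n x => Nat.iter n Px F x y).
Proof. intros H Hy n x Hx. apply (smooth_partials _ (smooth_iter_Px F n H) x y Hx Hy). Qed.

Lemma smooth_tower_y (F : C -> C -> C) (x : C) : smooth F -> disc x ->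
  tower disc (fun n y => Nat.iter n Py F x y).
Proof. intros H Hx n y Hy. apply (smooth_partials _ (smooth_iter_Py F n H) x y Hx Hy). Qed.

(** By uniform continuity [f] changes by less than 1 under a move of at most [d / 2] in each
    coordinate; a bounded number of such moves leads from the corner (0, 0) to any point. *)
Lemma bounded_rectangle (f : R -> R -> R) (b : R) : (0 <= b)%R ->
  (forall x y, (0 <= x <= b)%R -> (0 <= y <= b)%R -> continuity_2d_pt f x y) ->
  exists M, forall x y, (0 <= x <= b)%R -> (0 <= y <= b)%R -> (f x y <= M)%R.
Proof.
intros Hb Hf.
destruct (uniform_continuity_2d f 0 b 0 b Hf (mkposreal 1 Rlt_0_1)) as [d Hd]. simpl in Hd.
assert (Pd := cond_pos d).
assert (W : forall n x y, (0 <= x <= b)%R -> (0 <= y <= b)%R ->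
  (x <= INR n * (d / 2))%R -> (y <= INR n * (d / 2))%R -> (f x y <= f 0%R 0%R + INR n)%R).
{ induction n as [|n IH]; intros x y Hx Hy Hx' Hy'.
  - simpl in *. replace x with 0%R by lra. replace y with 0%R by lra. lra.
  - rewrite S_INR in *. set (x' := Rmax 0 (x - d / 2)). set (y' := Rmax 0 (y - d / 2)).
    assert (X : (0 <= x' <= x /\ x - d / 2 <= x' /\ x' <= INR n * (d / 2))%R).
    { unfold x'. assert (PN := pos_INR n). assert (0 <= INR n * (d / 2))%R by (apply Rmult_le_pos; lra).
      unfold Rmax. destruct (Rle_dec 0 (x - d / 2)); lra. }
    assert (Y : (0 <= y' <= y /\ y - d / 2 <= y' /\ y' <= INR n * (d / 2))%R).
    { unfold y'. assert (PN := pos_INR n). assert (0 <= INR n * (d / 2))%R by (apply Rmult_le_pos; lra).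
      unfold Rmax. destruct (Rle_dec 0 (y - d / 2)); lra. }
    assert (H1 := IH x' y' ltac:(lra) ltac:(lra) ltac:(lra) ltac:(lra)).
    assert (H2 := Hd x' y' x y ltac:(lra) ltac:(lra) ltac:(lra) ltac:(lra)
      ltac:(apply Rabs_lt_between; lra) ltac:(apply Rabs_lt_between; lra)).
    apply Rabs_lt_between in H2. lra. }
destruct (INR_unbounded (b / (d / 2))) as [n Hn].
assert (B : (b <= INR n * (d / 2))%R).
{ apply Rlt_le, Rmult_lt_reg_r with (/ (d / 2))%R; [apply Rinv_0_lt_compat; lra|].
  rewrite Rmult_assoc, Rinv_r by lra. unfold Rdiv at 1 in Hn. lra. }
exists (f 0%R 0%R + INR n)%R. intros x y Hx Hy. apply W; lra.
Qed.

Lemma torus_bound (g : C -> C -> C) (r : R) : bicontinuous g -> (0 < r < 1)%R ->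
  exists M, forall s t, (0 <= s <= 2 * PI)%R -> (0 <= t <= 2 * PI)%R ->
    (Cmod (g (RtoC r * cis s)%C (RtoC r * cis t)%C) <= M)%R.
Proof.
intros Hg Hr.
apply (bounded_rectangle (fun s t => Cmod (g (RtoC r * cis s)%C (RtoC r * cis t)%C))).
- assert (P := two_PI_pos). lra.
- intros s t _ _. apply continuity_2d_pt_filterlim.
  assert (D : forall t, disc (RtoC r * cis t)).
  { intros u. unfold disc. rewrite Cmod_mult, Cmod_cis, Cmod_R, Rabs_pos_eq; lra. }
  assert (K : continuous (T := prod_UniformSpace R_UniformSpace R_UniformSpace) (U := C_UniformSpace)
    (fun p => g (RtoC r * cis (fst p)) (RtoC r * cis (snd p))) (s, t)).
  { apply (continuous_comp_2 (U := prod_UniformSpace R_UniformSpace R_UniformSpace)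
      (V := C_UniformSpace) (W := C_UniformSpace) (X := C_UniformSpace)
      (fun p => RtoC r * cis (fst p)) (fun p => RtoC r * cis (snd p)) g (s, t)).
    - apply continuous_Cmult; [apply continuous_const|].
      apply continuous_cis, (continuous_fst (U := R_UniformSpace) (V := R_UniformSpace)).
    - apply continuous_Cmult; [apply continuous_const|].
      apply continuous_cis, (continuous_snd (U := R_UniformSpace) (V := R_UniformSpace)).
    - exact (Hg _ _ (D s) (D t)). }
  exact (filterlim_comp _ _ _ _ Cmod _ _ _ K
    (filterlim_norm (K := C_AbsRing) (V := C_NormedModule) _)).
Qed.

Lemma dser_x0 (a : nat -> nat -> C) (y : C) : dgrowth a -> (Cmod y < 1)%R ->
  is_Cseries (fun n => y ^ n * a 0%nat n) (dser a 0 y).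
Proof.
intros Ha Hy. rewrite dser_transpose.
exact (dser_y0 (fun m n => a n m) y (dgrowth_transpose a Ha) Hy).
Qed.

(** Cauchy's estimate in [x] and then in [y] bounds the Taylor coefficients at the origin by the
    maximum of [|g|] on a torus, which is the growth condition. Equality follows by comparing, at
    [x = 0], all [x]-derivatives, each expanded in [y]. *)
Theorem smooth_dser (g : C -> C -> C) : smooth g ->
  exists e, dgrowth e /\ forall x y, disc x -> disc y -> g x y = dser e x y.
Proof.
intros Hg.
set (e := fun m n => Nat.iter n Py (Nat.iter m Px g) 0 0 / (RtoC (INR (fact m)) * RtoC (INR (fact n)))).
assert (Hgm := fun m => smooth_iter_Px g m Hg).
assert (He : dgrowth e).
{ intros r Hr. destruct (torus_bound g r (diffn_bicontinuous 0 g (Hg 0%nat)) Hr) as [M HM].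
  exists (2 * (2 * M))%R. intros m n.
  destruct (tower_taylor _ (smooth_tower_y (Nat.iter m Px g) 0 (Hgm m) disc_0)) as [c [_ [_ [HB Hc]]]].
  assert (Pm := INR_fact_lt_0 m). assert (Pr : (0 < r ^ m)%R) by (apply pow_lt; lra).
  (* The estimate in [x] at [x = 0], uniform in [y] on the circle of radius [r]; it is the input of
     the estimate in [y]. *)
  assert (B1 : forall t, (0 <= t <= 2 * PI)%R ->
    (Cmod (Nat.iter m Px g 0%C (RtoC r * cis t)%C) <= INR (fact m) * (2 * M) / r ^ m)%R).
  { intros t Ht.
    assert (Dt : disc (RtoC r * cis t)).
    { unfold disc. rewrite Cmod_mult, Cmod_cis, Cmod_R, Rabs_pos_eq; lra. }
    destruct (tower_taylor _ (smooth_tower_x g _ Hg Dt)) as [c' [_ [_ [HB' Hc']]]].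
    rewrite Hc', Cmod_mult, Cmod_INR.
    assert (B := HB' r M Hr (fun s Hs => HM s t Hs Ht) m).
    unfold Rdiv. rewrite Rmult_assoc. apply Rmult_le_compat_l; [lra|].
    apply Rmult_le_reg_r with (r ^ m)%R; [exact Pr|]. rewrite Rmult_assoc, Rinv_l; lra. }
  specialize (HB r _ Hr B1 n). unfold e. rewrite Hc.
  replace (RtoC (INR (fact n)) * c n / (RtoC (INR (fact m)) * RtoC (INR (fact n))))
    with (c n / RtoC (INR (fact m))) by (field; split; apply RtoC_fact_neq_0).
  rewrite Cmod_div, Cmod_INR by apply RtoC_fact_neq_0.
  rewrite pow_add.
  apply Rmult_le_reg_r with (INR (fact m) / r ^ m)%R; [now apply Rdiv_lt_0_compat|].
  replace (Cmod (c n) / INR (fact m) * (r ^ m * r ^ n) * (INR (fact m) / r ^ m))%R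
    with (Cmod (c n) * r ^ n)%R by (field; split; lra).
  eapply Rle_trans; [exact HB|]. right. field. lra. }
exists e. split; [exact He|]. intros x y Hx Hy.
apply (tower_ext_0 _ _ (smooth_tower_x g y Hg Hy) (tower_dser_x e y He Hy)); [|exact Hx].
intros m. symmetry.
destruct (tower_taylor _ (smooth_tower_y (Nat.iter m Px g) 0 (Hgm m) disc_0)) as [c [_ [HS [_ Hc]]]].
apply (is_Cseries_unique (fun n => y ^ n * Nat.iter m Dx e 0%nat n)).
- apply dser_x0; [now apply dgrowth_iter_Dx|exact Hy].
- eapply is_Cseries_ext; [|apply HS, Hy]. intros n. cbv beta. f_equal.
  rewrite iter_Dx_00. unfold e. rewrite Hc. field. split; apply RtoC_fact_neq_0.
Qed.

(** * Laurent series on the exterior of the disc *)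

Lemma De_neq_0 (z : C) : De z -> z <> 0.
Proof. intros H. apply Cmod_gt_0. unfold De in H. lra. Qed.

Lemma De_inv_disc (z : C) : De z -> disc (/ z).
Proof.
intros H. unfold disc. rewrite Cmod_inv by now apply De_neq_0.
rewrite <- Rinv_1. apply Rinv_lt_contravar; unfold De in H; lra.
Qed.

Lemma Cinv_neq_0 (z : C) : z <> 0 -> / z <> 0.
Proof. intros H E. assert (K := Cinv_r z H). rewrite E, Cmult_0_r in K. apply RtoC_inj in K. lra. Qed.

Lemma Cinv_involutive (z : C) : z <> 0 -> / / z = z.
Proof. intros H. field. exact H. Qed.

Lemma disc_inv_De (x : C) : disc x -> x <> 0 -> De (/ x).
Proof.
intros H H0. unfold De. rewrite Cmod_inv by exact H0.
rewrite <- Rinv_1. assert (P := proj1 (Cmod_gt_0 x) H0). unfold disc in H.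
apply Rinv_lt_contravar; lra.
Qed.

Lemma De_nbhd (z : C) : De z -> exists d : R, (0 < d)%R /\ forall y, (Cmod (y - z) < d)%R -> De y.
Proof.
intros H. exists (Cmod z - 1)%R. unfold De in *. split; [lra|].
intros y Hy. assert (H1 := Cmod_triangle_rev z y). rewrite Cmod_minus_sym in H1. lra.
Qed.

Lemma C_infty_eps (f : C -> C) (l : C) :
  filterlim f C_infty (locally (T := C_UniformSpace) l) <->
  forall eps : R, (0 < eps)%R -> exists M : R, forall z, (M < Cmod z)%R -> (Cmod (f z - l) < eps)%R.
Proof.
split.
- intros H eps He.
  exact (H _ (proj2 (locally_C l (fun y => (Cmod (y - l) < eps)%R))
     (ex_intro _ eps (conj He (fun y Hy => Hy))))).
- intros H P HP. apply locally_C in HP. destruct HP as [d [Hd HP]].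
  destruct (H d Hd) as [M HM]. exists M. intros z Hz. apply HP, HM, Hz.
Qed.

Lemma C_infty_inv (f : C -> C) (l : C) :
  filterlim f C_infty (locally (T := C_UniformSpace) l) <->
  forall eps : R, (0 < eps)%R -> exists d : R, (0 < d)%R /\
    forall x, (0 < Cmod x < d)%R -> (Cmod (f (/ x)%C - l) < eps)%R.
Proof.
rewrite C_infty_eps. split; intros H eps He.
- destruct (H eps He) as [M HM]. exists (/ (Rabs M + 1))%R.
  assert (PM := Rabs_pos M). split; [apply Rinv_0_lt_compat; lra|].
  intros x [Hx0 Hx]. apply HM. rewrite Cmod_inv by now apply Cmod_gt_0.
  assert (QM := Rle_abs M).
  apply Rlt_trans with (Rabs M + 1)%R; [lra|].
  rewrite <- (Rinv_inv (Rabs M + 1)). apply Rinv_lt_contravar; [|exact Hx].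
  apply Rmult_lt_0_compat; [exact Hx0|]. apply Rinv_0_lt_compat; lra.
- destruct (H eps He) as [d [Hd HM]]. exists (/ d)%R. intros z Hz.
  assert (P : (0 < / d)%R) by now apply Rinv_0_lt_compat.
  assert (Hz0 : z <> 0) by (apply Cmod_gt_0; lra).
  rewrite <- (Cinv_involutive z Hz0). apply HM. rewrite Cmod_inv by exact Hz0. split.
  + apply Rinv_0_lt_compat. lra.
  + rewrite <- (Rinv_inv d). apply Rinv_lt_contravar; [|exact Hz]. apply Rmult_lt_0_compat; lra.
Qed.

Lemma filterlim_C_infty_continuous (f g : C -> C) : continuous g (RtoC 0) ->
  (forall x : C, x <> 0 -> disc x -> f (/ x) = g x) ->
  filterlim f C_infty (locally (T := C_UniformSpace) (g 0)).
Proof.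
intros Hg E. apply C_infty_inv. intros eps He. rewrite continuous_Cmod in Hg.
destruct (proj1 (locally_C _ _) (Hg eps He)) as [d [Hd HH]].
exists (Rmin 1 d). split; [apply Rmin_pos; lra|]. intros x [Hx0 Hx].
rewrite E.
- apply HH. replace (x - 0) with x by ring. eapply Rlt_le_trans; [exact Hx|apply Rmin_r].
- now apply Cmod_gt_0.
- unfold disc. eapply Rlt_le_trans; [exact Hx|apply Rmin_l].
Qed.

Lemma C_infty_unique (f : C -> C) (l l' : C) :
  filterlim f C_infty (locally (T := C_UniformSpace) l) ->
  filterlim f C_infty (locally (T := C_UniformSpace) l') -> l = l'.
Proof. apply (filterlim_locally_unique (V := C_NormedModule) f). Qed.

(** The segment from [x] towards 0 stays in the punctured disc. So [f] is constant along it, and its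
    value is the limit at 0. *)
Lemma punctured_disc_const (f : C -> C) (l : C) :
  (forall x : C, x <> 0 -> disc x -> is_C_derive f x 0) ->
  (forall eps : R, (0 < eps)%R -> exists d : R, (0 < d)%R /\
    forall x, (0 < Cmod x < d)%R -> (Cmod (f x - l) < eps)%R) ->
  forall x : C, x <> 0 -> disc x -> f x = l.
Proof.
intros Hf Hl x Hx0 Hx. unfold disc in Hx. assert (Px := proj1 (Cmod_gt_0 x) Hx0).
assert (E : forall t, (0 < t < 1)%R -> f (RtoC t * x) = f x).
{ intros t Ht.
  assert (PD : forall s, (t <= s <= 1)%R -> path_derive (fun s => f (RtoC s * x)) s 0).
  { intros s Hs. replace (RtoC 0) with (x * 0) by ring.
    apply (path_derive_comp f (fun s => RtoC s * x)).
    - apply Hf.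
      + apply Cmult_neq_0; [|exact Hx0]. intros Z. apply RtoC_inj in Z. lra.
      + unfold disc. rewrite Cmod_mult, Cmod_R, Rabs_pos_eq by lra. nra.
    - destruct x as [a b]. split; simpl; auto_derive; auto; ring. }
  replace (f x) with (f (RtoC 1 * x)) by (f_equal; ring).
  rewrite (surjective_pairing (f (RtoC t * x))), (surjective_pairing (f (RtoC 1 * x))). f_equal.
  - apply (eq_is_derive (V := R_NormedModule) (fun s => fst (f (RtoC s * x)))); [|lra].
    intros s Hs. apply (PD s Hs).
  - apply (eq_is_derive (V := R_NormedModule) (fun s => snd (f (RtoC s * x)))); [|lra].
    intros s Hs. apply (PD s Hs). }
assert (Z : f x - l = 0).
{ apply Cmod_eq0_eps. intros eps He. destruct (Hl eps He) as [d [Hd HH]].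
  set (t := Rmin (1 / 2) (d / 2)).
  assert (Ht : (0 < t <= 1 / 2 /\ t <= d / 2)%R).
  { unfold t. repeat split; [apply Rmin_pos; lra|apply Rmin_l|apply Rmin_r]. }
  rewrite <- (E t) by lra. apply Rlt_le, HH.
  rewrite Cmod_mult, Cmod_R, Rabs_pos_eq by lra. split; [apply Rmult_lt_0_compat; lra|nra]. }
replace (f x) with (f x - l + l) by ring. rewrite Z. ring.
Qed.

Lemma De_const (f : C -> C) (l : C) :
  (forall z, De z -> is_C_derive f z 0) ->
  filterlim f C_infty (locally (T := C_UniformSpace) l) -> forall z, De z -> f z = l.
Proof.
intros Hf Hl z Hz. assert (N := De_neq_0 z Hz).
rewrite <- (Cinv_involutive z N).
apply (punctured_disc_const (fun x => f (/ x))); [|now apply C_infty_inv| |].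
- intros x Hx0 Hx. eapply is_C_derive_eq.
  + apply (is_C_derive_comp f Cinv); [apply Hf; now apply disc_inv_De|now apply is_C_derive_Cinv].
  + ring.
- now apply Cinv_neq_0.
- now apply De_inv_disc.
Qed.

(** The action of d/dz on the coefficients of [sum a_mn z^-m w^-n]: [z^-m] goes to [-m z^-(m+1)]. In
    [x = 1 / z] it is the operator [- x^2 d/dx]. *)
Definition dz (a : nat -> nat -> C) (m n : nat) : C :=
  match m with 0%nat => 0 | S m => - RtoC (INR m) * a m n end.
Definition dw (a : nat -> nat -> C) (m n : nat) : C :=
  match n with 0%nat => 0 | S n => - RtoC (INR n) * a m n end.

Lemma dz_shx (a : nat -> nat -> C) (m n : nat) : dz a m n = - (1) * shx (shx (Dx a)) m n.
Proof.
destruct m as [|[|m]]; simpl; [ring|ring|]. unfold Dx. simpl INR. ring.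
Qed.

Lemma dgrowth_scal (c : C) (a : nat -> nat -> C) : dgrowth a -> dgrowth (fun m n => c * a m n).
Proof.
intros H r Hr. destruct (H r Hr) as [A HA]. exists (Cmod c * A)%R. intros m n.
rewrite Cmod_mult, Rmult_assoc. apply Rmult_le_compat_l; [apply Cmod_ge_0|apply HA].
Qed.

Lemma dgrowth_dz (a : nat -> nat -> C) : dgrowth a -> dgrowth (dz a).
Proof.
intros H. apply (dgrowth_ext (fun m n => - (1) * shx (shx (Dx a)) m n)).
- apply dgrowth_scal, dgrowth_shx, dgrowth_shx, dgrowth_Dx, H.
- intros m n. now rewrite dz_shx.
Qed.

Lemma dw_dz (a : nat -> nat -> C) (m n : nat) : dw a m n = dz (fun m n => a n m) n m.
Proof. reflexivity. Qed.

Lemma dgrowth_dw (a : nat -> nat -> C) : dgrowth a -> dgrowth (dw a).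
Proof. intros H. exact (dgrowth_transpose _ (dgrowth_dz _ (dgrowth_transpose _ H))). Qed.

Lemma dser_scal (c : C) (a : nat -> nat -> C) (x y : C) : dgrowth a -> disc x -> disc y ->
  dser (fun m n => c * a m n) x y = c * dser a x y.
Proof.
intros Ha Hx Hy. apply dser_eq.
eapply is_Cseries_ext; [|apply is_Cseries_scal, (is_dser a x y Ha Hx Hy)].
intros s. cbv beta. unfold hom. rewrite <- csum_scal. apply csum_ext. intros; ring.
Qed.

Lemma dser_dz (a : nat -> nat -> C) (x y : C) : dgrowth a -> disc x -> disc y ->
  dser (dz a) x y = - (x * x) * dser (Dx a) x y.
Proof.
intros Ha Hx Hy. rewrite (dser_ext _ _ x y (dz_shx a)).
rewrite dser_scal, dser_shx, dser_shx; auto using dgrowth_shx, dgrowth_Dx. ring.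
Qed.

Lemma dser_dw (a : nat -> nat -> C) (x y : C) : dgrowth a -> disc x -> disc y ->
  dser (dw a) x y = - (y * y) * dser (Dy a) x y.
Proof.
intros Ha Hx Hy. rewrite dser_transpose, (dser_transpose (Dy a)).
exact (dser_dz _ y x (dgrowth_transpose _ Ha) Hy Hx).
Qed.

Definition lser (a : nat -> nat -> C) (z w : C) : C := dser a (/ z) (/ w).

Lemma lser_chain (a : nat -> nat -> C) (u v : C -> C) (z u' v' : C) : dgrowth a ->
  De (u z) -> De (v z) -> is_C_derive u z u' -> is_C_derive v z v' ->
  is_C_derive (fun t => lser a (u t) (v t)) z
    (u' * lser (dz a) (u z) (v z) + v' * lser (dw a) (u z) (v z)).
Proof.
intros Ha Hu Hv Du Dv. assert (Nu := De_neq_0 _ Hu). assert (Nv := De_neq_0 _ Hv).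
eapply is_C_derive_eq.
- apply (dser_chain a (fun t => / u t) (fun t => / v t)); auto.
  + now apply De_inv_disc.
  + now apply De_inv_disc.
  + apply is_C_derive_inv; eauto.
  + apply is_C_derive_inv; eauto.
- cbv beta. unfold lser. rewrite dser_dz, dser_dw by (auto; now apply De_inv_disc). ring.
Qed.

Lemma lser_derive_z (a : nat -> nat -> C) (z w : C) : dgrowth a -> De z -> De w ->
  is_C_derive (fun z => lser a z w) z (lser (dz a) z w).
Proof.
intros Ha Hz Hw. eapply is_C_derive_eq.
- apply (lser_chain a (fun z => z) (fun _ => w)); auto;
    [apply is_C_derive_id|apply is_C_derive_const].
- cbv beta. ring.
Qed.

Lemma lser_derive_w (a : nat -> nat -> C) (z w : C) : dgrowth a -> De z -> De w ->
  is_C_derive (fun w => lser a z w) w (lser (dw a) z w).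
Proof.
intros Ha Hz Hw. eapply is_C_derive_eq.
- apply (lser_chain a (fun _ => z) (fun w => w)); auto;
    [apply is_C_derive_const|apply is_C_derive_id].
- cbv beta. ring.
Qed.

Lemma lser_derive_diag (a : nat -> nat -> C) (z : C) : dgrowth a -> De z ->
  is_C_derive (fun z => lser a z z) z (lser (dz a) z z + lser (dw a) z z).
Proof.
intros Ha Hz. eapply is_C_derive_eq.
- apply (lser_chain a (fun z => z) (fun z => z)); auto; apply is_C_derive_id.
- cbv beta. ring.
Qed.

Lemma pow_n_Cpow (x : C) (n : nat) : pow_n (K := C_Ring) x n = x ^ n.
Proof. induction n as [|n IH]; simpl; [reflexivity|]. rewrite IH. reflexivity. Qed.

Lemma pow_diff_csum (x y : C) (s : nat) :
  (x - y) * csum (fun m => x ^ m * y ^ (s - m)) s = x ^ S s - y ^ S s.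
Proof.
induction s as [|s IH].
- rewrite csum_0. simpl. ring.
- rewrite csum_S, Nat.sub_diag.
  rewrite (csum_ext _ (fun m => y * (x ^ m * y ^ (s - m)))).
  2:{ intros k Hk. replace (S s - k)%nat with (S (s - k)) by lia. rewrite Cpow_S. ring. }
  rewrite csum_scal, Cmult_plus_distr_l.
  replace ((x - y) * (y * csum (fun k => x ^ k * y ^ (s - k)) s)) with
    (y * ((x - y) * csum (fun k => x ^ k * y ^ (s - k)) s)) by ring.
  rewrite IH, !Cpow_S. simpl. ring.
Qed.

(* The coefficients of the difference quotient of [sum b_n x^n]. *)
Definition dquot (b : nat -> C) (m n : nat) : C := b (S (m + n)).

Lemma dgrowth_dquot (b : nat -> C) : sgrowth b -> dgrowth (dquot b).
Proof.
intros H r Hr. destruct (H r Hr) as [A HA]. exists (A / r)%R. intros m n. unfold dquot.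
specialize (HA (S (m + n))). apply Rmult_le_reg_r with r; [lra|].
unfold Rdiv. rewrite (Rmult_assoc A), Rinv_l, Rmult_1_r by lra.
rewrite <- tech_pow_Rmult in HA. lra.
Qed.

Lemma dser_dquot (b : nat -> C) (x y : C) : sgrowth b -> disc x -> disc y ->
  dser (emb b) x 0 - dser (emb b) y 0 = (x - y) * dser (dquot b) x y.
Proof.
intros Hb Hx Hy.
assert (P : forall u, disc u -> is_Cseries (fun n => u ^ S n * b (S n)) (dser (emb b) u 0 - b 0%nat)).
{ intros u Hu. assert (T := proj1 (is_Cseries_tail _ _) (dser_y0 (emb b) u (dgrowth_emb b Hb) Hu)).
  simpl in T. rewrite Cmult_1_l in T. exact T. }
assert (Q := is_Cseries_minus _ _ _ _ (P x Hx) (P y Hy)).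
assert (T := is_Cseries_scal (x - y) _ _ (is_dser _ x y (dgrowth_dquot b Hb) Hx Hy)).
replace (dser (emb b) x 0 - dser (emb b) y 0) with
  (dser (emb b) x 0 - b 0%nat - (dser (emb b) y 0 - b 0%nat)) by ring.
apply (is_Cseries_unique _ _ _ Q).
eapply is_Cseries_ext; [|exact T]. intros s. cbv beta.
unfold hom. rewrite (csum_ext _ (fun m => b (S s) * (x ^ m * y ^ (s - m)))).
2:{ intros k Hk. unfold dquot. do 2 f_equal. lia. }
rewrite csum_scal.
transitivity (b (S s) * ((x - y) * csum (fun m => x ^ m * y ^ (s - m)) s)); [ring|].
rewrite pow_diff_csum. ring.
Qed.

Lemma ex_filterdiff_derive_fst (F : C -> C -> C) (z w : C) :
  ex_filterdiff (K := C_AbsRing)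
    (U := prod_NormedModule C_AbsRing C_NormedModule C_NormedModule) (V := C_NormedModule)
    (fun p => F (fst p) (snd p))
    (locally (T := prod_NormedModule C_AbsRing C_NormedModule C_NormedModule) (z, w)) ->
  exists l, is_C_derive (fun z => F z w) z l.
Proof.
intros [l [Hl H]]. exists (l (RtoC 1, RtoC 0)).
assert (Hx : is_filter_lim (locally (T := prod_NormedModule C_AbsRing C_NormedModule C_NormedModule) (z, w)) (z, w))
  by now intros P HP.
assert (HL : forall h : C, l (h, RtoC 0) = h * l (RtoC 1, RtoC 0)).
{ intros h. refine (eq_trans _ (linear_scal l Hl h (RtoC 1, RtoC 0))). f_equal.
  change ((h, RtoC 0) = (h * 1, h * 0)). f_equal; ring. }
apply is_C_derive_eps. intros eps He.
specialize (H _ Hx (mkposreal eps He)). apply locally_C2 in H.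
destruct H as [d [Hd H]]. exists d; split; [exact Hd|].
intros y Hy.
assert (Hw : (Cmod (w - w) < d)%R) by (replace (w - w) with (RtoC 0) by ring; rewrite Cmod_0; exact Hd).
specialize (H y w Hy Hw).
set (U := prod_NormedModule C_AbsRing C_NormedModule C_NormedModule) in *.
assert (E : minus (G := U) (y, w) (z, w) = (y - z, RtoC 0)).
{ change ((y - z, w - w) = (y - z, RtoC 0)). f_equal. ring. }
assert (N : norm (K := C_AbsRing) (V := U) (y - z, RtoC 0) = Cmod (y - z)).
{ change (sqrt (Cmod (y - z) ^ 2 + Cmod 0 ^ 2) = Cmod (y - z))%R.
  rewrite Cmod_0. replace (Cmod (y - z) ^ 2 + 0 ^ 2)%R with (Cmod (y - z) * Cmod (y - z))%R by ring.
  apply sqrt_square, Cmod_ge_0. }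
change (Cmod (F y w - F z w - l (minus (G := U) (y, w) (z, w)))
  <= eps * norm (K := C_AbsRing) (V := U) (minus (G := U) (y, w) (z, w)))%R in H.
rewrite E, N in H. now rewrite <- HL.
Qed.

(** * The Grunsky symbol as a double Laurent series *)

(** The normalization of the branch: the series vanishes when [z] or [w] is infinite. *)
Definition bordered_zero (a : nat -> nat -> C) : Prop :=
  (forall m, a m 0%nat = 0) /\ (forall n, a 0%nat n = 0).

Lemma dser_y0_zero (a : nat -> nat -> C) (x : C) : dgrowth a -> bordered_zero a -> disc x ->
  dser a x 0 = 0.
Proof.
intros Ha [H0 _] Hx. apply (is_Cseries_unique _ _ _ (dser_y0 a x Ha Hx)).
apply is_Cseries_zero. intros n. rewrite H0. ring.
Qed.

Lemma dser_x0_zero (a : nat -> nat -> C) (y : C) : dgrowth a -> bordered_zero a -> disc y ->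
  dser a 0 y = 0.
Proof.
intros Ha [_ H0] Hy. apply (is_Cseries_unique _ _ _ (dser_x0 a y Ha Hy)).
apply is_Cseries_zero. intros n. rewrite H0. ring.
Qed.

(** The termwise antiderivative in [x] that vanishes at [x = 0]. Applied to a logarithmic derivative
    it yields the normalized branch of the logarithm. *)
Definition primx (e : nat -> nat -> C) (m n : nat) : C :=
  match m with 0%nat => 0 | S m' => e m' n / RtoC (INR m) end.

Lemma RtoC_INR_S_neq_0 (m : nat) : RtoC (INR (S m)) <> 0.
Proof. intros E. apply RtoC_inj in E. apply (not_0_INR (S m)) in E; auto. Qed.

Lemma dgrowth_primx (e : nat -> nat -> C) : dgrowth e -> dgrowth (primx e).
Proof.
intros H. apply (dgrowth_of_le (shx e)); [now apply dgrowth_shx|].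
intros [|m] n; simpl; [apply Rle_refl|].
change (match m with 0%nat => 1%R | S _ => (INR m + 1)%R end) with (INR (S m)).
rewrite Cmod_div, Cmod_INR by apply RtoC_INR_S_neq_0.
assert (P : (1 <= INR (S m))%R) by (rewrite S_INR; assert (Q := pos_INR m); lra).
apply Rmult_le_reg_r with (INR (S m)); [lra|].
unfold Rdiv. rewrite Rmult_assoc, Rinv_l by lra.
apply Rmult_le_compat_l; [apply Cmod_ge_0|exact P].
Qed.

Lemma Dx_primx (e : nat -> nat -> C) (m n : nat) : Dx (primx e) m n = e m n.
Proof. unfold Dx, primx. field. apply RtoC_INR_S_neq_0. Qed.

Lemma continuous_dser_x (a : nat -> nat -> C) (x y : C) : dgrowth a -> disc x -> disc y ->
  continuous (fun x => dser a x y) x.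
Proof. intros Ha Hx Hy. eapply is_C_derive_continuous. now apply dser_derive_x. Qed.

Lemma continuous_dser_y (a : nat -> nat -> C) (x y : C) : dgrowth a -> disc x -> disc y ->
  continuous (fun y => dser a x y) y.
Proof. intros Ha Hx Hy. eapply is_C_derive_continuous. now apply dser_derive_y. Qed.

Lemma continuous_at_0_lim (f : C -> C) : continuous f (RtoC 0) ->
  forall eps : R, (0 < eps)%R -> exists d : R, (0 < d)%R /\
    forall x, (0 < Cmod x < d)%R -> (Cmod (f x - f 0) < eps)%R.
Proof.
intros H eps He. rewrite continuous_Cmod in H.
destruct (proj1 (locally_C _ _) (H eps He)) as [d [Hd HH]]. exists d; split; [exact Hd|].
intros x Hx. apply HH. replace (x - 0) with x by ring. apply Hx.
Qed.

(* If [psi z = z + sum b_n z^-n], then [(psi z - psi w) / (z - w)] is this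
   function at [x = 1 / z], [y = 1 / w]. *)
Definition Hquot (b : nat -> C) (x y : C) : C := 1 - x * y * dser (dquot b) x y.

Lemma Hquot_sym (b : nat -> C) (x y : C) : Hquot b x y = Hquot b y x.
Proof.
unfold Hquot. rewrite (dser_transpose _ x y), (dser_ext (fun m n => dquot b n m) (dquot b)).
- ring.
- intros m n. unfold dquot. do 2 f_equal. lia.
Qed.

Lemma smooth_Hquot (b : nat -> C) : sgrowth b -> smooth (Hquot b).
Proof.
intros Hb n. apply diffn_minus; [apply diffn_const|].
apply diffn_mult; [apply diffn_mult; [apply diffn_fst|apply diffn_snd]|].
apply diffn_dser. now apply dgrowth_dquot.
Qed.

Lemma Sigma_Hquot (psi : C -> C) : Sigma psi -> exists b, sgrowth b /\
  forall z w, De z -> De w -> psi z - psi w = (z - w) * Hquot b (/ z) (/ w).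
Proof.
intros [_ [_ [b Hb]]]. exists b.
assert (HS : forall z, De z -> is_Cseries (fun n => (/ z) ^ n * b n) (psi z - z)).
{ intros z Hz. eapply is_Cseries_ext; [|exact (Hb z Hz)]. intros n. cbv beta.
  now rewrite pow_n_Cpow. }
assert (Gb : sgrowth b).
{ apply (sgrowth_of_series b (fun x => psi (/ x) - / x)). intros x [Hx0 Hx].
  assert (N : x <> 0) by now apply Cmod_gt_0.
  assert (K := HS (/ x) (disc_inv_De x Hx N)). now rewrite Cinv_involutive in K. }
split; [exact Gb|]. intros z w Hz Hw.
assert (Nz := De_neq_0 z Hz). assert (Nw := De_neq_0 w Hw).
assert (D := dser_dquot b (/ z) (/ w) Gb (De_inv_disc z Hz) (De_inv_disc w Hw)).
rewrite (dser_emb b (/ z) 0 _ (HS z Hz)), (dser_emb b (/ w) 0 _ (HS w Hw)) in D.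
unfold Hquot. set (q := dser (dquot b) (/ z) (/ w)) in *.
replace (psi z - psi w) with ((psi z - z - (psi w - w)) + (z - w)) by ring.
rewrite D. field. split; assumption.
Qed.

(** On the diagonal [Hquot] is the continuous extension of the difference quotient, hence the
    derivative of [psi]. *)
Lemma Grunsky_exp_Hquot (psi : C -> C) (Qe : C -> C -> C) (b : nat -> C) :
  Grunsky_symbol psi Qe -> sgrowth b ->
  (forall z w, De z -> De w -> psi z - psi w = (z - w) * Hquot b (/ z) (/ w)) ->
  forall z w, De z -> De w -> Cexp (Qe z w) = Hquot b (/ z) (/ w).
Proof.
intros [_ [H1 [H2 _]]] Gb HH z w Hz Hw.
destruct (Ceq_dec z w) as [<-|N].
- rewrite H2 by exact Hz. apply is_C_derive_unique.
  destruct (De_nbhd z Hz) as [d [Hd Dd]].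
  apply (is_C_derive_factor psi (fun y => Hquot b (/ y) (/ z)) z d Hd).
  + intros y Hy. apply HH; auto.
  + apply (continuous_comp_2 (U := C_UniformSpace) (V := C_UniformSpace) (W := C_UniformSpace)
      (X := C_UniformSpace) Cinv (fun _ => / z) (Hquot b)).
    * now apply continuous_Cinv_id, De_neq_0.
    * apply continuous_const.
    * apply (diffn_bicontinuous 0 _ (smooth_Hquot b Gb 0%nat)); now apply De_inv_disc.
- rewrite H1 by assumption. rewrite HH by assumption. field.
  intros E. apply N. replace z with (z - w + w) by ring. rewrite E. ring.
Qed.

(** [Qe] is only given for finite [z] and [w], whereas [Hquot] is smooth on the whole bidisc. Its
    logarithmic derivative in [x] is a double power series, and the primitive of that series is
    shown to be [Qe]. *)
Theorem Grunsky_dser (psi : C -> C) (Qe : C -> C -> C) : Sigma psi -> Grunsky_symbol psi Qe ->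
  exists gam, dgrowth gam /\ bordered_zero gam /\ (forall m n, gam m n = gam n m) /\
    forall z w, De z -> De w -> Qe z w = lser gam z w.
Proof.
intros HS HG. destruct (Sigma_Hquot psi HS) as [b [Gb HH]].
assert (HE := Grunsky_exp_Hquot psi Qe b HG Gb HH).
destruct HG as [Hol [_ [_ [Lz Lw]]]].
assert (SH := smooth_Hquot b Gb).
assert (HE' : forall x y : C, x <> 0 -> y <> 0 -> disc x -> disc y -> Cexp (Qe (/ x) (/ y)) = Hquot b x y).
{ intros x y Nx Ny Hx Hy. rewrite HE by now apply disc_inv_De. now rewrite !Cinv_involutive. }
assert (H0x : forall y, Hquot b 0 y = 1) by (intros y; unfold Hquot; ring).
assert (H0y : forall x, Hquot b x 0 = 1) by (intros x; unfold Hquot; ring).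
(* On the axes [Hquot] is 1, and elsewhere it is a value of the exponential. *)
assert (NH : forall x y, disc x -> disc y -> Hquot b x y <> 0).
{ intros x y Hx Hy. destruct (Ceq_dec x 0) as [->|Nx].
  - rewrite H0x. intros E. apply RtoC_inj in E. lra.
  - destruct (Ceq_dec y 0) as [->|Ny].
    + rewrite H0y. intros E. apply RtoC_inj in E. lra.
    + rewrite <- HE' by assumption. apply Cexp_neq_0. }
destruct (smooth_dser (fun x y => Px (Hquot b) x y * / Hquot b x y)) as [e [Ge He]].
{ intros n. apply diffn_mult; [now apply smooth_Px|]. now apply diffn_inv. }
set (gam := primx e).
assert (Gg : dgrowth gam) by now apply dgrowth_primx.
assert (Dg : forall x y, disc x -> disc y -> dser (Dx gam) x y = Px (Hquot b) x y * / Hquot b x y).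
{ intros x y Hx Hy. rewrite He by assumption. apply dser_ext. intros; apply Dx_primx. }
assert (Zg : forall y, disc y -> dser gam 0 y = 0).
{ intros y Hy. apply (is_Cseries_unique _ _ _ (dser_x0 gam y Gg Hy)).
  apply is_Cseries_zero. intros n. simpl. ring. }
(* Differentiating [exp Qe = Hquot] shows that both sides have the same derivative in [x], and both
   tend to 0 at [x = 0]. *)
assert (EQ : forall x y : C, x <> 0 -> y <> 0 -> disc x -> disc y -> Qe (/ x) (/ y) = dser gam x y).
{ intros x y Nx Ny Hx Hy. assert (Dy := disc_inv_De y Hy Ny).
  assert (Z : Qe (/ x) (/ y) - dser gam x y = 0).
  { apply (punctured_disc_const (fun x => Qe (/ x) (/ y) - dser gam x y) 0); auto.
    - clear x Nx Hx. intros x Nx Hx. assert (Dx' := disc_inv_De x Hx Nx).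
      destruct (ex_filterdiff_derive_fst Qe _ _ (Hol _ _ Dx' Dy)) as [l Hl].
      assert (K := is_C_derive_comp (fun z => Qe z (/ y)) Cinv x _ _ Hl (is_C_derive_Cinv x Nx)).
      cbv beta in K. set (d := - (/ x * / x) * l) in K.
      assert (E1 := is_C_derive_comp Cexp (fun x => Qe (/ x) (/ y)) x _ _ (is_C_derive_Cexp _) K).
      cbv beta in E1.
      assert (E2 : is_C_derive (fun x => Cexp (Qe (/ x) (/ y))) x (Px (Hquot b) x y)).
      { destruct (disc_nbhd x Hx) as [r [Hr Dr]].
        apply (is_C_derive_ext_loc (fun x => Hquot b x y) _ x _ (Rmin r (Cmod x))).
        - apply Rmin_pos; [exact Hr|now apply Cmod_gt_0].
        - intros t Ht. symmetry. apply HE'; auto.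
          + intros ->. assert (Q := Rlt_le_trans _ _ _ Ht (Rmin_r _ _)).
            rewrite Cmod_minus_sym in Q. replace (x - 0) with x in Q by ring. lra.
          + apply Dr. eapply Rlt_le_trans; [exact Ht|apply Rmin_l].
        - apply (smooth_partials _ SH x y Hx Hy). }
      assert (E3 := is_C_derive_uniq _ _ _ _ E1 E2). rewrite HE' in E3 by assumption.
      eapply is_C_derive_eq.
      + apply is_C_derive_minus; [exact K|now apply dser_derive_x].
      + rewrite Dg by assumption. rewrite <- E3. field. now apply NH.
    - assert (LL := proj1 (C_infty_inv _ _) (Lz (/ y) Dy)).
      assert (CC := continuous_at_0_lim (fun x => dser gam x y) (continuous_dser_x gam 0 y Gg disc_0 Hy)).
      cbv beta in CC. rewrite Zg in CC by exact Hy.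
      intros eps Heps. destruct (LL (eps / 2)%R ltac:(lra)) as [d1 [P1 Q1]].
      destruct (CC (eps / 2)%R ltac:(lra)) as [d2 [P2 Q2]].
      exists (Rmin d1 d2). split; [now apply Rmin_pos|]. intros t [T0 T].
      specialize (Q1 t (conj T0 (Rlt_le_trans _ _ _ T (Rmin_l _ _)))).
      specialize (Q2 t (conj T0 (Rlt_le_trans _ _ _ T (Rmin_r _ _)))).
      replace (Qe (/ t) (/ y) - dser gam t y - 0) with
        ((Qe (/ t) (/ y) - 0) - (dser gam t y - 0)) by ring.
      eapply Rle_lt_trans; [apply Cmod_minus_le|]. lra. }
  replace (Qe (/ x) (/ y)) with (Qe (/ x) (/ y) - dser gam x y + dser gam x y) by ring.
  rewrite Z. ring. }
(* Row 0 of [gam] vanishes by construction; column 0 vanishes by the normalization of [Qe] at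
   [w = oo]. *)
assert (Zy : forall x : C, x <> 0 -> disc x -> dser gam x 0 = 0).
{ intros x Nx Hx. symmetry.
  apply (C_infty_unique (fun w => Qe (/ x) w)).
  - apply Lw. now apply disc_inv_De.
  - apply (filterlim_C_infty_continuous _ (fun y => dser gam x y)).
    + apply (continuous_dser_y gam x 0 Gg Hx disc_0).
    + intros y Ny Hy. now apply EQ. }
assert (BZ : bordered_zero gam).
{ split; [|reflexivity]. apply (pow_series_zero (fun m => gam m 0%nat) 1%R Rlt_0_1).
  intros w [Hw0 Hw]. rewrite <- (Zy w); [now apply dser_y0|now apply Cmod_gt_0|exact Hw]. }
assert (EH : forall x y, disc x -> disc y -> Cexp (dser gam x y) = Hquot b x y).
{ intros x y Hx Hy. destruct (Ceq_dec x 0) as [->|Nx].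
  - rewrite H0x, Zg by exact Hy. apply Cexp_0.
  - destruct (Ceq_dec y 0) as [->|Ny].
    + rewrite H0y, Zy by assumption. apply Cexp_0.
    + rewrite <- EQ by assumption. now apply HE'. }
assert (Dgy : forall x y, disc x -> disc y -> dser (Dy gam) x y = Py (Hquot b) x y * / Hquot b x y).
{ intros x y Hx Hy. assert (N := NH x y Hx Hy).
  assert (E1 := is_C_derive_comp Cexp (fun y => dser gam x y) y _ _ (is_C_derive_Cexp _) (dser_derive_y gam x y Gg Hx Hy)).
  assert (E2 : is_C_derive (fun y => Cexp (dser gam x y)) y (Py (Hquot b) x y)).
  { destruct (disc_nbhd y Hy) as [r [Hr Dr]].
    apply (is_C_derive_ext_loc (Hquot b x) _ y _ r Hr).
    - intros t Ht. symmetry. apply EH; auto.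
    - apply (smooth_partials _ SH x y Hx Hy). }
  rewrite <- (is_C_derive_uniq _ _ _ _ E1 E2). cbv beta. rewrite EH by assumption. field. exact N. }
assert (PP : forall x y, Py (Hquot b) y x = Px (Hquot b) x y).
{ intros x y. unfold Px, Py, C_derive, C_lim. f_equal; apply f_equal, Lim_ext; intros t; now rewrite !(Hquot_sym b y). }
assert (Sym : forall x y, disc x -> disc y -> dser gam x y = dser (fun m n => gam n m) x y).
(* [Hquot] is symmetric, so both sides have the same derivative in [x]; both vanish at [x = 0]. *)
{ assert (S0 : forall x y : C, x <> 0 -> disc x -> disc y -> dser gam x y = dser gam y x).
  { intros x y Nx Hx Hy.
    assert (Z : dser gam x y - dser gam y x = 0).
    { apply (punctured_disc_const (fun x => dser gam x y - dser gam y x)); auto.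
      - clear x Nx Hx. intros x _ Hx. eapply is_C_derive_eq.
        + apply is_C_derive_minus; [now apply dser_derive_x|now apply dser_derive_y].
        + rewrite Dg, Dgy, PP, (Hquot_sym b y x) by assumption. ring.
      - assert (CC := continuous_at_0_lim (fun x => dser gam x y - dser gam y x)
          (continuous_Cminus _ _ _ (continuous_dser_x gam 0 y Gg disc_0 Hy) (continuous_dser_y gam y 0 Gg Hy disc_0))).
        cbv beta in CC. rewrite (Zg y Hy), (dser_y0_zero gam y Gg BZ Hy) in CC.
        replace (0 - 0) with (RtoC 0) in CC by ring. exact CC. }
    replace (dser gam x y) with (dser gam x y - dser gam y x + dser gam y x) by ring.
    rewrite Z. ring. }
  intros x y Hx Hy. rewrite <- (dser_transpose gam y x).
  destruct (Ceq_dec x 0) as [->|Nx]; [|now apply S0].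
  rewrite Zg, dser_y0_zero; auto. }
exists gam. split; [exact Gg|split; [exact BZ|split]].
- apply (dser_inj gam (fun m n => gam n m) Gg (dgrowth_transpose _ Gg) Sym).
- intros z w Hz Hw. assert (Nz := De_neq_0 z Hz). assert (Nw := De_neq_0 w Hw).
  unfold lser. rewrite <- EQ by auto using Cinv_neq_0, De_inv_disc.
  now rewrite !Cinv_involutive.
Qed.

(** * Jets on the diagonal *)

Definition jet (a : nat -> nat -> C) (j k : nat) : nat -> nat -> C :=
  Nat.iter j dz (Nat.iter k dw a).

Lemma dgrowth_jet (a : nat -> nat -> C) (j k : nat) : dgrowth a -> dgrowth (jet a j k).
Proof.
intros H. unfold jet. assert (H1 : dgrowth (Nat.iter k dw a)).
{ induction k; simpl; auto using dgrowth_dw. }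
induction j; simpl; auto using dgrowth_dz.
Qed.

Lemma C_derive_n_tower (F : C -> C) (f : nat -> C -> C) : tower De f ->
  (forall z, De z -> F z = f 0%nat z) -> forall n z, De z -> C_derive_n n F z = f n z.
Proof.
intros Hf H0 n. induction n as [|n IH]; intros z Hz; [now apply H0|].
apply is_C_derive_unique. destruct (De_nbhd z Hz) as [d [Hd Dd]].
apply (is_C_derive_ext_loc (f n) _ z _ d Hd); [|now apply Hf].
intros y Hy. symmetry. apply IH. auto.
Qed.

Lemma tower_lser_z (a : nat -> nat -> C) (w : C) : dgrowth a -> De w ->
  tower De (fun j z => lser (Nat.iter j dz a) z w).
Proof. intros Ha Hw j z Hz. apply lser_derive_z; auto. exact (dgrowth_jet a j 0 Ha). Qed.

Lemma tower_lser_w (a : nat -> nat -> C) (z : C) : dgrowth a -> De z ->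
  tower De (fun k w => lser (Nat.iter k dw a) z w).
Proof. intros Ha Hz k w Hw. apply lser_derive_w; auto. exact (dgrowth_jet a 0 k Ha). Qed.

Lemma dpartial_lser (Qe : C -> C -> C) (a : nat -> nat -> C) (j k : nat) (z w : C) : dgrowth a ->
  (forall z w, De z -> De w -> Qe z w = lser a z w) -> De z -> De w ->
  dpartial j k Qe z w = lser (jet a j k) z w.
Proof.
intros Ha HQ Hz Hw. unfold dpartial.
refine (C_derive_n_tower _ _ (tower_lser_z (Nat.iter k dw a) w (dgrowth_jet a 0 k Ha) Hw) _ j z Hz).
intros z' Hz'. refine (C_derive_n_tower _ _ (tower_lser_w a z' Ha Hz') _ k w Hw).
intros w' Hw'. now apply HQ.
Qed.

Lemma dz_ext (a b : nat -> nat -> C) : (forall m n, a m n = b m n) -> forall m n, dz a m n = dz b m n.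
Proof. intros H [|m] n; simpl; [reflexivity|now rewrite H]. Qed.

Lemma dw_dz_comm (a : nat -> nat -> C) (m n : nat) : dw (dz a) m n = dz (dw a) m n.
Proof. destruct m as [|m], n as [|n]; simpl; ring. Qed.

Lemma dw_iter_dz (a : nat -> nat -> C) (j m n : nat) :
  dw (Nat.iter j dz a) m n = Nat.iter j dz (dw a) m n.
Proof.
revert m n. induction j as [|j IH]; intros m n; [reflexivity|].
simpl. rewrite dw_dz_comm. now apply dz_ext.
Qed.

Lemma lser_ext (a b : nat -> nat -> C) (z w : C) : (forall m n, a m n = b m n) -> lser a z w = lser b z w.
Proof. apply dser_ext. Qed.

Lemma jet_derive_diag (a : nat -> nat -> C) (j k : nat) (z : C) : dgrowth a -> De z ->
  is_C_derive (fun z => lser (jet a j k) z z) z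
    (lser (jet a (S j) k) z z + lser (jet a j (S k)) z z).
Proof.
intros Ha Hz. eapply is_C_derive_eq; [now apply lser_derive_diag; [apply dgrowth_jet|]|].
f_equal. apply lser_ext. intros m n. apply dw_iter_dz.
Qed.

Lemma jet_derive_w (a : nat -> nat -> C) (j k : nat) (z w : C) : dgrowth a -> De z -> De w ->
  is_C_derive (fun w => lser (jet a j k) z w) w (lser (jet a j (S k)) z w).
Proof.
intros Ha Hz Hw. eapply is_C_derive_eq; [now apply lser_derive_w; [apply dgrowth_jet| |]|].
apply lser_ext. intros m n. apply dw_iter_dz.
Qed.

Lemma jet_derive_z (a : nat -> nat -> C) (j k : nat) (z w : C) : dgrowth a -> De z -> De w ->
  is_C_derive (fun z => lser (jet a j k) z w) z (lser (jet a (S j) k) z w).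
Proof. intros Ha Hz Hw. apply lser_derive_z; auto. now apply dgrowth_jet. Qed.

Lemma iter_dz_transpose (a : nat -> nat -> C) (j m n : nat) :
  Nat.iter j dz (fun m n => a n m) m n = Nat.iter j dw a n m.
Proof.
revert m n. induction j as [|j IH]; intros m n; [reflexivity|].
simpl. rewrite dw_dz. now apply dz_ext.
Qed.

Lemma iter_dz_ext (j : nat) (a b : nat -> nat -> C) : (forall m n, a m n = b m n) ->
  forall m n, Nat.iter j dz a m n = Nat.iter j dz b m n.
Proof. intros H. induction j as [|j IH]; [exact H|]. simpl. now apply dz_ext. Qed.

Lemma iter_dw_ext (j : nat) (a b : nat -> nat -> C) : (forall m n, a m n = b m n) ->
  forall m n, Nat.iter j dw a m n = Nat.iter j dw b m n.
Proof.
intros H m n. rewrite <- !iter_dz_transpose. apply iter_dz_ext. intros; apply H.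
Qed.

Lemma iter_dw_iter_dz (a : nat -> nat -> C) (j k m n : nat) :
  Nat.iter k dw (Nat.iter j dz a) m n = Nat.iter j dz (Nat.iter k dw a) m n.
Proof.
revert m n. induction k as [|k IH]; intros m n; [reflexivity|]. simpl.
rewrite <- dw_iter_dz, !dw_dz. apply dz_ext. intros; apply IH.
Qed.

Lemma jet_transpose (a : nat -> nat -> C) (j k m n : nat) :
  jet (fun m n => a n m) j k m n = jet a k j n m.
Proof.
unfold jet. rewrite <- iter_dw_iter_dz, <- iter_dz_transpose.
apply iter_dz_ext. intros i l. apply iter_dz_transpose.
Qed.

Definition diagc (a : nat -> nat -> C) (s : nat) : C := csum (fun m => a m (s - m)%nat) s.

Lemma lser_diag (a : nat -> nat -> C) (z : C) : dgrowth a -> De z ->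
  is_Cseries (fun s => (/ z) ^ s * diagc a s) (lser a z z).
Proof.
intros Ha Hz. eapply is_Cseries_ext; [|apply is_dser; auto; now apply De_inv_disc].
intros s. cbv beta. unfold hom, diagc. rewrite <- csum_scal. apply csum_ext. intros m Hm.
replace ((/ z) ^ s) with ((/ z) ^ m * (/ z) ^ (s - m)); [ring|].
rewrite <- Cpow_add_r. f_equal. lia.
Qed.

(** The rising factorial [m (m + 1) ... (m + j - 1)], which [j] differentiations of [z^-m] produce
    up to sign. *)
Fixpoint rise (m j : nat) : nat :=
  match j with 0%nat => 1%nat | S j => (rise m j * (m + j))%nat end.

Lemma rise_front (m j : nat) : rise m (S j) = (m * rise (S m) j)%nat.
Proof.
induction j as [|j IH]; [simpl; lia|].
change (rise m (S (S j))) with (rise m (S j) * (m + S j))%nat. rewrite IH.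
change (rise (S m) (S j)) with (rise (S m) j * (S m + j))%nat. lia.
Qed.

Lemma iter_dz_low (a : nat -> nat -> C) (j m n : nat) : (m < j)%nat -> Nat.iter j dz a m n = 0.
Proof.
revert m. induction j as [|j IH]; intros m Hm; [lia|].
simpl. destruct m as [|m]; simpl; [reflexivity|]. rewrite IH by lia. ring.
Qed.

Lemma iter_dz_coef (a : nat -> nat -> C) (j m n : nat) :
  Nat.iter j dz a (m + j)%nat n = (- (1)) ^ j * RtoC (INR (rise m j)) * a m n.
Proof.
induction j as [|j IH].
- rewrite Nat.add_0_r. simpl. ring.
- replace (m + S j)%nat with (S (m + j)) by lia.
  change (- RtoC (INR (m + j)) * Nat.iter j dz a (m + j)%nat n = (- (1)) ^ S j * RtoC (INR (rise m (S j))) * a m n).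
  rewrite IH. simpl rise. rewrite mult_INR, RtoC_mult, Cpow_S. ring.
Qed.

Lemma iter_dw_low (a : nat -> nat -> C) (k m n : nat) : (n < k)%nat -> Nat.iter k dw a m n = 0.
Proof. intros H. rewrite <- iter_dz_transpose. now apply iter_dz_low. Qed.

Lemma iter_dw_coef (a : nat -> nat -> C) (k m n : nat) :
  Nat.iter k dw a m (n + k)%nat = (- (1)) ^ k * RtoC (INR (rise n k)) * a m n.
Proof. rewrite <- iter_dz_transpose. exact (iter_dz_coef (fun m n => a n m) k n m). Qed.

Lemma csum_shift (u : nat -> C) (j n : nat) : (forall M, (M < j)%nat -> u M = 0) ->
  csum u (n + j) = csum (fun m => u (m + j)%nat) n.
Proof.
revert u. induction j as [|j IH]; intros u H.
- rewrite Nat.add_0_r. apply csum_ext. intros; f_equal; lia.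
- replace (n + S j)%nat with (S (n + j)) by lia.
  rewrite csum_first, H by lia. rewrite Cplus_0_l.
  rewrite (IH (fun k => u (S k))) by (intros; apply H; lia).
  apply csum_ext. intros; f_equal; lia.
Qed.

Lemma csum_extend (u : nat -> C) (k n : nat) : (forall M, (n < M <= n + k)%nat -> u M = 0) ->
  csum u (n + k) = csum u n.
Proof.
induction k as [|k IH]; intros H; [now rewrite Nat.add_0_r|].
replace (n + S k)%nat with (S (n + k)) by lia.
rewrite csum_S, IH, H by (try lia; intros; apply H; lia). ring.
Qed.

(** Differentiation shifts [m] by [j] and [n] by [k], so the diagonal coefficient of index
    [j + k + s] sees only the antidiagonal [s] of [a]. *)
Lemma diagc_jet (a : nat -> nat -> C) (j k s : nat) :
  diagc (jet a j k) (j + k + s) =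
  (- (1)) ^ (j + k) * csum (fun m => a m (s - m)%nat * (RtoC (INR (rise m j)) * RtoC (INR (rise (s - m) k)))) s.
Proof.
unfold diagc. replace (j + k + s)%nat with ((s + k) + j)%nat by lia.
rewrite csum_shift by (intros; now apply iter_dz_low).
rewrite csum_extend.
- rewrite <- csum_scal. apply csum_ext. intros m Hm.
  replace (s + k + j - (m + j))%nat with ((s - m) + k)%nat by lia.
  unfold jet. rewrite iter_dz_coef, iter_dw_coef, Cpow_add_r. ring.
- intros M HM. unfold jet. rewrite iter_dz_coef, iter_dw_low by lia. ring.
Qed.

(** The antidiagonals 0 and 1 lie in the zero border. This is the origin of the exponent [j + k + 2]
    in (a). *)
Lemma diagc_jet_low (a : nat -> nat -> C) (j k p : nat) : bordered_zero a -> (p < j + k + 2)%nat ->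
  diagc (jet a j k) p = 0.
Proof.
intros [B1 B2] Hp. destruct (Compare_dec.le_lt_dec (j + k) p) as [H|H].
- replace p with (j + k + (p - (j + k)))%nat by lia. rewrite diagc_jet.
  rewrite csum_zero; [ring|]. intros m Hm.
  assert (E : m = 0%nat \/ (p - (j + k) - m = 0)%nat) by lia.
  destruct E as [->|E]; [rewrite B2; ring|]. rewrite E, B1. ring.
- unfold diagc. apply csum_zero. intros m Hm. unfold jet.
  destruct (Compare_dec.le_lt_dec j m) as [Hj|Hj]; [|now apply iter_dz_low].
  replace m with ((m - j) + j)%nat at 1 by lia. rewrite iter_dz_coef, iter_dw_low by lia. ring.
Qed.

(* The binomial coefficient C(m+j-1, j); it is 0 for [m = 0 < j]. *)
Definition ubin (m j : nat) : C := RtoC (INR (rise m j)) / RtoC (INR (fact j)).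

(** * Finite differences of the normalized Laurent coefficients *)

Definition fdiff (g : nat -> C) (j : nat) : C := g (S j) - g j.

(** Pascal's rule for C(m+j, j). *)
Lemma ubin_diff (m j : nat) : fdiff (ubin (S m)) j = ubin m (S j).
Proof.
unfold fdiff, ubin. rewrite (rise_front m j).
change (rise (S m) (S j)) with (rise (S m) j * (S m + j))%nat.
change (fact (S j)) with ((S j) * fact j)%nat.
rewrite !mult_INR, plus_INR, !RtoC_mult, RtoC_plus.
assert (E := RtoC_fact_neq_0 j). assert (E' := RtoC_INR_S_neq_0 j).
rewrite !S_INR, !RtoC_plus in *. field. split; assumption.
Qed.

Lemma ubin_0_S (j : nat) : ubin 0 (S j) = 0.
Proof. unfold ubin. rewrite rise_front. simpl (0 * _)%nat. simpl INR at 1. unfold Cdiv. ring. Qed.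

Lemma ubin_1 (j : nat) : ubin 1 j = 1.
Proof.
unfold ubin. replace (rise 1 j) with (fact j).
- field. apply RtoC_fact_neq_0.
- induction j as [|j IH]; [reflexivity|]. simpl rise. rewrite <- IH. simpl. lia.
Qed.

Lemma iter_fdiff_ubin (p m j : nat) : (p <= m)%nat -> Nat.iter p fdiff (ubin m) j = ubin (m - p) (j + p).
Proof.
revert j. induction p as [|p IH]; intros j Hp.
- rewrite Nat.sub_0_r, Nat.add_0_r. reflexivity.
- simpl Nat.iter. unfold fdiff at 1. rewrite !IH by lia.
  replace (m - p)%nat with (S (m - S p)) by lia.
  replace (j + S p)%nat with (S (j + p)) by lia. apply ubin_diff.
Qed.

(** For [m >= 1], C(m+j-1, j) is a polynomial in [j] of degree [m - 1], so [m] differences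
    annihilate it. *)
Lemma iter_fdiff_ubin_high (p m j : nat) : (1 <= m <= p)%nat -> Nat.iter p fdiff (ubin m) j = 0.
Proof.
intros H. replace p with ((p - m) + m)%nat by lia. generalize (p - m)%nat. intros q.
revert j. induction q as [|q IH]; intros j.
- simpl. rewrite iter_fdiff_ubin, Nat.sub_diag by lia. destruct m as [|m]; [lia|].
  replace (j + S m)%nat with (S (j + m)) by lia. apply ubin_0_S.
- simpl. unfold fdiff. rewrite !IH. ring.
Qed.

Lemma iter_diff_k_prod (q s : nat) (c : nat -> C) (U V : nat -> nat -> C) (j k : nat) :
  Nat.iter q diff_k (fun j k => csum (fun m => c m * (U m j * V m k)) s) j k
  = csum (fun m => c m * (U m j * Nat.iter q fdiff (V m) k)) s.
Proof.
revert j k. induction q as [|q IH]; intros j k; [reflexivity|].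
simpl. unfold diff_k at 1. rewrite !IH, <- csum_minus. apply csum_ext. intros m _. unfold fdiff at 3. ring.
Qed.

Lemma iter_diff_j_prod (p s : nat) (c : nat -> C) (U V : nat -> nat -> C) (f : nat -> nat -> C) :
  (forall j k, f j k = csum (fun m => c m * (U m j * V m k)) s) -> forall j k,
  Nat.iter p diff_j f j k = csum (fun m => c m * (Nat.iter p fdiff (U m) j * V m k)) s.
Proof.
intros H. induction p as [|p IH]; intros j k; [apply H|].
simpl. unfold diff_j at 1. rewrite !IH, <- csum_minus. apply csum_ext. intros m _. unfold fdiff at 3. ring.
Qed.

Definition gdiff (p q : nat) (f : nat -> nat -> C) : nat -> nat -> C :=
  Nat.iter p diff_j (Nat.iter q diff_k f).

(** What [scoef] becomes when the functions have the jets of [a]. For [a] with zero border it is a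
    polynomial in [j] and [k]. *)
Definition acoef (a : nat -> nat -> C) (s j k : nat) : C :=
  csum (fun m => a m (s - m)%nat * (ubin m j * ubin (s - m) k)) s.

Lemma gdiff_acoef (a : nat -> nat -> C) (s p q j k : nat) :
  gdiff p q (acoef a s) j k
  = csum (fun m => a m (s - m)%nat * (Nat.iter p fdiff (ubin m) j * Nat.iter q fdiff (ubin (s - m)) k)) s.
Proof.
unfold gdiff.
refine (iter_diff_j_prod p s (fun m => a m (s - m)%nat) ubin (fun m => Nat.iter q fdiff (ubin (s - m))) _ _ j k).
intros j' k'. exact (iter_diff_k_prod q s (fun m => a m (s - m)%nat) ubin (fun m => ubin (s - m)) j' k').
Qed.

(** If [i + l = s < m + n], then [i <= m - 1] or [l <= n - 1], and the corresponding difference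
    annihilates the term of [a i l]. *)
Lemma gdiff_acoef_high (a : nat -> nat -> C) (s m n j k : nat) : bordered_zero a ->
  (1 <= m)%nat -> (1 <= n)%nat -> (s < m + n)%nat -> gdiff (m - 1) (n - 1) (acoef a s) j k = 0.
Proof.
intros [B1 B2] Hm Hn Hs. rewrite gdiff_acoef. apply csum_zero. intros i Hi.
destruct i as [|i]; [rewrite B2; ring|].
destruct (s - S i)%nat as [|l] eqn:E; [rewrite B1; ring|].
destruct (Compare_dec.le_lt_dec (S i) (m - 1)) as [H|H].
- rewrite (iter_fdiff_ubin_high (m - 1)) by lia. ring.
- rewrite (iter_fdiff_ubin_high (n - 1)) by lia. ring.
Qed.

Lemma csum_one (u : nat -> C) (i n : nat) : (i <= n)%nat ->
  (forall k, (k <= n)%nat -> k <> i -> u k = 0) -> csum u n = u i.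
Proof.
induction n as [|n IH]; intros Hi H.
- replace i with 0%nat by lia. apply csum_0.
- destruct (Nat.eq_dec i (S n)) as [->|N].
  + apply csum_last. intros; apply H; lia.
  + rewrite csum_S, (H (S n)), IH by (auto; try lia; intros; apply H; lia). ring.
Qed.

(** On the antidiagonal [m + n] only the term of [a m n] survives, and each of its two binomial
    factors is differenced to exactly 1, independently of (j, k). This is why (d) has the powers
    [m - 1] and [n - 1]. *)
Lemma gdiff_acoef_top (a : nat -> nat -> C) (m n j k : nat) : bordered_zero a ->
  (1 <= m)%nat -> (1 <= n)%nat -> gdiff (m - 1) (n - 1) (acoef a (m + n)) j k = a m n.
Proof.
intros [B1 B2] Hm Hn. rewrite gdiff_acoef. rewrite (csum_one _ m); [|lia|].
2:{ intros i Hi Ni. destruct i as [|i]; [rewrite B2; ring|].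
    destruct (m + n - S i)%nat as [|l] eqn:E; [rewrite B1; ring|].
    destruct (Compare_dec.le_lt_dec (S i) (m - 1)) as [H|H].
    - rewrite (iter_fdiff_ubin_high (m - 1)) by lia. ring.
    - rewrite (iter_fdiff_ubin_high (n - 1)) by lia. ring. }
replace (m + n - m)%nat with n by lia. rewrite !iter_fdiff_ubin by lia.
replace (m - (m - 1))%nat with 1%nat by lia. replace (n - (n - 1))%nat with 1%nat by lia.
rewrite !ubin_1. ring.
Qed.

(** * The jets satisfying (a), (b) and (d) *)

Lemma is_Cseries_drop (u : nat -> C) (l : C) (N : nat) : is_Cseries u l ->
  (forall p, (p < N)%nat -> u p = 0) -> is_Cseries (fun s => u (N + s)%nat) l.
Proof.
revert u. induction N as [|N IH]; intros u H H0; [exact H|].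
apply (IH (fun s => u (S s))).
- replace l with (l - u 0%nat) by (rewrite H0 by lia; ring). now apply (proj1 (is_Cseries_tail u l)).
- intros p Hp. apply H0. lia.
Qed.

Lemma Cpow_mul_inv (z : C) (n : nat) : z <> 0 -> z ^ n * (/ z) ^ n = 1.
Proof. intros H. rewrite <- Cpow_mult_l, Cinv_r by exact H. apply Cpow_1_l. Qed.

Lemma scaled_series_lim (F : C -> C) (D : nat -> C) (N : nat) :
  (forall z, De z -> is_Cseries (fun s => z ^ N * (/ z) ^ s * D s) (F z)) ->
  (forall s, (s < N)%nat -> D s = 0) ->
  filterlim F C_infty (locally (T := C_UniformSpace) (D N)).
Proof.
intros HF H0. set (D' := fun s => D (N + s)%nat).
assert (HS : forall z, De z -> is_Cseries (fun s => (/ z) ^ s * D' s) (F z)).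
{ intros z Hz. assert (K := is_Cseries_drop _ _ N (HF z Hz) (fun p Hp => ltac:(cbv beta; rewrite H0 by exact Hp; ring))).
  eapply is_Cseries_ext; [|exact K]. intros s. cbv beta. unfold D'.
  rewrite Cpow_add_r, !Cmult_assoc, Cpow_mul_inv by now apply De_neq_0. ring. }
assert (HS' : forall x, (0 < Cmod x < 1)%R -> is_Cseries (fun s => x ^ s * D' s) (F (/ x)%C)).
{ intros x [Hx0 Hx]. assert (N0 : x <> 0) by now apply Cmod_gt_0.
  assert (K := HS _ (disc_inv_De x Hx N0)). now rewrite Cinv_involutive in K. }
assert (G := sgrowth_of_series D' (fun x => F (/ x)) HS').
replace (D N) with (dser (emb D') 0 0).
2:{ rewrite dser_00. simpl. unfold D'. now rewrite Nat.add_0_r. }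
apply (filterlim_C_infty_continuous F (fun x => dser (emb D') x 0)).
- apply (continuous_dser_x (emb D') 0 0 (dgrowth_emb D' G) disc_0 disc_0).
- intros x N0 Hx. symmetry. apply dser_emb, HS'. split; [now apply Cmod_gt_0|exact Hx].
Qed.

Lemma C_infty_decay (F : C -> C) (l : C) (k : nat) :
  filterlim F C_infty (locally (T := C_UniformSpace) l) ->
  filterlim (fun z => (/ z) ^ (S k) * F z) C_infty (locally (T := C_UniformSpace) (RtoC 0)).
Proof.
intros H. apply C_infty_eps. intros eps He.
destruct (proj1 (C_infty_eps _ _) H 1%R Rlt_0_1) as [M HM].
assert (Pl := Cmod_ge_0 l).
exists (Rmax M (Rmax 1 ((Cmod l + 1) / eps))). intros z Hz.
assert (H1 := Rle_lt_trans _ _ _ (Rmax_l _ _) Hz).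
assert (H2 := Rle_lt_trans _ _ _ (Rle_trans _ _ _ (Rmax_l _ _) (Rmax_r _ _)) Hz).
assert (H3 := Rle_lt_trans _ _ _ (Rle_trans _ _ _ (Rmax_r _ _) (Rmax_r _ _)) Hz).
assert (B := HM z H1). assert (T := Cmod_triangle_rev (F z) l).
assert (Hi : (0 < / Cmod z <= 1)%R).
{ split; [apply Rinv_0_lt_compat; lra|]. rewrite <- Rinv_1. apply Rinv_le_contravar; lra. }
assert (Nz : z <> 0) by (apply Cmod_gt_0; lra).
replace ((/ z) ^ S k * F z - 0) with ((/ z) ^ S k * F z) by ring.
rewrite Cmod_mult, Cmod_pow, Cmod_inv by exact Nz.
assert (P2 : ((/ Cmod z) ^ S k <= / Cmod z)%R).
{ rewrite <- tech_pow_Rmult. rewrite <- (Rmult_1_r (/ Cmod z)) at 3.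
  apply Rmult_le_compat_l; [lra|]. rewrite <- (pow1 k). apply pow_incr. lra. }
apply Rle_lt_trans with (/ Cmod z * (Cmod l + 1))%R.
- apply Rmult_le_compat; [apply pow_le; lra|apply Cmod_ge_0|exact P2|lra].
- apply Rmult_lt_reg_l with (Cmod z); [lra|]. rewrite <- Rmult_assoc, Rinv_r, Rmult_1_l by lra.
  apply Rmult_lt_reg_r with (/ eps)%R; [now apply Rinv_0_lt_compat|].
  rewrite (Rmult_assoc (Cmod z)), Rinv_r, Rmult_1_r by lra. exact H3.
Qed.

(** A finite limit excludes positive powers of [z]: by strong induction on [s < N], dividing by
    [z ^ (N - s)] leaves the limit [D s] on one side and 0 on the other. *)
Lemma scaled_series_lim_inv (F : C -> C) (D : nat -> C) (N : nat) (l : C) :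
  (forall z, De z -> is_Cseries (fun s => z ^ N * (/ z) ^ s * D s) (F z)) ->
  filterlim F C_infty (locally (T := C_UniformSpace) l) ->
  (forall s, (s < N)%nat -> D s = 0) /\ D N = l.
Proof.
intros HF Hl.
assert (H : forall s, (s < N)%nat -> D s = 0).
{ intros s. induction s as [s IH] using lt_wf_ind. intros Hs.
  apply (C_infty_unique (fun z => (/ z) ^ S (N - s - 1) * F z)).
  - apply (scaled_series_lim _ D s).
    + intros z Hz. eapply is_Cseries_ext; [|apply is_Cseries_scal, (HF z Hz)].
      intros t. cbv beta.
      replace (z ^ N) with (z ^ s * z ^ S (N - s - 1)) by (rewrite <- Cpow_add_r; f_equal; lia).
      transitivity ((z ^ S (N - s - 1) * (/ z) ^ S (N - s - 1)) * (z ^ s * (/ z) ^ t * D t)); [ring|].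
      rewrite Cpow_mul_inv by now apply De_neq_0. ring.
    + intros t Ht. apply IH; lia.
  - now apply (C_infty_decay F l). }
split; [exact H|]. apply (C_infty_unique F); [|exact Hl]. now apply scaled_series_lim.
Qed.

Definition represents (Q : nat -> nat -> C -> C) (q : nat -> nat -> nat -> C) : Prop :=
  forall j k, (forall z, De z -> is_Cseries (fun p => (/ z) ^ p * q j k p) (Q j k z)) /\
    (forall p, (p < j + k + 2)%nat -> q j k p = 0).

(** The coefficient of [z^-s] in [(-1)^(j+k) / (j! k!) z^(j+k) Q_jk], the quantity whose differences
    are taken in (d). *)
Definition scoef (q : nat -> nat -> nat -> C) (s j k : nat) : C :=
  (-1) ^ (j + k) / (RtoC (INR (fact j)) * RtoC (INR (fact k))) * q j k (j + k + s)%nat.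

Lemma iter_diff_k_ext (n : nat) (f g : nat -> nat -> C) : (forall j k, f j k = g j k) ->
  forall j k, Nat.iter n diff_k f j k = Nat.iter n diff_k g j k.
Proof. intros H. induction n as [|n IH]; intros j k; [apply H|]. simpl. unfold diff_k. now rewrite !IH. Qed.

Lemma iter_diff_j_ext (n : nat) (f g : nat -> nat -> C) : (forall j k, f j k = g j k) ->
  forall j k, Nat.iter n diff_j f j k = Nat.iter n diff_j g j k.
Proof. intros H. induction n as [|n IH]; intros j k; [apply H|]. simpl. unfold diff_j. now rewrite !IH. Qed.

Lemma gdiff_ext (p q : nat) (f g : nat -> nat -> C) (j k : nat) :
  (forall j k, f j k = g j k) -> gdiff p q f j k = gdiff p q g j k.
Proof. intros H. apply iter_diff_j_ext. intros; now apply iter_diff_k_ext. Qed.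

Lemma iter_diff_k_lin (n : nat) (c : nat -> C) (f g : nat -> nat -> C) (j k : nat) :
  Nat.iter n diff_k (fun j k => c j * f j k + g j k) j k
  = c j * Nat.iter n diff_k f j k + Nat.iter n diff_k g j k.
Proof. revert j k. induction n as [|n IH]; intros j k; [reflexivity|]. simpl. unfold diff_k at 1 3 5. rewrite !IH. ring. Qed.

Lemma iter_diff_j_lin (n : nat) (c : nat -> C) (f g : nat -> nat -> C) (j k : nat) :
  Nat.iter n diff_j (fun j k => c k * f j k + g j k) j k
  = c k * Nat.iter n diff_j f j k + Nat.iter n diff_j g j k.
Proof. revert j k. induction n as [|n IH]; intros j k; [reflexivity|]. simpl. unfold diff_j at 1 3 5. rewrite !IH. ring. Qed.

Lemma gdiff_lin (p q : nat) (c : C) (f g : nat -> nat -> C) (j k : nat) :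
  gdiff p q (fun j k => c * f j k + g j k) j k = c * gdiff p q f j k + gdiff p q g j k.
Proof.
unfold gdiff. rewrite <- (iter_diff_j_lin p (fun _ => c)). apply iter_diff_j_ext.
intros j' k'. apply (iter_diff_k_lin q (fun _ => c)).
Qed.

Lemma gdiff_scal (p q : nat) (c : C) (f : nat -> nat -> C) (j k : nat) :
  gdiff p q (fun j k => c * f j k) j k = c * gdiff p q f j k.
Proof.
assert (Z : gdiff p q (fun j k => (-(1)) * 0 + 0) j k = 0).
{ rewrite (gdiff_lin p q (-(1)) (fun _ _ => 0) (fun _ _ => 0)). ring. }
assert (Z' : gdiff p q (fun _ _ => 0) j k = 0).
{ refine (eq_trans (gdiff_ext _ _ _ _ _ _ _) Z). intros; ring. }
rewrite (gdiff_ext p q _ (fun j k => c * f j k + 0)) by (intros; ring).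
rewrite (gdiff_lin p q c f (fun _ _ => 0)), Z'. ring.
Qed.

Lemma gdiff_series (p q : nat) (f : nat -> nat -> nat -> C) (b : nat -> nat -> C) :
  (forall j k, is_Cseries (fun s => f s j k) (b j k)) ->
  forall j k, is_Cseries (fun s => gdiff p q (f s) j k) (gdiff p q b j k).
Proof.
intros H.
assert (H1 : forall j k, is_Cseries (fun s => Nat.iter q diff_k (f s) j k) (Nat.iter q diff_k b j k)).
{ induction q as [|q IH]; intros j k; [apply H|]. simpl. unfold diff_k at 1 3. now apply is_Cseries_minus. }
unfold gdiff. induction p as [|p IH]; intros j k; [apply H1|]. simpl. unfold diff_j at 1 3.
now apply is_Cseries_minus.
Qed.

Lemma represents_diff_expr (Q : nat -> nat -> C -> C) (q : nat -> nat -> nat -> C) (m n j k : nat) (z : C) :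
  represents Q q -> De z ->
  is_Cseries (fun s => z ^ (m + n) * (/ z) ^ s * gdiff (m - 1) (n - 1) (scoef q s) j k)
    (diff_expr Q m n j k z).
Proof.
intros HR Hz. assert (Nz := De_neq_0 z Hz).
eapply is_Cseries_ext.
2:{ apply (gdiff_series (m - 1) (n - 1) (fun s j k => z ^ (m + n) * (/ z) ^ s * scoef q s j k)).
  intros j' k'. destruct (HR j' k') as [H1 H2].
  assert (K := is_Cseries_drop _ _ (j' + k')%nat (H1 z Hz)
    (fun p Hp => ltac:(cbv beta; rewrite H2 by lia; ring))).
  apply (is_Cseries_scal ((-1) ^ (j' + k') / (RtoC (INR (fact j')) * RtoC (INR (fact k'))) * z ^ (j' + k' + m + n))) in K.
  eapply is_Cseries_ext; [|exact K].
  intros s. cbv beta. unfold scoef.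
  replace (j' + k' + m + n)%nat with ((j' + k') + (m + n))%nat by lia.
  rewrite !(Cpow_add_r _ (j' + k')).
  transitivity ((z ^ (j' + k') * (/ z) ^ (j' + k')) * (z ^ (m + n) * (/ z) ^ s *
    ((-1) ^ (j' + k') / (RtoC (INR (fact j')) * RtoC (INR (fact k'))) * q j' k' (j' + k' + s)%nat))); [ring|].
  rewrite Cpow_mul_inv by exact Nz. ring. }
intros s. cbv beta. now rewrite gdiff_scal.
Qed.

Lemma Cpow_m1_sq (n : nat) : (-1) ^ n * (- (1)) ^ n = 1.
Proof.
rewrite <- Cpow_mult_l. replace ((-1) * - (1)) with (RtoC 1) by (apply injective_projections; simpl; ring).
apply Cpow_1_l.
Qed.

Definition has_jets (Q : nat -> nat -> C -> C) (a : nat -> nat -> C) : Prop :=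
  forall j k z, De z -> Q j k z = lser (jet a j k) z z.

Lemma has_jets_represents (Q : nat -> nat -> C -> C) (a : nat -> nat -> C) :
  dgrowth a -> bordered_zero a -> has_jets Q a -> represents Q (fun j k => diagc (jet a j k)).
Proof.
intros Ha Hb HQ j k. split.
- intros z Hz. rewrite HQ by exact Hz. apply lser_diag; auto. now apply dgrowth_jet.
- intros p Hp. now apply diagc_jet_low.
Qed.

Lemma scoef_jet (a : nat -> nat -> C) (s j k : nat) :
  scoef (fun j k => diagc (jet a j k)) s j k = acoef a s j k.
Proof.
unfold scoef, acoef. rewrite diagc_jet.
assert (E1 := RtoC_fact_neq_0 j). assert (E2 := RtoC_fact_neq_0 k).
transitivity (((-1) ^ (j + k) * (- (1)) ^ (j + k)) * (/ (RtoC (INR (fact j)) * RtoC (INR (fact k))) *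
  csum (fun m => a m (s - m)%nat * (RtoC (INR (rise m j)) * RtoC (INR (rise (s - m) k)))) s)).
{ unfold Cdiv. ring. }
rewrite Cpow_m1_sq, Cmult_1_l, <- csum_scal. apply csum_ext. intros m _.
unfold ubin. field. split; assumption.
Qed.

Lemma has_jets_lim (Q : nat -> nat -> C -> C) (a : nat -> nat -> C) (m n j k : nat) :
  dgrowth a -> bordered_zero a -> has_jets Q a -> (1 <= m)%nat -> (1 <= n)%nat ->
  filterlim (diff_expr Q m n j k) C_infty (locally (T := C_UniformSpace) (a m n)).
Proof.
intros Ha Hb HQ Hm Hn. assert (HR := has_jets_represents Q a Ha Hb HQ).
set (q := fun j k => diagc (jet a j k)) in *.
assert (E : forall s, gdiff (m - 1) (n - 1) (scoef q s) j k = gdiff (m - 1) (n - 1) (acoef a s) j k).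
{ intros s. apply gdiff_ext. intros; apply scoef_jet. }
rewrite <- (gdiff_acoef_top a m n j k Hb Hm Hn), <- E.
apply (scaled_series_lim _ (fun s => gdiff (m - 1) (n - 1) (scoef q s) j k) (m + n)).
- intros z Hz. now apply represents_diff_expr.
- intros s Hs. rewrite E. now apply gdiff_acoef_high.
Qed.

Lemma has_jets_cond_a (Q : nat -> nat -> C -> C) (a : nat -> nat -> C) :
  dgrowth a -> bordered_zero a -> has_jets Q a -> cond_a Q.
Proof.
intros Ha Hb HQ j k. set (N := (j + k + 2)%nat).
destruct (has_jets_represents Q a Ha Hb HQ j k) as [H1 H2]. set (q := diagc (jet a j k)) in *.
assert (L : filterlim (fun z => z ^ N * Q j k z) C_infty (locally (T := C_UniformSpace) (q N))).
{ apply (scaled_series_lim _ q N); [|exact H2]. intros z Hz.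
  eapply is_Cseries_ext; [|apply is_Cseries_scal, (H1 z Hz)]. intros s. cbv beta. ring. }
destruct (proj1 (C_infty_eps _ _) L 1%R Rlt_0_1) as [M HM].
exists (Cmod (q N) + 1)%R, (Rmax M 1). intros z Hz.
assert (B := HM z (Rle_lt_trans _ _ _ (Rmax_l _ _) Hz)).
assert (Z1 := Rle_lt_trans _ _ _ (Rmax_r _ _) Hz).
assert (T := Cmod_triangle_rev (z ^ N * Q j k z) (q N)). rewrite Cmod_mult, Cmod_pow in T.
assert (P : (0 < Cmod z ^ N)%R) by (apply pow_lt; lra).
apply Rmult_le_reg_l with (Cmod z ^ N)%R; [exact P|].
rewrite (Rmult_comm (Cmod (q N) + 1)), <- Rmult_assoc, Rinv_r by lra. lra.
Qed.

Lemma has_jets_cond_b (Q : nat -> nat -> C -> C) (a : nat -> nat -> C) :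
  dgrowth a -> (forall m n, a m n = a n m) -> has_jets Q a -> cond_b Q.
Proof.
intros Ha Hs HQ. split.
- intros j k z Hz. rewrite !HQ by exact Hz. unfold lser. rewrite dser_transpose. apply dser_ext.
  intros m n. rewrite <- jet_transpose. unfold jet. apply iter_dz_ext, iter_dw_ext. intros; apply Hs.
- intros j k z Hz. apply is_C_derive_unique. rewrite (HQ (S j) k), (HQ j (S k)) by exact Hz.
  destruct (De_nbhd z Hz) as [d [Hd Dd]].
  apply (is_C_derive_ext_loc (fun z => lser (jet a j k) z z) _ z _ d Hd).
  + intros y Hy. symmetry. apply HQ. auto.
  + now apply jet_derive_diag.
Qed.

Lemma has_jets_cond_d (Q : nat -> nat -> C -> C) (a : nat -> nat -> C) :
  dgrowth a -> bordered_zero a -> has_jets Q a -> cond_d Q.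
Proof.
intros Ha Hb HQ. exists a. split.
- intros m n j k Hm Hn. now apply has_jets_lim.
- intros eps He. set (r := (/ (1 + eps))%R).
  assert (Hr : (0 < r < 1)%R).
  { unfold r. split; [apply Rinv_0_lt_compat; lra|]. rewrite <- Rinv_1. apply Rinv_lt_contravar; lra. }
  destruct (Ha r Hr) as [A HA]. exists A. intros m n _ _. specialize (HA m n).
  assert (P : (0 < (1 + eps) ^ (m + n))%R) by (apply pow_lt; lra).
  unfold r in HA. rewrite pow_inv in HA.
  apply Rmult_le_reg_r with (/ (1 + eps) ^ (m + n))%R; [now apply Rinv_0_lt_compat|].
  rewrite (Rmult_assoc A), Rinv_r by lra. lra.
Qed.

(** * The coefficient recursion that expresses the consistency condition in (b) *)

Definition dz1 (c : nat -> C) (p : nat) : C :=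
  match p with 0%nat => 0 | S p => - RtoC (INR p) * c p end.

Lemma series_inv_derive (c : nat -> C) (f : C -> C) :
  (forall z, De z -> is_Cseries (fun p => (/ z) ^ p * c p) (f z)) ->
  exists f', forall z, De z -> is_C_derive f z (f' z) /\ is_Cseries (fun p => (/ z) ^ p * dz1 c p) (f' z).
Proof.
intros H. exists (fun z => lser (dz (emb c)) z z).
assert (G : sgrowth c).
{ apply (sgrowth_of_series c (fun x => f (/ x))). intros x [Hx0 Hx].
  assert (N : x <> 0) by now apply Cmod_gt_0.
  assert (K := H (/ x) (disc_inv_De x Hx N)). now rewrite Cinv_involutive in K. }
assert (Ge := dgrowth_emb c G).
assert (E : forall m n, dz (emb c) m n = emb (dz1 c) m n).
{ intros [|m] [|n]; simpl; ring. }
intros z Hz. split.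
- destruct (De_nbhd z Hz) as [d [Hd Dd]].
  apply (is_C_derive_ext_loc (fun y => lser (emb c) y z) _ z _ d Hd).
  + intros y Hy. unfold lser. apply dser_emb, H. auto.
  + now apply lser_derive_z.
- eapply is_Cseries_ext; [|apply (is_dser (dz (emb c)) (/ z) (/ z)); auto using dgrowth_dz, De_inv_disc].
  + intros s. cbv beta. rewrite (hom_ext _ _ s _ _ E). apply hom_emb.
  + now apply De_inv_disc.
  + now apply De_inv_disc.
Qed.

Lemma series_inv_inj (c c' : nat -> C) (f : C -> C) :
  (forall z, De z -> is_Cseries (fun p => (/ z) ^ p * c p) (f z)) ->
  (forall z, De z -> is_Cseries (fun p => (/ z) ^ p * c' p) (f z)) -> forall p, c p = c' p.
Proof.
intros H H'. apply (pow_series_inj c c' (fun x => f (/ x)) 1 Rlt_0_1); intros x [Hx0 Hx];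
  assert (N : x <> 0) by (now apply Cmod_gt_0).
- assert (K := H (/ x) (disc_inv_De x Hx N)). now rewrite Cinv_involutive in K.
- assert (K := H' (/ x) (disc_inv_De x Hx N)). now rewrite Cinv_involutive in K.
Qed.

(** The coefficients of index [j + k + s + 1] in [Q_jk' = Q_(j+1)k + Q_j(k+1)]. The factors [S j]
    and [S k] come from the factorials in [scoef], and the signs cancel. *)
Lemma represents_recursion (Q : nat -> nat -> C -> C) (q : nat -> nat -> nat -> C) : represents Q q ->
  (forall j k z, De z -> is_C_derive (Q j k) z (Q (S j) k z + Q j (S k) z)) ->
  forall s j k, RtoC (INR (j + k + s)) * scoef q s j k
    = RtoC (INR (S j)) * scoef q s (S j) k + RtoC (INR (S k)) * scoef q s j (S k).
Proof.
intros HR HD s j k.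
destruct (series_inv_derive (q j k) (Q j k) (proj1 (HR j k))) as [f' Hf'].
assert (E : - RtoC (INR (j + k + s)) * q j k (j + k + s)%nat
  = q (S j) k (S (j + k + s)) + q j (S k) (S (j + k + s))).
{ change (dz1 (q j k) (S (j + k + s)) = (fun p => q (S j) k p + q j (S k) p) (S (j + k + s))).
  apply (series_inv_inj _ _ f').
  - intros z Hz. apply (Hf' z Hz).
  - intros z Hz. rewrite (is_C_derive_uniq _ _ _ _ (proj1 (Hf' z Hz)) (HD j k z Hz)).
    eapply is_Cseries_ext; [|apply is_Cseries_plus; [apply (HR (S j) k), Hz|apply (HR j (S k)), Hz]].
    intros p. cbv beta. ring. }
unfold scoef. replace (S j + k + s)%nat with (S (j + k + s)) by lia.
replace (j + S k + s)%nat with (S (j + k + s)) by lia.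
replace (S j + k)%nat with (S (j + k)) by lia. replace (j + S k)%nat with (S (j + k)) by lia.
rewrite !fact_simpl, !mult_INR, !RtoC_mult, !Cpow_S.
assert (F1 := RtoC_fact_neq_0 j). assert (F2 := RtoC_fact_neq_0 k).
assert (F3 := RtoC_INR_S_neq_0 j). assert (F4 := RtoC_INR_S_neq_0 k).
assert (M : RtoC (-1) = - (1)) by (apply injective_projections; simpl; ring). rewrite M.
transitivity ((- (1)) ^ (j + k) / (RtoC (INR (fact j)) * RtoC (INR (fact k))) * (- (1)) *
  (- RtoC (INR (j + k + s)) * q j k (j + k + s)%nat)).
- field. split; assumption.
- rewrite E. field. repeat split; assumption.
Qed.

(** Leibniz rule with a linear factor: only two terms remain. The second is taken at the shifted
    point, which makes no difference once the difference of order [p] is constant. *)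
Lemma iter_diff_j_leibniz (p : nat) (g : nat -> nat -> C) (j k : nat) :
  Nat.iter p diff_j (fun j k => RtoC (INR (S j)) * diff_j g j k) j k
  = RtoC (INR (S j)) * Nat.iter (S p) diff_j g j k + RtoC (INR p) * Nat.iter p diff_j g (S j) k.
Proof.
revert j k. induction p as [|p IH]; intros j k.
- change (INR 0) with 0%R. rewrite Cmult_0_l, Cplus_0_r. reflexivity.
- change (Nat.iter (S p) diff_j (fun j k => RtoC (INR (S j)) * diff_j g j k) j k) with
    (Nat.iter p diff_j (fun j k => RtoC (INR (S j)) * diff_j g j k) (S j) k
     - Nat.iter p diff_j (fun j k => RtoC (INR (S j)) * diff_j g j k) j k).
  rewrite !IH.
  change (Nat.iter (S (S p)) diff_j g j k) with (Nat.iter (S p) diff_j g (S j) k - Nat.iter (S p) diff_j g j k).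
  rewrite (S_INR (S j)), (S_INR p), !RtoC_plus.
  change (Nat.iter (S p) diff_j g (S j) k) with (Nat.iter p diff_j g (S (S j)) k - Nat.iter p diff_j g (S j) k).
  change (Nat.iter (S p) diff_j g j k) with (Nat.iter p diff_j g (S j) k - Nat.iter p diff_j g j k).
  ring.
Qed.

Lemma iter_diff_k_leibniz (p : nat) (g : nat -> nat -> C) (j k : nat) :
  Nat.iter p diff_k (fun j k => RtoC (INR (S k)) * diff_k g j k) j k
  = RtoC (INR (S k)) * Nat.iter (S p) diff_k g j k + RtoC (INR p) * Nat.iter p diff_k g j (S k).
Proof.
revert j k. induction p as [|p IH]; intros j k.
- change (INR 0) with 0%R. rewrite Cmult_0_l, Cplus_0_r. reflexivity.
- change (Nat.iter (S p) diff_k (fun j k => RtoC (INR (S k)) * diff_k g j k) j k) with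
    (Nat.iter p diff_k (fun j k => RtoC (INR (S k)) * diff_k g j k) j (S k)
     - Nat.iter p diff_k (fun j k => RtoC (INR (S k)) * diff_k g j k) j k).
  rewrite !IH.
  change (Nat.iter (S (S p)) diff_k g j k) with (Nat.iter (S p) diff_k g j (S k) - Nat.iter (S p) diff_k g j k).
  rewrite (S_INR (S k)), (S_INR p), !RtoC_plus.
  change (Nat.iter (S p) diff_k g j (S k)) with (Nat.iter p diff_k g j (S (S k)) - Nat.iter p diff_k g j (S k)).
  change (Nat.iter (S p) diff_k g j k) with (Nat.iter p diff_k g j (S k) - Nat.iter p diff_k g j k).
  ring.
Qed.

Lemma iter_diff_k_diff_j (q : nat) (g : nat -> nat -> C) (j k : nat) :
  Nat.iter q diff_k (diff_j g) j k = diff_j (Nat.iter q diff_k g) j k.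
Proof.
revert j k. induction q as [|q IH]; intros j k; [reflexivity|].
simpl. unfold diff_k at 1. rewrite !IH. unfold diff_j, diff_k. ring.
Qed.

(* A solution of the recursion whose differences of order [D <= s - 2] vanish is
   zero: a difference of order [D - 1] is then constant, and differencing the
   recursion multiplies this constant by [D - 1] on one side, [s - 2] on the other. *)
Lemma recursion_zero (B : nat -> nat -> C) (s : nat) :
  (forall j k, RtoC (INR (j + k + s)) * B j k
    = RtoC (INR (S j)) * B (S j) k + RtoC (INR (S k)) * B j (S k)) ->
  forall D, (D + 2 <= s)%nat -> (forall p q j k, (p + q = D)%nat -> gdiff p q B j k = 0) ->
  forall j k, B j k = 0.
Proof.
intros HB.
(* Subtracting [(j + 1) B j k + (k + 1) B j k] turns the recursion into a discrete Euler identity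
   with eigenvalue [s - 2]. *)
assert (HB' : forall j k, RtoC (INR s - 2) * B j k
  = RtoC (INR (S j)) * diff_j B j k + RtoC (INR (S k)) * diff_k B j k).
{ intros j k. unfold diff_j, diff_k. assert (H := HB j k).
  rewrite !plus_INR, !RtoC_plus in H. rewrite !S_INR, !RtoC_plus, RtoC_minus in *.
  transitivity ((RtoC (INR j) + RtoC (INR k) + RtoC (INR s)) * B j k - (RtoC (INR j) + 1 + (RtoC (INR k) + 1)) * B j k).
  - rewrite <- RtoC_plus. replace (RtoC 2) with (1 + 1) by (rewrite <- RtoC_plus; f_equal; ring). rewrite RtoC_plus. ring.
  - rewrite H. ring. }
induction D as [|D IH]; intros Hs H0.
- intros j k. exact (H0 0%nat 0%nat j k eq_refl).
- apply IH; [lia|]. intros p q j k Hpq.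
  assert (E1 : gdiff p q (fun j k => RtoC (INR (S j)) * diff_j B j k) j k
    = RtoC (INR (S j)) * gdiff (S p) q B j k + RtoC (INR p) * gdiff p q B (S j) k).
  { unfold gdiff. rewrite <- iter_diff_j_leibniz. apply iter_diff_j_ext. intros j' k'.
    rewrite <- iter_diff_k_diff_j.
    assert (L := iter_diff_k_lin q (fun j => RtoC (INR (S j))) (diff_j B) (fun _ _ => (-(1)) * 0 ) j' k').
    assert (Z : Nat.iter q diff_k (fun _ _ => (-(1)) * 0) j' k' = 0).
    { clear. revert j' k'. induction q as [|q IHq]; intros; simpl; [ring|]. unfold diff_k. rewrite !IHq. ring. }
    rewrite Z, Cplus_0_r in L. rewrite <- L. apply iter_diff_k_ext. intros; ring. }
  assert (E2 : gdiff p q (fun j k => RtoC (INR (S k)) * diff_k B j k) j k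
    = RtoC (INR (S k)) * gdiff p (S q) B j k + RtoC (INR q) * gdiff p q B j (S k)).
  { unfold gdiff.
    rewrite (iter_diff_j_ext p _ (fun j k => RtoC (INR (S k)) * Nat.iter (S q) diff_k B j k
      + RtoC (INR q) * Nat.iter q diff_k B j (S k))) by (intros; apply iter_diff_k_leibniz).
    rewrite (iter_diff_j_lin p (fun k => RtoC (INR (S k)))). f_equal.
    assert (L := iter_diff_j_lin p (fun _ => RtoC (INR q)) (fun j k => Nat.iter q diff_k B j (S k)) (fun _ _ => (-(1)) * 0) j k).
    assert (Z : forall j k, Nat.iter p diff_j (fun _ _ => (-(1)) * 0) j k = 0).
    { clear. induction p as [|p IHp]; intros; simpl; [ring|]. unfold diff_j. rewrite !IHp. ring. }
    rewrite Z, Cplus_0_r in L.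
    rewrite (iter_diff_j_ext p _ (fun j k => RtoC (INR q) * Nat.iter q diff_k B j (S k) + (-(1)) * 0)) by (intros; ring).
    rewrite L. f_equal. clear. revert j k. induction p as [|p IHp]; intros j k; [reflexivity|].
    simpl. unfold diff_j. now rewrite !IHp. }
  assert (E3 : RtoC (INR s - 2) * gdiff p q B j k = RtoC (INR p) * gdiff p q B (S j) k + RtoC (INR q) * gdiff p q B j (S k)).
  { rewrite <- gdiff_scal.
    rewrite (gdiff_ext p q _ (fun j k => 1 * (RtoC (INR (S j)) * diff_j B j k) + RtoC (INR (S k)) * diff_k B j k))
      by (intros; rewrite HB'; ring).
    rewrite (gdiff_lin p q 1 (fun j k => RtoC (INR (S j)) * diff_j B j k)), E1, E2.
    rewrite (H0 (S p) q), (H0 p (S q)) by lia. ring. }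
  assert (E4 : gdiff p q B (S j) k = gdiff p q B j k).
  { assert (K := H0 (S p) q j k ltac:(lia)).
    change (gdiff p q B (S j) k - gdiff p q B j k = 0) in K.
    replace (gdiff p q B (S j) k) with (gdiff p q B (S j) k - gdiff p q B j k + gdiff p q B j k) by ring.
    rewrite K. ring. }
  assert (E5 : gdiff p q B j (S k) = gdiff p q B j k).
  { assert (K := H0 p (S q) j k ltac:(lia)).
    assert (K2 : gdiff p (S q) B j k = gdiff p q B j (S k) - gdiff p q B j k).
    { unfold gdiff. clear. revert j k. induction p as [|p IHp]; intros j k; [reflexivity|].
      change (Nat.iter (S p) diff_j (Nat.iter (S q) diff_k B) j k) with
        (Nat.iter p diff_j (Nat.iter (S q) diff_k B) (S j) k - Nat.iter p diff_j (Nat.iter (S q) diff_k B) j k).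
      rewrite !IHp. simpl. unfold diff_j. ring. }
    rewrite K2 in K.
    replace (gdiff p q B j (S k)) with (gdiff p q B j (S k) - gdiff p q B j k + gdiff p q B j k) by ring.
    rewrite K. ring. }
  rewrite E4, E5 in E3.
  (* Here [p + q = D] and [S D + 2 <= s], so the scalar factor is not zero. *)
  assert (E6 : RtoC (INR s - 2 - INR p - INR q) * gdiff p q B j k = 0).
  { rewrite !RtoC_minus in *.
    transitivity ((RtoC (INR s) - RtoC 2) * gdiff p q B j k - (RtoC (INR p) * gdiff p q B j k + RtoC (INR q) * gdiff p q B j k)); [ring|].
    rewrite E3. ring. }
  destruct (Ceq_dec (gdiff p q B j k) 0) as [E|N]; [exact E|].
  exfalso.
  assert (F : RtoC (INR s - 2 - INR p - INR q) <> 0).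
  { intros F. apply RtoC_inj in F.
    assert (G : INR s = INR (2 + p + q)) by (rewrite !plus_INR; simpl; lra).
    apply INR_eq in G. lia. }
  exact (Cmult_neq_0 _ _ F N E6).
Qed.

(** * Laurent expansions at infinity from (a) and (b), and reconstruction of the double series *)

Lemma cond_a_inv (Q : nat -> nat -> C -> C) (j k : nat) : cond_a Q ->
  exists A d : R, (0 <= A)%R /\ (0 < d < 1)%R /\
    forall x, (0 < Cmod x < d)%R -> (Cmod (Q j k (/ x)%C) <= A * Cmod x ^ (j + k + 2))%R.
Proof.
intros Ha. destruct (Ha j k) as [A [M HM]].
exists (Rabs A), (/ (Rabs M + 2))%R.
assert (PM := Rabs_pos M). assert (QM := Rle_abs M).
split; [apply Rabs_pos|]. split.
{ split; [apply Rinv_0_lt_compat; lra|]. rewrite <- Rinv_1. apply Rinv_lt_contravar; lra. }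
intros x [Hx0 Hx]. assert (N : x <> 0) by now apply Cmod_gt_0.
assert (B : (M < Cmod (/ x))%R).
{ rewrite Cmod_inv by exact N. apply Rlt_trans with (Rabs M + 2)%R; [lra|].
  rewrite <- (Rinv_inv (Rabs M + 2)). apply Rinv_lt_contravar; [|exact Hx].
  apply Rmult_lt_0_compat; [exact Hx0|]. apply Rinv_0_lt_compat; lra. }
eapply Rle_trans; [apply (HM (/ x) B)|].
rewrite Cmod_inv by exact N. rewrite <- pow_inv, Rinv_inv.
apply Rmult_le_compat_r; [apply pow_le; lra|apply Rle_abs].
Qed.

Lemma pow_le_pow_lt1 (x : R) (m n : nat) : (0 <= x <= 1)%R -> (m <= n)%nat -> (x ^ n <= x ^ m)%R.
Proof.
intros Hx H. replace n with (m + (n - m))%nat by lia. rewrite pow_add.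
rewrite <- (Rmult_1_r (x ^ m)) at 2. apply Rmult_le_compat_l; [apply pow_le; lra|].
rewrite <- (pow1 (n - m)). apply pow_incr. lra.
Qed.

(** In [x = 1 / z] the singularity at 0 is removed by hand. By (a) the function is O(x^2), so its
    derivative at 0 is 0. By (b) its derivative elsewhere is [- x^-2] times a sum of two functions
    that (a) makes O(x^3), so the derivative is continuous at 0 and Cauchy's formula applies. *)
Lemma jets_expansion (Q : nat -> nat -> C -> C) (j k : nat) :
  (forall j k, holomorphic_De (Q j k)) -> cond_a Q -> cond_b Q ->
  exists c, forall z, De z -> is_Cseries (fun p => (/ z) ^ p * c p) (Q j k z).
Proof.
intros HQ Ha Hb.
set (f := fun x : C => if Ceq_dec x 0 then RtoC 0 else Q j k (/ x)).
set (f' := fun x : C => if Ceq_dec x 0 then RtoC 0 else - (/ x * / x) * (Q (S j) k (/ x) + Q j (S k) (/ x))).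
assert (fN : forall x : C, x <> 0 -> f x = Q j k (/ x)).
{ intros x N. unfold f. destruct (Ceq_dec x 0); [contradiction|reflexivity]. }
assert (fN' : forall x : C, x <> 0 -> f' x = - (/ x * / x) * (Q (S j) k (/ x) + Q j (S k) (/ x))).
{ intros x N. unfold f'. destruct (Ceq_dec x 0); [contradiction|reflexivity]. }
assert (f0 : f 0 = 0) by (unfold f; destruct (Ceq_dec 0 0); [reflexivity|contradiction]).
assert (f0' : f' 0 = 0) by (unfold f'; destruct (Ceq_dec 0 0); [reflexivity|contradiction]).
assert (near : forall x : C, x <> 0 -> forall y, (Cmod (y - x) < Cmod x)%R -> y <> 0).
{ intros x N y Hy ->. rewrite Cmod_minus_sym in Hy. replace (x - 0) with x in Hy by ring. lra. }
assert (HC : C1_disc f f').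
{ intros x Hx. destruct (Ceq_dec x 0) as [->|N].
  - rewrite f0'. split.
    + destruct (cond_a_inv Q j k Ha) as [A [d [PA [Hd HA]]]].
      apply (is_C_derive_quadratic f 0 A d); [lra|exact f0|].
      intros y Hy. replace (y - 0) with y in * by ring.
      assert (Py := Cmod_ge_0 y).
      destruct (Ceq_dec y 0) as [->|Ny].
      * rewrite f0, Cmod_0. simpl. lra.
      * rewrite fN by exact Ny. eapply Rle_trans; [apply HA; split; [now apply Cmod_gt_0|lra]|].
        apply Rmult_le_compat_l; [exact PA|]. apply pow_le_pow_lt1; [lra|lia].
    + destruct (cond_a_inv Q (S j) k Ha) as [A [d [PA [Hd HA]]]].
      destruct (cond_a_inv Q j (S k) Ha) as [A2 [d2 [PA2 [Hd2 HA2]]]].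
      apply continuous_Cmod. intros eps He. apply locally_C. rewrite f0'.
      exists (Rmin (Rmin d d2) (eps / (A + A2 + 1))). split.
      { repeat apply Rmin_pos; try lra. apply Rdiv_lt_0_compat; lra. }
      intros y Hy. replace (y - 0) with y in Hy by ring. replace (f' y - 0) with (f' y) by ring.
      destruct (Ceq_dec y 0) as [->|Ny]; [now rewrite f0', Cmod_0|].
      assert (Py := proj1 (Cmod_gt_0 y) Ny).
      assert (Y1 : (Cmod y < d)%R) by (eapply Rlt_le_trans; [exact Hy|eapply Rle_trans; apply Rmin_l]).
      assert (Y2 : (Cmod y < d2)%R).
      { eapply Rlt_le_trans; [exact Hy|]. eapply Rle_trans; [apply Rmin_l|apply Rmin_r]. }
      assert (Y3 := Rlt_le_trans _ _ _ Hy (Rmin_r _ _)).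
      rewrite fN' by exact Ny. rewrite Cmod_mult, Cmod_opp, Cmod_mult, Cmod_inv by exact Ny.
      assert (B1 := HA y (conj Py Y1)). assert (B2 := HA2 y (conj Py Y2)).
      assert (C1 : (Cmod y ^ (S j + k + 2) <= Cmod y ^ 3)%R) by (apply pow_le_pow_lt1; [lra|lia]).
      assert (C2 : (Cmod y ^ (j + S k + 2) <= Cmod y ^ 3)%R) by (apply pow_le_pow_lt1; [lra|lia]).
      assert (B : (Cmod (Q (S j) k (/ y)%C + Q j (S k) (/ y)%C) <= (A + A2) * Cmod y ^ 3)%R).
      { eapply Rle_trans; [apply Cmod_triangle|].
        assert (A * Cmod y ^ (S j + k + 2) <= A * Cmod y ^ 3)%R by (apply Rmult_le_compat_l; lra).
        assert (A2 * Cmod y ^ (j + S k + 2) <= A2 * Cmod y ^ 3)%R by (apply Rmult_le_compat_l; lra).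
        lra. }
      apply Rle_lt_trans with ((A + A2) * Cmod y)%R.
      * apply Rle_trans with (/ Cmod y * / Cmod y * ((A + A2) * Cmod y ^ 3))%R.
        -- apply Rmult_le_compat_l; [|exact B].
           assert (P := Rinv_0_lt_compat _ Py). apply Rmult_le_pos; lra.
        -- right. field. lra.
      * apply Rle_lt_trans with ((A + A2 + 1) * Cmod y)%R; [apply Rmult_le_compat_r; lra|].
        apply Rlt_le_trans with ((A + A2 + 1) * (eps / (A + A2 + 1)))%R; [apply Rmult_lt_compat_l; lra|].
        right; field; lra.
  - assert (Dx' := disc_inv_De x Hx N). split.
    + rewrite fN' by exact N. rewrite <- (proj2 Hb j k (/ x) Dx').
      apply (is_C_derive_ext_loc (fun y => Q j k (/ y)) _ x _ (Cmod x) (proj1 (Cmod_gt_0 x) N)).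
      * intros y Hy. symmetry. apply fN. now apply (near x).
      * apply (is_C_derive_comp (Q j k) Cinv); [|now apply is_C_derive_Cinv].
        apply C_derive_correct; [exact 0|]. now apply HQ.
    + apply (continuous_ext_loc (T := C_UniformSpace) (U := C_UniformSpace) f'
        (fun x => - (/ x * / x) * (Q (S j) k (/ x) + Q j (S k) (/ x))) x).
      * apply locally_C. exists (Cmod x). split; [now apply Cmod_gt_0|].
        intros y Hy. symmetry. apply fN'. now apply (near x).
      * assert (CQ : forall j k, continuous (fun x => Q j k (/ x)) x).
        { intros j' k'. apply (continuous_comp Cinv (Q j' k')); [now apply continuous_Cinv_id|].
          eapply is_C_derive_continuous. apply C_derive_correct; [exact 0|]. now apply HQ. }
        apply continuous_Cmult; [|apply continuous_Cplus; apply CQ].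
        apply continuous_Copp, continuous_Cmult; now apply continuous_Cinv_id. }
destruct (disc_dser f f' HC) as [c [_ [Hc _]]].
exists c. intros z Hz. assert (N := De_neq_0 z Hz).
assert (K := Hc (/ z) (De_inv_disc z Hz)). rewrite fN, Cinv_involutive in K; auto using Cinv_neq_0.
Qed.

(** The exponent is one below the decay rate in (a). The limit 0 therefore removes the coefficient
    of index [j + k + 1] along with the lower ones. *)
Lemma cond_a_lim (Q : nat -> nat -> C -> C) (j k : nat) : cond_a Q ->
  filterlim (fun z => z ^ (j + k + 1) * Q j k z) C_infty (locally (T := C_UniformSpace) (RtoC 0)).
Proof.
intros Ha. destruct (cond_a_inv Q j k Ha) as [A [d [PA [Hd HA]]]].
apply C_infty_inv. intros eps He. exists (Rmin d (eps / (A + 1))). split.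
{ apply Rmin_pos; [lra|]. apply Rdiv_lt_0_compat; lra. }
intros x [Hx0 Hx]. assert (N : x <> 0) by now apply Cmod_gt_0.
assert (X1 := Rlt_le_trans _ _ _ Hx (Rmin_l _ _)). assert (X2 := Rlt_le_trans _ _ _ Hx (Rmin_r _ _)).
replace ((/ x) ^ (j + k + 1) * Q j k (/ x) - 0) with ((/ x) ^ (j + k + 1) * Q j k (/ x)) by ring.
rewrite Cmod_mult, Cmod_pow, Cmod_inv by exact N.
apply Rle_lt_trans with ((/ Cmod x) ^ (j + k + 1) * (A * Cmod x ^ (j + k + 2)))%R.
- apply Rmult_le_compat_l; [apply pow_le, Rlt_le, Rinv_0_lt_compat; lra|]. now apply HA.
- replace (j + k + 2)%nat with (S (j + k + 1)) by lia. rewrite pow_inv, <- tech_pow_Rmult.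
  assert (P : (0 < Cmod x ^ (j + k + 1))%R) by now apply pow_lt.
  replace (/ Cmod x ^ (j + k + 1) * (A * (Cmod x * Cmod x ^ (j + k + 1))))%R with (A * Cmod x)%R by (field; lra).
  apply Rle_lt_trans with ((A + 1) * Cmod x)%R; [apply Rmult_le_compat_r; lra|].
  apply Rlt_le_trans with ((A + 1) * (eps / (A + 1)))%R; [apply Rmult_lt_compat_l; lra|].
  right; field; lra.
Qed.

Lemma represents_of_conds (Q : nat -> nat -> C -> C) :
  (forall j k, holomorphic_De (Q j k)) -> cond_a Q -> cond_b Q -> exists q, represents Q q.
Proof.
intros HQ Ha Hb.
set (ch := fun j k => constructive_indefinite_description _ (jets_expansion Q j k HQ Ha Hb)).
exists (fun j k => proj1_sig (ch j k)). intros j k. destruct (ch j k) as [c Hc]. simpl.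
split; [exact Hc|].
assert (K := scaled_series_lim_inv (fun z => z ^ (j + k + 1) * Q j k z) c (j + k + 1) 0
  (fun z Hz => is_Cseries_ext _ _ _ (fun s => Cmult_assoc _ _ _) (is_Cseries_scal (z ^ (j + k + 1)) _ _ (Hc z Hz)))
  (cond_a_lim Q j k Ha)).
destruct K as [K1 K2]. intros p Hp. destruct (Nat.eq_dec p (j + k + 1)) as [->|N]; [exact K2|].
apply K1. lia.
Qed.

(** The series [a] is [gamma] with a zero border. Both the [Q_jk] and the jets of [a] satisfy the
    recursion from (b), and (d) makes enough of their differences agree for [recursion_zero]. *)
Theorem has_jets_of_conds (Q : nat -> nat -> C -> C) :
  (forall j k, holomorphic_De (Q j k)) -> cond_a Q -> cond_b Q -> cond_d Q ->
  exists a, dgrowth a /\ bordered_zero a /\ (forall m n, a m n = a n m) /\ has_jets Q a.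
Proof.
intros HQ Ha Hb [gam [Hlim Hgr]].
destruct (represents_of_conds Q HQ Ha Hb) as [q Hq].
set (a := fun m n => match m, n with 0%nat, _ => RtoC 0 | _, 0%nat => RtoC 0 | _, _ => gam m n end).
assert (Ba : bordered_zero a) by (split; [intros [|m]|]; reflexivity).
assert (Ea : forall m n, (1 <= m)%nat -> (1 <= n)%nat -> a m n = gam m n).
{ intros [|m] [|n] Hm Hn; (reflexivity || lia). }
assert (Ga : dgrowth a).
{ intros r Hr. assert (P : (0 < / r - 1)%R).
  { assert (H := Rinv_lt_contravar r 1 ltac:(lra) ltac:(lra)). rewrite Rinv_1 in H. lra. }
  destruct (Hgr _ P) as [A HA]. exists (Rmax 0 A). intros m n.
  assert (Z : (Cmod 0 * r ^ (m + n) <= Rmax 0 A)%R) by (rewrite Cmod_0, Rmult_0_l; apply Rmax_l).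
  destruct m as [|m]; [exact Z|]. destruct n as [|n]; [exact Z|].
  eapply Rle_trans; [|apply Rmax_r].
  assert (K := HA (S m) (S n) ltac:(lia) ltac:(lia)).
  replace (1 + (/ r - 1))%R with (/ r)%R in K by ring. rewrite pow_inv in K.
  assert (Pr : (0 < r ^ (S m + S n))%R) by (apply pow_lt; lra).
  apply Rmult_le_reg_r with (/ r ^ (S m + S n))%R; [now apply Rinv_0_lt_compat|].
  rewrite (Rmult_assoc (Cmod _)), Rinv_r by lra. simpl a. lra. }
(* The limits in (d) read on coefficients: the differences vanish below the antidiagonal [m + n] and
   equal [a m n] on it, at every (j, k). *)
assert (Hg : forall m n j k, (1 <= m)%nat -> (1 <= n)%nat ->
  (forall s, (s < m + n)%nat -> gdiff (m - 1) (n - 1) (scoef q s) j k = 0) /\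
  gdiff (m - 1) (n - 1) (scoef q (m + n)) j k = a m n).
{ intros m n j k Hm Hn. rewrite Ea by assumption.
  apply (scaled_series_lim_inv (diff_expr Q m n j k) (fun s => gdiff (m - 1) (n - 1) (scoef q s) j k)).
  - intros z Hz. now apply represents_diff_expr.
  - now apply Hlim. }
set (Q' := fun j k z => lser (jet a j k) z z).
assert (HQ' : has_jets Q' a) by (intros j k z Hz; reflexivity).
set (q' := fun j k => diagc (jet a j k)).
assert (Hq' : represents Q' q') by now apply has_jets_represents.
assert (R1 := represents_recursion Q q Hq (fun j k z Hz => eq_ind _ (fun l => is_C_derive (Q j k) z l)
   (C_derive_correct _ z 0 (HQ j k z Hz)) _ (proj2 Hb j k z Hz))).
assert (R2 := represents_recursion Q' q' Hq' (fun j k z Hz => jet_derive_diag a j k z Ga Hz)).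
(* If [p + p' = s - 2], then [m = p + 1] and [n = p' + 1] have sum [s], so both sides have the same
   difference [a m n] of orders (p, p'). Thus the hypothesis of [recursion_zero] holds with
   [D = s - 2]. *)
assert (ES : forall s j k, scoef q s j k - scoef q' s j k = 0).
{ intros s.
  assert (HB : forall m n j k, (1 <= m)%nat -> (1 <= n)%nat -> (s <= m + n)%nat ->
    gdiff (m - 1) (n - 1) (fun j k => - (1) * scoef q' s j k + scoef q s j k) j k = 0).
  { intros m n j k Hm Hn Hs. rewrite gdiff_lin.
    rewrite (gdiff_ext (m - 1) (n - 1) (scoef q' s) (acoef a s)) by (intros; apply scoef_jet).
    destruct (Nat.eq_dec s (m + n)) as [->|N].
    - rewrite gdiff_acoef_top by assumption. rewrite (proj2 (Hg m n j k Hm Hn)). ring.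
    - rewrite gdiff_acoef_high by (auto; lia). rewrite (proj1 (Hg m n j k Hm Hn)) by lia. ring. }
  intros j k. replace (scoef q s j k - scoef q' s j k) with (- (1) * scoef q' s j k + scoef q s j k) by ring.
  (* For [s <= 2] the case [m = n = 1] suffices, in which no difference is taken. *)
  destruct (Compare_dec.le_lt_dec s 2) as [Hs|Hs].
  - exact (HB 1%nat 1%nat j k ltac:(lia) ltac:(lia) Hs).
  - refine (recursion_zero (fun j k => - (1) * scoef q' s j k + scoef q s j k) s _ (s - 2) _ _ j k).
    + intros j' k'.
      transitivity (- (1) * (RtoC (INR (j' + k' + s)) * scoef q' s j' k') + RtoC (INR (j' + k' + s)) * scoef q s j' k'); [ring|].
      rewrite R1, R2. ring.
    + lia.
    + intros p p' j' k' Hp. assert (K := HB (S p) (S p') j' k' ltac:(lia) ltac:(lia) ltac:(lia)).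
      replace (S p - 1)%nat with p in K by lia. replace (S p' - 1)%nat with p' in K by lia. exact K. }
assert (Eq : forall j k p, q j k p = q' j k p).
{ intros j k p. destruct (Compare_dec.le_lt_dec (j + k) p) as [H|H].
  - assert (K := ES (p - (j + k))%nat j k). unfold scoef in K.
    replace (j + k + (p - (j + k)))%nat with p in K by lia.
    set (c := (-1) ^ (j + k) / (RtoC (INR (fact j)) * RtoC (INR (fact k)))) in K.
    assert (Nc : c <> 0).
    { unfold c. intros E.
      assert (F := Cmult_neq_0 _ _ (RtoC_fact_neq_0 j) (RtoC_fact_neq_0 k)).
      assert (E2 : (-1) ^ (j + k) = 0).
      { replace ((-1) ^ (j + k)) with ((-1) ^ (j + k) / (RtoC (INR (fact j)) * RtoC (INR (fact k))) * (RtoC (INR (fact j)) * RtoC (INR (fact k)))).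
        - rewrite E. ring.
        - field. split; apply RtoC_fact_neq_0. }
      assert (X := Cpow_m1_sq (j + k)). rewrite E2, Cmult_0_l in X. apply RtoC_inj in X. lra. }
    apply (Cmult_cancel_l c); [exact Nc|].
    replace (c * q j k p) with (c * q j k p - c * q' j k p + c * q' j k p) by ring. rewrite K. ring.
  - rewrite (proj2 (Hq j k)), (proj2 (Hq' j k)) by lia. reflexivity. }
assert (HJ : has_jets Q a).
{ intros j k z Hz. apply (is_Cseries_unique _ _ _ (proj1 (Hq j k) z Hz)).
  eapply is_Cseries_ext; [|apply (proj1 (Hq' j k) z Hz)]. intros p. cbv beta. now rewrite Eq. }
exists a. split; [exact Ga|split; [exact Ba|split; [|exact HJ]]].
(* As [Q] is symmetric, it also has the jets of the transpose of [a]; the limits in (d) recover the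
   coefficients from the jets, so the two arrays coincide. *)
assert (HJ' : has_jets Q (fun m n => a n m)).
{ intros j k z Hz. rewrite (proj1 Hb j k z Hz), HJ by exact Hz. unfold lser. rewrite dser_transpose.
  apply dser_ext. intros m n. now rewrite jet_transpose. }
assert (Ba' : bordered_zero (fun m n => a n m)) by (split; [intros; apply Ba|intros; apply Ba]).
intros [|m] [|n]; [reflexivity|reflexivity|reflexivity|].
apply (C_infty_unique (diff_expr Q (S m) (S n) 0 0)).
- apply has_jets_lim; auto; lia.
- apply (has_jets_lim Q (fun m n => a n m)); auto using dgrowth_transpose; lia.
Qed.

(** * The jet wave and Riccati equations *)

Lemma binom_0 (n : nat) : binom n 0 = 1.
Proof.
unfold binom, Binomial.C. rewrite Nat.sub_0_r. simpl.
f_equal. field. apply INR_fact_neq_0.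
Qed.

Lemma binom_diag (n : nat) : binom n n = 1.
Proof.
unfold binom, Binomial.C. rewrite Nat.sub_diag. simpl.
f_equal. field. apply INR_fact_neq_0.
Qed.

Lemma binom_pascal (n i : nat) : (i < n)%nat -> binom (S n) (S i) = binom n i + binom n (S i).
Proof. intros H. unfold binom. rewrite <- RtoC_plus, Binomial.pascal by exact H. reflexivity. Qed.

Lemma csum_binom (n : nat) (X : nat -> C) :
  csum (fun l => binom n l * X (S l)) n + csum (fun l => binom n l * X l) n
  = csum (fun l => binom (S n) l * X l) (S n).
Proof.
destruct n as [|m].
- rewrite csum_S, !csum_0, !binom_0, binom_diag. ring.
- rewrite (csum_first (fun l => binom (S (S m)) l * X l)), (csum_S _ m), (csum_first _ m), (csum_S _ m).
  rewrite !binom_0, !binom_diag.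
  rewrite (csum_ext (fun k => binom (S (S m)) (S k) * X (S k))
    (fun k => binom (S m) k * X (S k) + binom (S m) (S k) * X (S k))).
  2:{ intros k Hk. rewrite binom_pascal by lia. ring. }
  rewrite csum_plus. ring.
Qed.

Definition leib (f g : nat -> C -> C) (n : nat) (z : C) : C :=
  csum (fun l => binom n l * (f l z * g (n - l)%nat z)) n.

Lemma is_C_derive_csum (u : nat -> C -> C) (u' : nat -> C) (z : C) (n : nat) :
  (forall l, (l <= n)%nat -> is_C_derive (u l) z (u' l)) ->
  is_C_derive (fun z => csum (fun l => u l z) n) z (csum u' n).
Proof.
induction n as [|n IH]; intros H.
- apply (is_C_derive_ext_loc (u 0%nat) _ _ _ 1%R Rlt_0_1); [intros; now rewrite csum_0|].
  rewrite csum_0. now apply H.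
- apply (is_C_derive_ext_loc (fun z => csum (fun l => u l z) n + u (S n) z) _ _ _ 1%R Rlt_0_1).
  + intros y _. now rewrite csum_S.
  + rewrite csum_S. apply is_C_derive_plus; [|now apply H]. apply IH. intros; apply H; lia.
Qed.

Lemma tower_leib (D : C -> Prop) (f g : nat -> C -> C) : tower D f -> tower D g -> tower D (leib f g).
Proof.
intros Hf Hg n z Hz. unfold leib. eapply is_C_derive_eq.
- apply (is_C_derive_csum (fun l z => binom n l * (f l z * g (n - l)%nat z))
    (fun l => binom n l * (f (S l) z * g (n - l)%nat z + f l z * g (S (n - l)) z))).
  intros l _. apply is_C_derive_scal, is_C_derive_mult; auto.
- rewrite <- (csum_binom n (fun l => f l z * g (S n - l)%nat z)), <- csum_plus.
  apply csum_ext. intros l Hl. replace (S n - S l)%nat with (n - l)%nat by lia.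
  replace (S n - l)%nat with (S (n - l)) by lia. ring.
Qed.

Lemma tower_plus (D : C -> Prop) (f g : nat -> C -> C) : tower D f -> tower D g ->
  tower D (fun n z => f n z + g n z).
Proof. intros Hf Hg n z Hz. apply is_C_derive_plus; auto. Qed.

Lemma tower_minus (D : C -> Prop) (f g : nat -> C -> C) : tower D f -> tower D g ->
  tower D (fun n z => f n z - g n z).
Proof. intros Hf Hg n z Hz. apply is_C_derive_minus; auto. Qed.

Lemma tower_scal (D : C -> Prop) (c : C) (f : nat -> C -> C) : tower D f -> tower D (fun n z => c * f n z).
Proof. intros Hf n z Hz. apply is_C_derive_scal; auto. Qed.

Lemma tower_zero (D : C -> Prop) : tower D (fun _ _ => 0).
Proof. intros n z _. apply is_C_derive_const. Qed.

Lemma tower_const (D : C -> Prop) (c : C) : tower D (fun n _ => match n with 0%nat => c | _ => 0 end).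
Proof. intros n z _. destruct n; apply is_C_derive_const. Qed.

(** Leibniz rule for [(z - w) A]. At [n = 0] the value at [pred 0] is a default that is multiplied
    by 0. *)
Lemma tower_mul_linear (D : C -> Prop) (w : C) (A : nat -> C -> C) : tower D A ->
  tower D (fun n z => (z - w) * A n z + RtoC (INR n) * A (pred n) z).
Proof.
intros HA n z Hz. eapply is_C_derive_eq.
- apply is_C_derive_plus.
  + apply (is_C_derive_mult (fun z => z - w)); [|now apply HA].
    apply is_C_derive_minus; [apply is_C_derive_id|apply is_C_derive_const].
  + apply is_C_derive_scal, (HA (pred n)), Hz.
- cbv beta. rewrite S_INR, RtoC_plus. destruct n as [|n]; simpl pred.
  + change (INR 0) with 0%R. ring.
  + ring.
Qed.

Lemma tower_zero_ball (G : nat -> C -> C) (w : C) : De w -> tower De G -> (forall n, G n w = 0) ->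
  forall z, (Cmod (z - w) < Cmod w - 1)%R -> G 0%nat z = 0.
Proof.
intros Hw HG H0 z Hz. unfold De in Hw. set (rho := (Cmod w - 1)%R) in *.
assert (Hr : (0 < rho)%R) by (unfold rho; lra).
assert (Er : Cmod (RtoC rho) = rho) by (rewrite Cmod_R; apply Rabs_pos_eq; lra).
assert (Nr : RtoC rho <> 0) by (apply Cmod_gt_0; lra).
assert (T : tower disc (fun n u => RtoC rho ^ n * G n (w + RtoC rho * u))).
{ intros n u Hu. assert (Du : De (w + RtoC rho * u)).
  { unfold De. assert (K := Cmod_triangle_rev w (- (RtoC rho * u))). rewrite Cmod_opp, Cmod_mult, Er in K.
    replace (w - - (RtoC rho * u)) with (w + RtoC rho * u) in K by ring.
    assert (rho * Cmod u < rho * 1)%R by (apply Rmult_lt_compat_l; [lra|exact Hu]). unfold rho in *. lra. }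
  eapply is_C_derive_eq.
  - apply is_C_derive_scal. apply (is_C_derive_comp (G n) (fun u => w + RtoC rho * u)); [now apply HG|].
    apply is_C_derive_plus; [apply is_C_derive_const|apply is_C_derive_scal, is_C_derive_id].
  - rewrite Cpow_S. ring. }
assert (E := tower_ext_0 _ _ T (tower_zero disc)
  (fun n => ltac:(cbv beta; replace (w + RtoC rho * 0) with w by ring; rewrite H0; ring))).
assert (Hu : disc ((z - w) / RtoC rho)).
{ unfold disc. rewrite Cmod_div, Er by exact Nr. apply Rmult_lt_reg_r with rho; [exact Hr|].
  unfold Rdiv. rewrite Rmult_assoc, Rinv_l; lra. }
specialize (E _ Hu). cbv beta in E. simpl Cpow in E. rewrite Cmult_1_l in E.
replace (w + RtoC rho * ((z - w) / RtoC rho)) with z in E by (field; exact Nr). exact E.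
Qed.

(** Vanishing to infinite order at [w] controls only the largest disc about [w] in De. Multiplied by
    [x y], where [x y (z - w) = y - x] no longer grows at infinity, the function is smooth on the
    whole disc [|x| < 1], and the identity theorem carries the zero over to all of De. *)
Lemma tower_zero_De (G : nat -> C -> C) (F : C -> C -> C) (w : C) : De w -> tower De G ->
  (forall n, G n w = 0) -> smooth F ->
  (forall x : C, x <> 0 -> disc x -> F x (/ w) = x * / w * G 0%nat (/ x)) ->
  forall z, De z -> G 0%nat z = 0.
Proof.
intros Hw HG H0 HF HFG.
assert (Nw := De_neq_0 w Hw). assert (Dy := De_inv_disc w Hw). assert (Ny := Cinv_neq_0 w Nw).
assert (HB := tower_zero_ball G w Hw HG H0).
assert (C1 : C1_disc (fun x => F x (/ w)) (fun x => Px F x (/ w))).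
{ intros x Hx. split; [apply (smooth_partials F HF x (/ w) Hx Dy)|].
  exact (is_C_derive_continuous (fun x => Px F x (/ w)) x _
    (proj1 (smooth_partials (Px F) (smooth_Px F HF) x (/ w) Hx Dy))). }
assert (NZ : exists d : R, (0 < d)%R /\ forall x, (Cmod (x - / w) < d)%R -> F x (/ w) = 0).
{ assert (Cw := continuous_Cinv_id (/ w) Ny). rewrite continuous_Cmod in Cw.
  assert (Pr : (0 < Cmod w - 1)%R) by (unfold De in Hw; lra).
  destruct (proj1 (locally_C _ _) (Cw _ Pr)) as [d [Hd HH]].
  destruct (disc_nbhd (/ w) Dy) as [d' [Hd' HH']].
  exists (Rmin (Rmin d d') (Cmod (/ w))). split.
  { repeat apply Rmin_pos; auto. now apply Cmod_gt_0. }
  intros x Hx.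
  assert (X1 := Rlt_le_trans _ _ _ Hx (Rle_trans _ _ _ (Rmin_l _ _) (Rmin_l _ _))).
  assert (X2 := Rlt_le_trans _ _ _ Hx (Rle_trans _ _ _ (Rmin_l _ _) (Rmin_r _ _))).
  assert (X3 := Rlt_le_trans _ _ _ Hx (Rmin_r _ _)).
  rewrite HFG; auto.
  - rewrite HB; [ring|]. assert (K := HH x X1). now rewrite Cinv_involutive in K.
  - intros ->. rewrite Cmod_minus_sym in X3. replace (/ w - 0) with (/ w) in X3 by ring. lra. }
destruct NZ as [d [Hd HZ]].
assert (ID := C1_disc_identity _ _ (/ w) d C1 Dy Hd HZ).
intros z Hz. assert (Nz := De_neq_0 z Hz). assert (Nx := Cinv_neq_0 z Nz).
assert (K := HFG (/ z) Nx (De_inv_disc z Hz)). rewrite Cinv_involutive in K by exact Nz.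
cbv beta in ID. rewrite ID in K by now apply De_inv_disc.
apply (Cmult_cancel_l (/ z * / w)); [now apply Cmult_neq_0|]. rewrite <- K. ring.
Qed.

Section Equations.

Variable a : nat -> nat -> C.
Hypothesis Ga : dgrowth a.
Hypothesis Sa : forall m n, a m n = a n m.

Let J (j k : nat) (z w : C) : C := lser (jet a j k) z w.

Lemma jet_diag_sym (j k : nat) (z : C) : J j k z z = J k j z z.
Proof.
unfold J, lser. rewrite dser_transpose. apply dser_ext.
intros m n. rewrite <- jet_transpose. unfold jet. apply iter_dz_ext, iter_dw_ext. intros; apply Sa.
Qed.

(** The mixed derivative of [(z - w) exp Q], divided by [exp Q]. *)
Definition wave (z w : C) : C :=
  (z - w) * (J 1 1 z w + J 0 1 z w * J 1 0 z w) - J 1 0 z w + J 0 1 z w.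

(** With [h = (z - w) exp Q], this is [d^2 h / dw^2 - 2 J01(w, w) dh/dw] divided by [exp Q]; by
    symmetry [2 J01(w, w)] is the derivative of [Q(w, w)]. *)
Definition riccati (z w : C) : C :=
  (z - w) * (J 0 2 z w + J 0 1 z w * J 0 1 z w - 2 * J 0 1 w w * J 0 1 z w)
  - 2 * (J 0 1 z w - J 0 1 w w).

Lemma tower_J (k : nat) (w : C) : De w -> tower De (fun j z => J j k z w).
Proof. intros Hw j z Hz. now apply jet_derive_z. Qed.

Lemma tower_J_S (k : nat) (w : C) : De w -> tower De (fun j z => J (S j) k z w).
Proof. intros Hw j z Hz. now apply jet_derive_z. Qed.

Definition waveA (w : C) (n : nat) (z : C) : C :=
  J (S n) 1 z w + leib (fun l z => J l 1 z w) (fun l z => J (S l) 0 z w) n z.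

Definition waveT (w : C) (n : nat) (z : C) : C :=
  ((z - w) * waveA w n z + RtoC (INR n) * waveA w (pred n) z) - J (S n) 0 z w + J n 1 z w.

Lemma tower_waveT (w : C) : De w -> tower De (waveT w).
Proof.
intros Hw. unfold waveT.
apply (tower_plus De (fun n z => ((z - w) * waveA w n z + RtoC (INR n) * waveA w (pred n) z) - J (S n) 0 z w));
  [|now apply tower_J].
apply (tower_minus De (fun n z => (z - w) * waveA w n z + RtoC (INR n) * waveA w (pred n) z));
  [|now apply tower_J_S].
apply tower_mul_linear. unfold waveA.
apply (tower_plus De (fun n z => J (S n) 1 z w)); [now apply tower_J_S|].
apply tower_leib; [now apply tower_J|now apply tower_J_S].
Qed.

Lemma waveT_0 (w z : C) : waveT w 0 z = wave z w.
Proof.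
unfold waveT, wave, waveA, leib. rewrite csum_0, binom_0. simpl pred. simpl Nat.sub.
change (INR 0) with 0%R. ring.
Qed.

(** At [z = w] the factor [z - w] disappears and only [n] times the derivative of order [n - 1] of
    its cofactor remains. Hence order [k + 1] gives equation [k] of (c), while order 0 vanishes by
    symmetry. *)
Lemma waveT_S_diag (w : C) (k : nat) :
  waveT w (S k) w = - (J (k + 2) 0 w w - RtoC (INR (k + 2)) * J (k + 1) 1 w w
    - RtoC (INR (k + 1)) * csum (fun l => binom k l * J l 1 w w * J (k + 1 - l) 0 w w) k).
Proof.
unfold waveT, waveA. simpl pred.
replace (k + 2)%nat with (S (S k)) by lia. replace (k + 1)%nat with (S k) by lia.
replace (csum (fun l => binom k l * J l 1 w w * J (S k - l) 0 w w) k)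
  with (leib (fun l z => J l 1 z w) (fun l z => J (S l) 0 z w) k w).
- rewrite (S_INR (S k)), RtoC_plus. ring.
- apply csum_ext. intros l Hl. replace (S k - l)%nat with (S (k - l)) by lia. ring.
Qed.

Lemma smooth_jet (j k : nat) : smooth (dser (jet a j k)).
Proof. intros n. now apply diffn_dser, dgrowth_jet. Qed.

Lemma wave_iff_cond_c (Q : nat -> nat -> C -> C) : has_jets Q a ->
  (cond_c Q <-> forall z w, De z -> De w -> wave z w = 0).
Proof.
intros HQ. split.
- intros Hc z w Hz Hw. rewrite <- waveT_0.
  refine (tower_zero_De (waveT w) (fun x y => (y - x) * (dser (jet a 1 1) x y + dser (jet a 0 1) x y * dser (jet a 1 0) x y)
    - x * y * (dser (jet a 1 0) x y - dser (jet a 0 1) x y)) w Hw (tower_waveT w Hw) _ _ _ z Hz).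
  + intros [|k].
    * rewrite waveT_0. unfold wave. rewrite (jet_diag_sym 1 0). ring.
    * rewrite waveT_S_diag. assert (K := Hc k w Hw).
      rewrite !HQ in K by exact Hw. fold (J (k + 2) 0 w w) (J (k + 1) 1 w w) in K.
      change (sum_n (G := C_AbelianGroup) (fun l => binom k l * Q l 1%nat w * Q (k + 1 - l)%nat 0%nat w) k)
        with (csum (fun l => binom k l * Q l 1%nat w * Q (k + 1 - l)%nat 0%nat w) k) in K.
      rewrite (csum_ext _ (fun l => binom k l * J l 1 w w * J (k + 1 - l) 0 w w)) in K
        by (intros; unfold J; now rewrite !HQ).
      rewrite K. ring.
  + intros n. apply diffn_minus; apply diffn_mult.
    * apply diffn_minus; [apply diffn_snd|apply diffn_fst].
    * apply diffn_plus; [|apply diffn_mult]; apply smooth_jet.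
    * apply diffn_mult; [apply diffn_fst|apply diffn_snd].
    * apply diffn_minus; apply smooth_jet.
  + intros x Nx Hx. rewrite waveT_0. unfold wave, J, lser.
    rewrite Cinv_involutive by exact Nx. assert (Nw := De_neq_0 w Hw). field. split; assumption.
- intros H k w Hw.
  assert (K := waveT_S_diag w k).
  rewrite (tower_unique De _ _ De_nbhd (tower_waveT w Hw) (tower_zero De)
    (fun z Hz => eq_trans (waveT_0 w z) (H z w Hz Hw)) (S k) w Hw) in K.
  rewrite !HQ by exact Hw. fold (J (k + 2) 0 w w) (J (k + 1) 1 w w).
  change (sum_n (G := C_AbelianGroup) (fun l => binom k l * Q l 1%nat w * Q (k + 1 - l)%nat 0%nat w) k)
    with (csum (fun l => binom k l * Q l 1%nat w * Q (k + 1 - l)%nat 0%nat w) k).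
  rewrite (csum_ext _ (fun l => binom k l * J l 1 w w * J (k + 1 - l) 0 w w))
    by (intros; unfold J; now rewrite !HQ).
  set (X := J (k + 2) 0 w w - RtoC (INR (k + 2)) * J (k + 1) 1 w w
    - RtoC (INR (k + 1)) * csum (fun l => binom k l * J l 1 w w * J (k + 1 - l) 0 w w) k) in *.
  replace X with (- - X) by ring. rewrite <- K. ring.
Qed.

Definition ricB (w : C) (n : nat) (z : C) : C :=
  J n 2 z w + leib (fun l z => J l 1 z w) (fun l z => J l 1 z w) n z - 2 * J 0 1 w w * J n 1 z w.

Definition ricT (w : C) (n : nat) (z : C) : C :=
  ((z - w) * ricB w n z + RtoC (INR n) * ricB w (pred n) z)
  - 2 * (J n 1 z w - match n with 0%nat => J 0 1 w w | _ => 0 end).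

Lemma tower_ricT (w : C) : De w -> tower De (ricT w).
Proof.
intros Hw. unfold ricT.
apply (tower_minus De (fun n z => (z - w) * ricB w n z + RtoC (INR n) * ricB w (pred n) z)).
- apply tower_mul_linear. unfold ricB.
  apply (tower_minus De (fun n z => J n 2 z w + leib (fun l z => J l 1 z w) (fun l z => J l 1 z w) n z)).
  + apply (tower_plus De (fun n z => J n 2 z w)); [now apply tower_J|].
    apply tower_leib; now apply tower_J.
  + apply (tower_scal De (2 * J 0 1 w w) (fun n z => J n 1 z w)). now apply tower_J.
- apply (tower_scal De 2 (fun n z => J n 1 z w - match n with 0%nat => J 0 1 w w | _ => 0 end)).
  apply (tower_minus De (fun n z => J n 1 z w)); [now apply tower_J|apply tower_const].
Qed.

Lemma ricT_0 (w z : C) : ricT w 0 z = riccati z w.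
Proof.
unfold ricT, riccati, ricB, leib. rewrite csum_0, binom_0. simpl pred. simpl Nat.sub.
change (INR 0) with 0%R. ring.
Qed.

(** The two end terms of the Leibniz sum are split off because they cancel against
    [2 J01(w, w) J_k1]; what remains is the sum in (c'). *)
Lemma sum_n_m_csum (f : nat -> C) (k : nat) :
  csum f (S k) = f 0%nat + sum_n_m (G := C_AbelianGroup) f 1 k + f (S k).
Proof.
rewrite csum_S. f_equal. unfold csum, sum_n.
rewrite (sum_Sn_m (G := C_AbelianGroup) f 0 k) by lia. reflexivity.
Qed.

Definition ric_lhs (Q : nat -> nat -> C -> C) (k : nat) (z : C) : C :=
  match k with
  | 0%nat => C_derive (Q 1%nat 0%nat) z - 3 * Q 1%nat 1%nat z - (Q 1%nat 0%nat z) ^ 2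
  | _ => C_derive (Q k 1%nat) z
     - RtoC (INR (k + 3)) / RtoC (INR (k + 1)) * Q (k + 1)%nat 1%nat z
     + sum_n_m (G := C_AbelianGroup)
         (fun l => binom k l * Q (k - l)%nat 1%nat z * Q l 1%nat z) 1 (k - 1)
  end.

Lemma ric_lhs_cond_c' (Q : nat -> nat -> C -> C) :
  cond_c' Q <-> forall k z, De z -> ric_lhs Q k z = 0.
Proof.
split.
- intros [H0 H1] [|k] z Hz; [now apply H0|]. apply (H1 (S k) z); [lia|exact Hz].
- intros H. split; [intros z Hz; exact (H 0%nat z Hz)|].
  intros [|k] z Hk Hz; [lia|]. exact (H (S k) z Hz).
Qed.

Lemma has_jets_derive (Q : nat -> nat -> C -> C) (j k : nat) (z : C) : has_jets Q a -> De z ->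
  C_derive (Q j k) z = J (S j) k z z + J j (S k) z z.
Proof.
intros HQ Hz. rewrite (proj2 (has_jets_cond_b Q a Ga Sa HQ) j k z Hz).
now rewrite !HQ by exact Hz.
Qed.

(** By (b), [J_k2 = Q_k1' - J_(k+1)1] on the diagonal. With the term [- 2 / (k + 1) J_(k+1)1] this
    produces the coefficient [(k + 3) / (k + 1)], and the 3 when [k = 0]. *)
Lemma ricT_S_diag (Q : nat -> nat -> C -> C) (w : C) (k : nat) : has_jets Q a -> De w ->
  ricT w (S k) w = RtoC (INR (S k)) * ric_lhs Q k w.
Proof.
intros HQ Hw. unfold ricT. simpl pred.
assert (E : RtoC (INR (S k)) * ricB w k w - 2 * J (S k) 1 w w = RtoC (INR (S k)) * ric_lhs Q k w).
{ destruct k as [|k].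
  - unfold ric_lhs, ricB, leib. rewrite csum_0, binom_0, (has_jets_derive Q) by assumption.
    rewrite !HQ by exact Hw. fold (J 1 1 w w) (J 1 0 w w). simpl Nat.sub.
    rewrite (jet_diag_sym 1 0), (jet_diag_sym 2 0).
    change (INR 1) with 1%R. replace (RtoC 3) with (RtoC 2 + 1) by (apply injective_projections; simpl; ring).
    replace (RtoC 2) with (1 + 1) by (apply injective_projections; simpl; ring). simpl. ring.
  - unfold ric_lhs, ricB, leib. rewrite sum_n_m_csum, binom_0, binom_diag, (has_jets_derive Q) by assumption.
    replace (S k - 1)%nat with k by lia. rewrite Nat.sub_0_r, Nat.sub_diag.
    replace (S k + 1)%nat with (S (S k)) by lia. rewrite !HQ by exact Hw. fold (J (S (S k)) 1 w w).
    replace (sum_n_m (G := C_AbelianGroup) (fun l => binom (S k) l * Q (S k - l)%nat 1%nat w * Q l 1%nat w) 1 k)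
      with (sum_n_m (G := C_AbelianGroup) (fun l => binom (S k) l * (J l 1 w w * J (S k - l) 1 w w)) 1 k).
    2:{ assert (EX : forall l, binom (S k) l * (J l 1 w w * J (S k - l) 1 w w)
          = binom (S k) l * Q (S k - l)%nat 1%nat w * Q l 1%nat w).
        { intros l. rewrite !HQ by exact Hw. unfold J. ring. }
        exact (sum_n_m_ext (G := C_AbelianGroup) _ _ 1 k EX). }
    set (X := sum_n_m _ 1 k).
    assert (N := RtoC_INR_S_neq_0 (S k)).
    replace (RtoC (INR (S k + 3))) with (RtoC (INR (S (S k))) + 2).
    2:{ rewrite <- RtoC_plus. f_equal. rewrite !S_INR, plus_INR, S_INR. simpl. ring. }
    field. exact N. }
rewrite <- E. ring.
Qed.

Lemma riccati_iff_cond_c' (Q : nat -> nat -> C -> C) : has_jets Q a ->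
  (cond_c' Q <-> forall z w, De z -> De w -> riccati z w = 0).
Proof.
intros HQ. rewrite ric_lhs_cond_c'. split.
- intros Hc z w Hz Hw. rewrite <- ricT_0.
  refine (tower_zero_De (ricT w) (fun x y => (y - x) * (dser (jet a 0 2) x y + dser (jet a 0 1) x y * dser (jet a 0 1) x y
      - 2 * J 0 1 w w * dser (jet a 0 1) x y)
    - x * y * (2 * (dser (jet a 0 1) x y - J 0 1 w w))) w Hw (tower_ricT w Hw) _ _ _ z Hz).
  + intros [|k].
    * rewrite ricT_0. unfold riccati. ring.
    * rewrite (ricT_S_diag Q) by assumption. rewrite Hc by exact Hw. ring.
  + intros n. apply diffn_minus; apply diffn_mult.
    * apply diffn_minus; [apply diffn_snd|apply diffn_fst].
    * apply diffn_minus.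
      -- apply diffn_plus; [|apply diffn_mult]; apply smooth_jet.
      -- apply diffn_mult; [apply diffn_const|apply smooth_jet].
    * apply diffn_mult; [apply diffn_fst|apply diffn_snd].
    * apply diffn_mult; [apply diffn_const|].
      apply diffn_minus; [apply smooth_jet|apply diffn_const].
  + intros x Nx Hx. rewrite ricT_0. unfold riccati. set (c := J 0 1 w w). unfold J, lser.
    rewrite Cinv_involutive by exact Nx. assert (Nw := De_neq_0 w Hw). field. split; assumption.
- intros H k w Hw.
  assert (K := ricT_S_diag Q w k HQ Hw).
  rewrite (tower_unique De _ _ De_nbhd (tower_ricT w Hw) (tower_zero De)
    (fun z Hz => eq_trans (ricT_0 w z) (H z w Hz Hw)) (S k) w Hw) in K.
  apply (Cmult_cancel_l (RtoC (INR (S k)))); [apply RtoC_INR_S_neq_0|]. rewrite <- K. ring.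
Qed.

End Equations.

(** * From the equations to the univalent function *)

(** Division by [x] when row 0 vanishes, and evaluation at [x = 0] of the quotient picks out row 1;
    [vsh] divides by [y]. *)
Definition ush (b : nat -> nat -> C) (m n : nat) : C := b (S m) n.
Definition vsh (b : nat -> nat -> C) (m n : nat) : C := b m (S n).

Lemma dgrowth_ush (b : nat -> nat -> C) : dgrowth b -> dgrowth (ush b).
Proof.
intros H r Hr. destruct (H r Hr) as [A HA]. exists (A / r)%R. intros m n. unfold ush.
specialize (HA (S m) n). apply Rmult_le_reg_r with r; [lra|].
unfold Rdiv. rewrite (Rmult_assoc A), Rinv_l, Rmult_1_r by lra.
simpl (S m + n)%nat in HA. rewrite <- tech_pow_Rmult in HA. lra.
Qed.

Lemma dgrowth_vsh (b : nat -> nat -> C) : dgrowth b -> dgrowth (vsh b).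
Proof. intros H. exact (dgrowth_transpose _ (dgrowth_ush _ (dgrowth_transpose _ H))). Qed.

Lemma dser_ush (b : nat -> nat -> C) (x y : C) : dgrowth b -> (forall n, b 0%nat n = 0) ->
  disc x -> disc y -> dser b x y = x * dser (ush b) x y.
Proof.
intros Hb H0 Hx Hy. rewrite <- dser_shx by (auto using dgrowth_ush).
apply dser_ext. intros [|m] n; [now rewrite H0|reflexivity].
Qed.

Lemma dser_vsh (b : nat -> nat -> C) (x y : C) : dgrowth b -> (forall m, b m 0%nat = 0) ->
  disc x -> disc y -> dser b x y = y * dser (vsh b) x y.
Proof.
intros Hb H0 Hx Hy. rewrite dser_transpose, (dser_transpose (vsh b)).
exact (dser_ush (fun m n => b n m) y x (dgrowth_transpose _ Hb) H0 Hy Hx).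
Qed.

Lemma lser_lim_w (b : nat -> nat -> C) (z : C) : dgrowth b -> De z ->
  filterlim (fun w => lser b z w) C_infty (locally (T := C_UniformSpace) (dser b (/ z) 0)).
Proof.
intros Hb Hz. apply (filterlim_C_infty_continuous _ (fun y => dser b (/ z) y)).
- apply (continuous_dser_y b (/ z) 0 Hb (De_inv_disc z Hz) disc_0).
- intros y Ny Hy. unfold lser. now rewrite Cinv_involutive.
Qed.

Lemma lser_lim_z (b : nat -> nat -> C) (w : C) : dgrowth b -> De w ->
  filterlim (fun z => lser b z w) C_infty (locally (T := C_UniformSpace) (dser b 0 (/ w))).
Proof.
intros Hb Hw. apply (filterlim_C_infty_continuous _ (fun x => dser b x (/ w))).
- apply (continuous_dser_x b 0 (/ w) Hb disc_0 (De_inv_disc w Hw)).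
- intros x Nx Hx. unfold lser. now rewrite Cinv_involutive.
Qed.

Lemma is_linear_pair (A B : C) :
  is_linear (K := C_AbsRing) (U := prod_NormedModule C_AbsRing C_NormedModule C_NormedModule)
    (V := C_NormedModule) (fun p => fst p * A + snd p * B).
Proof.
constructor.
- intros [x y] [x' y']. change ((x + x') * A + (y + y') * B = x * A + y * B + (x' * A + y' * B)). ring.
- intros k [x y]. change (k * x * A + k * y * B = k * (x * A + y * B)). ring.
- exists (Cmod A + Cmod B + 1)%R. assert (PA := Cmod_ge_0 A). assert (PB := Cmod_ge_0 B).
  split; [lra|]. intros [x y].
  change (Cmod (x * A + y * B) <= (Cmod A + Cmod B + 1) * sqrt (Cmod x ^ 2 + Cmod y ^ 2))%R.
  assert (Px := Cmod_ge_0 x). assert (Py := Cmod_ge_0 y).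
  set (s := sqrt (Cmod x ^ 2 + Cmod y ^ 2)).
  assert (Sx : (Cmod x <= s)%R).
  { unfold s. rewrite <- (sqrt_pow2 (Cmod x)) at 1 by exact Px. apply sqrt_le_1_alt. nra. }
  assert (Sy : (Cmod y <= s)%R).
  { unfold s. rewrite <- (sqrt_pow2 (Cmod y)) at 1 by exact Py. apply sqrt_le_1_alt. nra. }
  eapply Rle_trans; [apply Cmod_triangle|]. rewrite !Cmod_mult.
  assert (Cmod x * Cmod A <= s * Cmod A)%R by (apply Rmult_le_compat_r; lra).
  assert (Cmod y * Cmod B <= s * Cmod B)%R by (apply Rmult_le_compat_r; lra).
  lra.
Qed.

Lemma ex_filterdiff_eps (F : C -> C -> C) (z w A B : C) :
  (forall eps : R, (0 < eps)%R -> exists d : R, (0 < d)%R /\ forall z' w',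
    (Cmod (z' - z) < d)%R -> (Cmod (w' - w) < d)%R ->
    (Cmod (F z' w' - F z w - ((z' - z) * A + (w' - w) * B))
      <= eps * (Cmod (z' - z) + Cmod (w' - w)))%R) ->
  ex_filterdiff (K := C_AbsRing)
    (U := prod_NormedModule C_AbsRing C_NormedModule C_NormedModule) (V := C_NormedModule)
    (fun p => F (fst p) (snd p))
    (locally (T := prod_NormedModule C_AbsRing C_NormedModule C_NormedModule) (z, w)).
Proof.
intros H. exists (fun p => fst p * A + snd p * B). split; [apply is_linear_pair|].
intros p Hp.
apply (is_filter_lim_locally_unique (V := prod_NormedModule C_AbsRing C_NormedModule C_NormedModule)) in Hp.
rewrite <- Hp. intros eps.
assert (He : (0 < eps / 2)%R) by (assert (P := cond_pos eps); lra).
destruct (H _ He) as [d [Hd HH]].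
apply locally_C2. exists d; split; [exact Hd|]. intros z' w' Hz Hw.
change (Cmod (F z' w' - F z w - ((z' - z) * A + (w' - w) * B))
  <= eps * sqrt (Cmod (z' - z) ^ 2 + Cmod (w' - w) ^ 2))%R.
eapply Rle_trans; [now apply HH|].
set (h := Cmod (z' - z)) in *. set (k := Cmod (w' - w)) in *.
assert (Px : (0 <= h)%R) by apply Cmod_ge_0. assert (Py : (0 <= k)%R) by apply Cmod_ge_0.
set (s := sqrt (h ^ 2 + k ^ 2)).
assert (Sx : (h <= s)%R).
{ unfold s. rewrite <- (sqrt_pow2 h) at 1 by exact Px. apply sqrt_le_1_alt. nra. }
assert (Sy : (k <= s)%R).
{ unfold s. rewrite <- (sqrt_pow2 k) at 1 by exact Py. apply sqrt_le_1_alt. nra. }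
replace (eps * s)%R with (eps / 2 * (s + s))%R by field.
apply Rmult_le_compat_l; lra.
Qed.

Lemma holomorphic_lser (a : nat -> nat -> C) : dgrowth a -> holomorphic_De2 (lser a).
Proof.
intros Ha z w Hz Hw. apply (ex_filterdiff_eps (lser a)) with
  (A := - (/ z * / z) * dser (Dx a) (/ z) (/ w)) (B := - (/ w * / w) * dser (Dy a) (/ z) (/ w)).
exact (dser_frechet a Cinv Cinv z w _ _ Ha (De_inv_disc z Hz) (De_inv_disc w Hw)
  (is_C_derive_Cinv z (De_neq_0 z Hz)) (is_C_derive_Cinv w (De_neq_0 w Hw))).
Qed.

Section Pivot.

Variable a : nat -> nat -> C.
Hypothesis Ga : dgrowth a.
Hypothesis Ba : bordered_zero a.
Hypothesis Sa : forall m n, a m n = a n m.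

Let J (j k : nat) (z w : C) : C := lser (jet a j k) z w.

(* The [w]-derivative of [h z w = (z - w) exp (Q z w)]. *)
Definition hw (z w : C) : C := Cexp (lser a z w) * (- (1) + (z - w) * lser (jet a 0 1) z w).

(** The common first integral of the two equations: each of them is equivalent to it, and it is what
    integrates to [psi]. *)
Definition pivot : Prop := forall z w, De z -> De w -> hw z w = - Cexp (lser a w w).

Lemma Cexp_lser_derive_z (z w : C) : De z -> De w ->
  is_C_derive (fun z => Cexp (lser a z w)) z (J 1 0 z w * Cexp (lser a z w)).
Proof.
intros Hz Hw. apply (is_C_derive_comp Cexp (fun z => lser a z w)); [apply is_C_derive_Cexp|].
exact (jet_derive_z a 0 0 z w Ga Hz Hw).
Qed.

Lemma Cexp_lser_derive_w (z w : C) : De z -> De w ->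
  is_C_derive (fun w => Cexp (lser a z w)) w (J 0 1 z w * Cexp (lser a z w)).
Proof.
intros Hz Hw. apply (is_C_derive_comp Cexp (fun w => lser a z w)); [apply is_C_derive_Cexp|].
exact (jet_derive_w a 0 0 z w Ga Hz Hw).
Qed.

Lemma h_derive_w (z w : C) : De z -> De w ->
  is_C_derive (fun w => (z - w) * Cexp (lser a z w)) w (hw z w).
Proof.
intros Hz Hw. eapply is_C_derive_eq.
- apply (is_C_derive_mult (fun w => z - w)); [|now apply Cexp_lser_derive_w].
  apply is_C_derive_minus; [apply is_C_derive_const|apply is_C_derive_id].
- cbv beta. unfold hw, J. ring.
Qed.

Lemma hw_derive_z (z w : C) : De z -> De w ->
  is_C_derive (fun z => hw z w) z (Cexp (lser a z w) * wave a z w).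
Proof.
intros Hz Hw. eapply is_C_derive_eq.
- apply (is_C_derive_mult (fun z => Cexp (lser a z w))); [now apply Cexp_lser_derive_z|].
  apply is_C_derive_plus; [apply is_C_derive_const|].
  apply (is_C_derive_mult (fun z => z - w)).
  + apply is_C_derive_minus; [apply is_C_derive_id|apply is_C_derive_const].
  + exact (jet_derive_z a 0 1 z w Ga Hz Hw).
- cbv beta. unfold wave, J. ring.
Qed.

Lemma hw_derive_w (z w : C) : De z -> De w ->
  is_C_derive (fun w => hw z w) w
    (2 * J 0 1 w w * hw z w + Cexp (lser a z w) * riccati a z w).
Proof.
intros Hz Hw. eapply is_C_derive_eq.
- apply (is_C_derive_mult (fun w => Cexp (lser a z w))); [now apply Cexp_lser_derive_w|].
  apply is_C_derive_plus; [apply is_C_derive_const|].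
  apply (is_C_derive_mult (fun w => z - w)).
  + apply is_C_derive_minus; [apply is_C_derive_const|apply is_C_derive_id].
  + exact (jet_derive_w a 0 1 z w Ga Hz Hw).
- cbv beta. unfold riccati, hw, J.
  replace (RtoC 2) with (1 + 1) by (apply injective_projections; simpl; ring). ring.
Qed.

Lemma Cexp_diag_derive (w : C) : De w ->
  is_C_derive (fun w => Cexp (lser a w w)) w (2 * J 0 1 w w * Cexp (lser a w w)).
Proof.
intros Hw. eapply is_C_derive_eq.
- apply (is_C_derive_comp Cexp (fun w => lser a w w)); [apply is_C_derive_Cexp|].
  exact (jet_derive_diag a 0 0 w Ga Hw).
- assert (E := jet_diag_sym a Sa 1 0 w). cbv beta zeta in E. rewrite E. unfold J.
  replace (RtoC 2) with (1 + 1) by (apply injective_projections; simpl; ring). ring.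
Qed.

Lemma jet01_row0 (n : nat) : jet a 0 1 0 n = 0.
Proof. destruct Ba as [B1 B2]. unfold jet; simpl. destruct n; simpl; [reflexivity|rewrite B2; ring]. Qed.

(** The factor [z - w] is unbounded, but [jet a 0 1] has no row 0 and releases a factor [x], with
    [(z - w) x = 1 - x w]. *)
Lemma hw_lim_z (w : C) : De w ->
  filterlim (fun z => hw z w) C_infty
    (locally (T := C_UniformSpace) (dser (ush (jet a 0 1)) 0 (/ w) - 1)).
Proof.
intros Hw. assert (Nw := De_neq_0 w Hw). assert (Dy := De_inv_disc w Hw).
assert (Gj := dgrowth_jet a 0 1 Ga). assert (Gu := dgrowth_ush _ Gj).
set (g := fun x => Cexp (dser a x (/ w)) * (- (1) + (1 - x * w) * dser (ush (jet a 0 1)) x (/ w))).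
replace (dser (ush (jet a 0 1)) 0 (/ w) - 1) with (g 0).
2:{ unfold g. rewrite dser_x0_zero by assumption. rewrite Cexp_0. ring. }
apply filterlim_C_infty_continuous.
- unfold g. apply continuous_Cmult.
  + apply continuous_Cexp. now apply (continuous_dser_x a 0 (/ w) Ga disc_0).
  + apply continuous_Cplus; [apply continuous_const|]. apply continuous_Cmult.
    * apply continuous_Cminus; [apply continuous_const|].
      apply continuous_Cmult; [apply continuous_id|apply continuous_const].
    * now apply (continuous_dser_x _ 0 (/ w) Gu disc_0).
- intros x Nx Hx. unfold hw, g, lser. rewrite Cinv_involutive by exact Nx.
  rewrite (dser_ush (jet a 0 1) x (/ w) Gj jet01_row0 Hx Dy). field. exact Nx.
Qed.

(** The wave equation makes [hw z w] independent of [z], and its value is read off at [z = w]. *)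
Lemma wave_pivot : (forall z w, De z -> De w -> wave a z w = 0) <-> pivot.
Proof.
split.
- intros H z w Hz Hw.
  assert (K : forall z, De z -> hw z w = dser (ush (jet a 0 1)) 0 (/ w) - 1).
  { apply De_const; [|now apply hw_lim_z]. intros z' Hz'.
    eapply is_C_derive_eq; [now apply hw_derive_z|]. rewrite H by assumption. ring. }
  rewrite (K z Hz), <- (K w Hw). unfold hw. ring.
- intros H z w Hz Hw.
  apply (Cmult_cancel_l (Cexp (lser a z w))); [apply Cexp_neq_0|].
  rewrite Cmult_0_r. apply (is_C_derive_uniq (fun z => hw z w) z); [now apply hw_derive_z|].
  destruct (De_nbhd z Hz) as [d [Hd Dd]].
  apply (is_C_derive_ext_loc (fun _ => - Cexp (lser a w w)) _ z _ d Hd); [|apply is_C_derive_const].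
  intros y Hy. symmetry. apply H; auto.
Qed.

(** The factor [z - w] is absorbed as in [hw_lim_z]: [jet a 0 1] starts at [y^2], so [w] times it
    still tends to 0. *)
Lemma hw_exp_lim_w (z : C) : De z ->
  filterlim (fun w => hw z w * Cexp (- lser a w w)) C_infty (locally (T := C_UniformSpace) (- (1))).
Proof.
intros Hz. assert (Nz := De_neq_0 z Hz). assert (Dx' := De_inv_disc z Hz). set (x := / z) in *.
destruct Ba as [B1 B2].
assert (Gj := dgrowth_jet a 0 1 Ga). assert (Gv := dgrowth_vsh _ Gj).
assert (J0 : forall m, jet a 0 1 m 0%nat = 0) by reflexivity.
assert (V0 : dser (vsh (jet a 0 1)) x 0 = 0).
{ apply (is_Cseries_unique _ _ _ (dser_y0 _ x Gv Dx')). apply is_Cseries_zero. intros n.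
  unfold vsh, jet; simpl. ring. }
set (g := fun y => Cexp (dser a x y) * (- (1) + (z * dser (jet a 0 1) x y - dser (vsh (jet a 0 1)) x y))
   * Cexp (- dser a y y)).
replace (- (1)) with (g 0).
2:{ unfold g. rewrite dser_y0_zero, V0, (dser_vsh (jet a 0 1) x 0 Gj J0 Dx' disc_0), V0, dser_00, B1 by assumption.
    replace (- 0) with (RtoC 0) by ring. rewrite !Cexp_0. ring. }
apply filterlim_C_infty_continuous.
- unfold g. apply continuous_Cmult; [apply continuous_Cmult|].
  + apply continuous_Cexp. now apply (continuous_dser_y a x 0 Ga Dx' disc_0).
  + apply continuous_Cplus; [apply continuous_const|]. apply continuous_Cminus.
    * apply continuous_Cmult; [apply continuous_const|].
      now apply (continuous_dser_y _ x 0 Gj Dx' disc_0).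
    * now apply (continuous_dser_y _ x 0 Gv Dx' disc_0).
  + apply continuous_Cexp, continuous_Copp.
    apply (dser_continuous_comp a (fun y => y) (fun y => y) (RtoC 0));
      [exact Ga|exact disc_0|exact disc_0|apply continuous_id|apply continuous_id].
- intros y Ny Hy. unfold hw, g, lser. fold x. rewrite Cinv_involutive by exact Ny.
  rewrite (dser_vsh (jet a 0 1) x y Gj J0 Dx' Hy). f_equal. f_equal. field. exact Ny.
Qed.

(** For fixed [z] the Riccati equation is a linear equation in [w] for [hw], with integrating factor
    [exp (- Q(w, w))]; the limit -1 at [w = oo] determines the solution. *)
Lemma riccati_pivot : (forall z w, De z -> De w -> riccati a z w = 0) <-> pivot.
Proof.
split.
- intros H z w Hz Hw.
  assert (K : hw z w * Cexp (- lser a w w) = - (1)).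
  { apply (De_const (fun w => hw z w * Cexp (- lser a w w))); auto.
    - clear w Hw. intros w Hw. eapply is_C_derive_eq.
      + apply (is_C_derive_mult (fun w => hw z w)); [now apply hw_derive_w|].
        apply (is_C_derive_comp Cexp (fun w => - lser a w w)); [apply is_C_derive_Cexp|].
        apply is_C_derive_opp. exact (jet_derive_diag a 0 0 w Ga Hw).
      + rewrite H by assumption.
        assert (E := jet_diag_sym a Sa 1 0 w). cbv beta zeta in E. rewrite E. unfold J.
        replace (RtoC 2) with (1 + 1) by (apply injective_projections; simpl; ring). ring.
    - now apply hw_exp_lim_w. }
  rewrite Cexp_opp in K. assert (N := Cexp_neq_0 (lser a w w)).
  replace (hw z w) with (hw z w * / Cexp (lser a w w) * Cexp (lser a w w)) by (field; exact N).
  rewrite K. ring.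
- intros H z w Hz Hw.
  apply (Cmult_cancel_l (Cexp (lser a z w))); [apply Cexp_neq_0|].
  assert (K : is_C_derive (fun w => hw z w) w (- (2 * J 0 1 w w * Cexp (lser a w w)))).
  { destruct (De_nbhd w Hw) as [d [Hd Dd]].
    apply (is_C_derive_ext_loc (fun w => - Cexp (lser a w w)) _ w _ d Hd).
    - intros y Hy. symmetry. apply H; auto.
    - apply is_C_derive_opp. now apply Cexp_diag_derive. }
  assert (E := is_C_derive_uniq _ _ _ _ (hw_derive_w z w Hz Hw) K). rewrite H in E by assumption.
  replace (Cexp (lser a z w) * riccati a z w) with
    (2 * J 0 1 w w * - Cexp (lser a w w) + Cexp (lser a z w) * riccati a z w
     + 2 * J 0 1 w w * Cexp (lser a w w)) by ring.
  rewrite E. ring.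
Qed.

Lemma pivot_of_Sigma (psi : C -> C) (Qe : C -> C -> C) : Sigma psi -> Grunsky_symbol psi Qe ->
  (forall z w, De z -> De w -> Qe z w = lser a z w) -> pivot.
Proof.
intros [Hpsi _] [_ [H1 [H2 _]]] HQ z w Hz Hw.
assert (E : forall w, De w -> (z - w) * Cexp (lser a z w) = psi z - psi w).
{ intros v Hv. rewrite <- HQ by assumption. destruct (Ceq_dec z v) as [<-|N]; [ring|].
  rewrite H1 by assumption. field. intros F. apply N. replace z with (z - v + v) by ring. rewrite F. ring. }
rewrite <- HQ, H2 by assumption.
apply (is_C_derive_uniq (fun w => (z - w) * Cexp (lser a z w)) w); [now apply h_derive_w|].
destruct (De_nbhd w Hw) as [d [Hd Dd]].
apply (is_C_derive_ext_loc (fun w => psi z - psi w) _ w _ d Hd).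
- intros y Hy. symmetry. apply E; auto.
- eapply is_C_derive_eq.
  + apply is_C_derive_minus; [apply is_C_derive_const|].
    apply C_derive_correct; [exact 0|]. now apply Hpsi.
  + ring.
Qed.

(** This is [z - sum a_1n z^-n]. As [Z] tends to infinity, [(Z - z) exp Q(Z, z) = Z - z + sum a_1n
    z^-n + o(1)], which must be [psi Z - psi z] with [psi Z = Z + o(1)]. *)
Definition psi_of (z : C) : C := z - dser (ush a) 0 (/ z).

(** The limit of [hw z w] at [z = oo] is computed twice: from [pivot], and from row 1 of [a], where
    differentiation in [w] commutes with [ush]. *)
Lemma psi_of_derive (w : C) : pivot -> De w -> is_C_derive psi_of w (Cexp (lser a w w)).
Proof.
intros HP Hw. assert (Nw := De_neq_0 w Hw). assert (Dy := De_inv_disc w Hw).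
assert (Gu := dgrowth_ush a Ga).
assert (E : dser (ush (jet a 0 1)) 0 (/ w) - 1 = - Cexp (lser a w w)).
{ apply (C_infty_unique (fun z => hw z w)); [now apply hw_lim_z|].
  apply C_infty_eps. intros eps He. exists 1%R. intros z Hz. rewrite HP by assumption.
  replace (- Cexp (lser a w w) - - Cexp (lser a w w)) with (RtoC 0) by ring. now rewrite Cmod_0. }
replace (Cexp (lser a w w)) with (1 - dser (ush (jet a 0 1)) 0 (/ w)).
2:{ replace (Cexp (lser a w w)) with (- - Cexp (lser a w w)) by ring. rewrite <- E. ring. }
unfold psi_of. apply is_C_derive_minus; [apply is_C_derive_id|].
eapply is_C_derive_eq.
- apply (dser_chain (ush a) (fun _ => 0) (fun w => / w) w 0 (- (/ w * / w)) Gu disc_0 Dy);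
    [apply is_C_derive_const|now apply is_C_derive_Cinv].
- cbv beta. rewrite (dser_ext (ush (jet a 0 1)) (dw (ush a))) by (intros m [|n]; reflexivity).
  rewrite dser_dw by (auto using disc_0). ring.
Qed.

(** This fixes the constant in [psi_of_diff]. The unbounded parts of [(z - w) exp Q] and of
    [psi_of w] cancel. *)
Lemma h_psi_lim (z : C) : De z ->
  filterlim (fun w => (z - w) * Cexp (lser a z w) + psi_of w) C_infty
    (locally (T := C_UniformSpace) (psi_of z)).
Proof.
intros Hz. assert (Dx' := De_inv_disc z Hz). set (x := / z) in *.
assert (Gu := dgrowth_ush a Ga). destruct Ba as [B1 B2].
set (f := fun y => Cexp (dser a x y)).
assert (f0 : f 0 = 1) by (unfold f; rewrite dser_y0_zero by assumption; apply Cexp_0).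
assert (Df : is_C_derive f 0 (dser (Dy a) x 0)).
{ eapply is_C_derive_eq.
  - apply (is_C_derive_comp Cexp (fun y => dser a x y)); [apply is_C_derive_Cexp|].
    now apply (dser_derive_y a x 0 Ga Dx' disc_0).
  - rewrite (dser_y0_zero a x) by assumption. rewrite Cexp_0. ring. }
(* The difference quotient of [f] at 0, completed by the derivative. With [w = 1 / y] one has
   [w f = q + w], and this last [w] cancels the one in [psi_of w]. *)
set (q := fun y : C => if Ceq_dec y 0 then dser (Dy a) x 0 else (f y - 1) / y).
assert (Cq : continuous q (RtoC 0)).
{ apply continuous_Cmod. intros eps He. apply locally_C. rewrite is_C_derive_eps in Df.
  destruct (Df (eps / 2)%R ltac:(lra)) as [d [Hd HH]]. exists d; split; [exact Hd|].
  intros y Hy. unfold q. destruct (Ceq_dec 0 0) as [_|F]; [|contradiction].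
  destruct (Ceq_dec y 0) as [->|Ny].
  - replace (dser (Dy a) x 0 - dser (Dy a) x 0) with (RtoC 0) by ring. now rewrite Cmod_0.
  - specialize (HH y Hy). rewrite f0 in HH. replace (y - 0) with y in HH by ring.
    replace ((f y - 1) / y - dser (Dy a) x 0) with ((f y - 1 - y * dser (Dy a) x 0) / y) by (field; exact Ny).
    rewrite Cmod_div by exact Ny. assert (Py := proj1 (Cmod_gt_0 y) Ny).
    apply Rle_lt_trans with (eps / 2)%R; [|lra].
    apply Rmult_le_reg_r with (Cmod y); [exact Py|]. unfold Rdiv at 1.
    rewrite Rmult_assoc, Rinv_l by lra. lra. }
set (g := fun y => z * f y - q y - dser (ush a) 0 y).
replace (psi_of z) with (g 0).
2:{ unfold g, psi_of, q. destruct (Ceq_dec 0 0) as [_|F]; [|contradiction].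
    rewrite f0, dser_00. unfold ush at 1. rewrite B1. fold x.
    (* At [y = 0], [Dy a] gives column 1 of [a]; symmetry turns it into row 1, from which [psi_of]
       is defined. *)
    rewrite (dser_transpose (Dy a)).
    rewrite (is_Cseries_unique _ (dser (fun m n => Dy a n m) 0 x) (dser (ush a) 0 x)
      (dser_x0 _ x (dgrowth_transpose _ (dgrowth_Dy a Ga)) Dx')).
    - ring.
    - eapply is_Cseries_ext; [|apply (dser_x0 _ x Gu Dx')]. intros n. cbv beta. f_equal.
      unfold ush, Dy. rewrite Sa. simpl. ring. }
apply filterlim_C_infty_continuous.
- unfold g. apply continuous_Cminus; [apply continuous_Cminus|].
  + apply continuous_Cmult; [apply continuous_const|]. exact (is_C_derive_continuous f 0 _ Df).
  + exact Cq.
  + now apply (continuous_dser_y _ 0 0 Gu disc_0 disc_0).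
- intros y Ny Hy. unfold g, psi_of, lser. fold x. rewrite Cinv_involutive by exact Ny.
  change (Cexp (dser a x y)) with (f y). unfold q. destruct (Ceq_dec y 0) as [F|_]; [contradiction|].
  field. exact Ny.
Qed.

(** By [pivot] the sum [(z - w) exp Q + psi_of w] has derivative 0 in [w], so it equals its limit at
    [w = oo]. *)
Lemma psi_of_diff (z w : C) : pivot -> De z -> De w ->
  psi_of z - psi_of w = (z - w) * Cexp (lser a z w).
Proof.
intros HP Hz Hw.
assert (K : (z - w) * Cexp (lser a z w) + psi_of w = psi_of z).
{ apply (De_const (fun w => (z - w) * Cexp (lser a z w) + psi_of w)); auto.
  - clear w Hw. intros w Hw. eapply is_C_derive_eq.
    + apply is_C_derive_plus; [now apply h_derive_w|now apply psi_of_derive].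
    + rewrite HP by assumption. ring.
  - now apply h_psi_lim. }
rewrite <- K. ring.
Qed.

Lemma Sigma_psi_of : pivot -> Sigma psi_of.
Proof.
intros HP. split; [|split].
- intros z Hz. eexists. now apply psi_of_derive.
(* Univalence: the exponential has no zero, so [psi_of z = psi_of w] forces [z - w = 0]. *)
- intros z w Hz Hw E. assert (K := psi_of_diff z w HP Hz Hw). rewrite E in K.
  destruct (Ceq_dec (z - w) 0) as [Z|N].
  + replace z with (z - w + w) by ring. rewrite Z. ring.
  + exfalso. apply (Cmult_neq_0 _ _ N (Cexp_neq_0 (lser a z w))). rewrite <- K. ring.
- exists (fun n => - (1) * a 1%nat n). intros z Hz.
  assert (K := is_Cseries_scal (- (1)) _ _ (dser_x0 (ush a) (/ z) (dgrowth_ush a Ga) (De_inv_disc z Hz))).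
  replace (- (1) * dser (ush a) 0 (/ z)) with (psi_of z - z) in K by (unfold psi_of; ring).
  refine (is_Cseries_ext _ _ _ _ K). intros n. cbv beta.
  transitivity ((/ z) ^ n * (- (1) * a 1%nat n)); [unfold ush; ring|].
  exact (f_equal (fun p => p * (- (1) * a 1%nat n)) (eq_sym (pow_n_Cpow (/ z) n))).
Qed.

Lemma Grunsky_psi_of : pivot -> Grunsky_symbol psi_of (lser a).
Proof.
intros HP. split; [now apply holomorphic_lser|split; [|split; [|split]]].
- intros z w Hz Hw N. rewrite psi_of_diff by assumption. field.
  intros F. apply N. replace z with (z - w + w) by ring. rewrite F. ring.
- intros z Hz. symmetry. apply is_C_derive_unique. now apply psi_of_derive.
- intros w Hw. rewrite <- (dser_x0_zero a (/ w) Ga Ba (De_inv_disc w Hw)). now apply lser_lim_z.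
- intros z Hz. rewrite <- (dser_y0_zero a (/ z) Ga Ba (De_inv_disc z Hz)). now apply lser_lim_w.
Qed.

End Pivot.

(** The univalent function is eliminated: what remains is a condition on the coefficient array
    alone, with which (c) and (c') can be compared separately. *)
Lemma jet_coordinates_iff (Q : nat -> nat -> C -> C) :
  jet_coordinates Q <-> exists a, dgrowth a /\ bordered_zero a /\ (forall m n, a m n = a n m) /\
    has_jets Q a /\ pivot a.
Proof.
split.
- intros [psi [HS [Qe [HG HQ]]]].
  destruct (Grunsky_dser psi Qe HS HG) as [a [Ga [Ba [Sa HE]]]].
  exists a. split; [exact Ga|split; [exact Ba|split; [exact Sa|split]]].
  + intros j k z Hz. rewrite HQ by exact Hz. now apply dpartial_lser.
  + now apply (pivot_of_Sigma a Ga psi Qe).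
- intros [a [Ga [Ba [Sa [HJ HP]]]]]. exists (psi_of a). split; [now apply Sigma_psi_of|].
  exists (lser a). split; [now apply Grunsky_psi_of|].
  intros j k z Hz. rewrite HJ by exact Hz. symmetry. now apply dpartial_lser.
Qed.

Theorem theorem5p6 (Q : nat -> nat -> C -> C)
  (HQ : forall j k : nat, holomorphic_De (Q j k)) :
  (jet_coordinates Q <-> cond_a Q /\ cond_b Q /\ cond_c Q /\ cond_d Q) /\
  (jet_coordinates Q <-> cond_a Q /\ cond_b Q /\ cond_c' Q /\ cond_d Q).
Proof.
rewrite jet_coordinates_iff. split; split.
- intros [a [Ga [Ba [Sa [HJ HP]]]]].
  split; [now apply (has_jets_cond_a Q a)|split; [now apply (has_jets_cond_b Q a)|split]].
  + apply (wave_iff_cond_c a Ga Sa Q HJ). now apply wave_pivot.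
  + now apply (has_jets_cond_d Q a).
- intros [Ha [Hb [Hc Hd]]]. destruct (has_jets_of_conds Q HQ Ha Hb Hd) as [a [Ga [Ba [Sa HJ]]]].
  exists a. repeat split; auto; try apply Ba.
  apply wave_pivot; auto. now apply (wave_iff_cond_c a Ga Sa Q HJ).
- intros [a [Ga [Ba [Sa [HJ HP]]]]].
  split; [now apply (has_jets_cond_a Q a)|split; [now apply (has_jets_cond_b Q a)|split]].
  + apply (riccati_iff_cond_c' a Ga Sa Q HJ). now apply riccati_pivot.
  + now apply (has_jets_cond_d Q a).
- intros [Ha [Hb [Hc Hd]]]. destruct (has_jets_of_conds Q HQ Ha Hb Hd) as [a [Ga [Ba [Sa HJ]]]].
  exists a. repeat split; auto; try apply Ba.
  apply riccati_pivot; auto. now apply (riccati_iff_cond_c' a Ga Sa Q HJ).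
Qed.
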